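(* Consider the incentivized RL problem and the Hidden Hallucination algorithm described in the context, with an arbitrary prior $\mathbf{p}$. Fix parameters $\rho,\delta\in(0,1]$. Assume $r_{\mathrm{alt}}>0$ and $q_{\mathrm{pun}}:=q_{\mathrm{pun}}(\varepsilon_{\mathrm{pun}})>0$, where $\varepsilon_{\mathrm{pun}}=r_{\mathrm{alt}}\,\rho/(18H)$. Then the algorithm with punishment parameter $\varepsilon_{\mathrm{pun}}$ and appropriate phase length $N_{\mathrm{ph}}$ and target $n_{\mathrm{lrn}}$ is guaranteed to $(\rho,n)$-explore with probability at least $1-\delta$ by episode $K_{\rho,n}$, provided $n$ and $K_{\rho,n}$ are sufficiently large. Specifically, there are absolute constants $c_1,c_2$ such that it suffices to take \[n=n_{\mathrm{lrn}}\ \ge\ c_1\,\rho^{-2}r_{\mathrm{alt}}^{-2}H^4\Big(S+\log\frac{SAH}{\delta\rho\, r_{\mathrm{alt}}\, q_{\mathrm{pun}}}\Big),\qquad K_{\rho,n}=c_2\,n\,q_{\mathrm{pun}}^{-1}\rho^{-3}r_{\mathrm{alt}}^{-3}SAH^4.\] In particular one may take $K_{\rho,n}=q_{\mathrm{pun}}^{-1}\cdot\mathrm{poly}(\rho^{-1}r_{\mathrm{alt}}^{-1}SAH)\cdot\log(\delta^{-1}q_{\mathrm{pun}}^{-1})$.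
   Context: MDPs. Fix positive integers $S,A,H$. An MDP model $\mu$ specifies for each triple $(x,a,h)\in[S]\times[A]\times[H]$ a reward distribution $R_\mu(x,a,h)$ on $[0,1]$ (all supported on a common countable set) with mean $r_\mu(x,a,h)$, a transition distribution $p_\mu(\cdot\mid x,a,h)$ on $[S]$, and an initial distribution $p_\mu(\cdot\mid0)$. In an episode, $x_1\sim p_\mu(\cdot\mid0)$; at stage $h$ the agent observes $x_h$, picks $a_h$, receives $r_h\sim R_\mu(x_h,a_h,h)$ and moves to $x_{h+1}\sim p_\mu(\cdot\mid x_h,a_h,h)$. The trajectory is $(x_h,a_h,r_h,h)_{h\in[H]}$. $\Pi_{\mathrm{mkv}}$ is the set of deterministic Markov policies $\pi:[S]\times[H]\to[A]$; $\mathsf{P}^\pi_\mu$ is the trajectory law and $V(\pi,\mu)=\mathsf{E}^\pi_\mu[\sum_h r_\mu(x_h,a_h,h)]$. A triple $(x,a,h)$ is visited in an episode if $(x_h,a_h)=(x,a)$. Incentivized RL. A prior $\mathbf{p}$ over models is known to all; $\mu_\star\sim\mathbf{p}$ is unknown. In each episode $k$ the principal chooses a signal $\sigma_k$ via a known algorithm from past trajectories; agent $k$ chooses $\pi_k\in\arg\max_{\pi\in\Pi_{\mathrm{mkv}}}\mathbb{E}[V(\pi,\mu_\star)\mid\sigma_k]$ (fixed known tie-breaking; expectation over all randomness); $\pi_k$ is run in $\mu_\star$ and the principal observes the trajectory $\tau_k$. A triple is $\rho$-reachable if some $\pi\in\Pi_{\mathrm{mkv}}$ has $\mathsf{P}^\pi_{\mu_\star}[(x_h,a_h)=(x,a)]\ge\rho$;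 the algorithm has $(\rho,n)$-explored by episode $K$ if each $\rho$-reachable triple is visited in at least $n$ distinct episodes among the first $K$. Ledgers and canonical posteriors. A ledger $\lambda$ consists of a censoring set $\mathcal{U}_\lambda\subseteq[S]\times[A]\times[H]$ and a finite sequence $(\pi_i,\tau_i)_{i=1}^m$ of policies in $\Pi_{\mathrm{mkv}}$ and trajectories in which the reward at each stage $h$ with $(x_h,a_h,h)\in\mathcal{U}_\lambda$ is removed; it is partially-censored for arbitrary $\mathcal{U}_\lambda$ and totally-censored if $\mathcal{U}_\lambda$ is the set of all triples. The canonical posterior $\Pr_{\mathrm{can}}[\,\cdot\mid\lambda]$ (expectation $\mathbb{E}_{\mathrm{can}}$) is the conditional law of $\mu_\star$ given $\hat\lambda=\lambda$, where $\mu_\star\sim\mathbf{p}$ and $\hat\lambda$ is obtained by running each fixed (non-random) policy $\pi_1,\dots,\pi_m$ once, independently, in $\mu_\star$ and removing rewards at triples in $\mathcal{U}_\lambda$; conditioning additionally on an event $\mathcal{E}$ about $\mu_\star$ is defined analogously. Define $q_{\mathrm{pun}}(\epsilon):=\min_{\lambda\text{ totally-censored}}\Pr_{\mathrm{can}}[r_{\mu_\star}(x,a,h)\le\epsilon\ \forall(x,a,h)\mid\lambda]$ and $r_{\mathrm{alt}}:=\min_{\lambda\text{ partially-censored}}\min_{(x,a,h)\in\mathcal{U}_\lambda}\mathbb{E}_{\mathrm{can}}[r_{\mu_\star}(x,a,h)\mid\lambda]$. Algorithm (Hidden Hallucination for MDPs), inputs $N_{\mathrm{ph}},n_{\mathrm{lrn}},\varepsilon_{\mathrm{pun}}>0$.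 Phase $\ell$ consists of episodes $(\ell-1)N_{\mathrm{ph}}+1,\dots,\ell N_{\mathrm{ph}}$, and a hallucination episode $k_\ell$ is drawn uniformly from it. A triple is fully explored at phase $\ell$ if visited in at least $n_{\mathrm{lrn}}$ of the episodes $k_1,\dots,k_{\ell-1}$; $\mathcal{U}_\ell$ denotes the set of under-explored triples. Raw ledger at phase $\ell$: the pairs $(\pi_{k_j},\tau_{k_j})$, $j<\ell$; censored ledger $\lambda_{\mathrm{cens},\ell}$: all rewards removed; honest ledger $\lambda_{\mathrm{hon},\ell}$: censoring set $\mathcal{U}_\ell$. Punish event $\mathcal{E}_{\mathrm{pun},\ell}=\{r_{\mu_\star}(x,a,h)\le\varepsilon_{\mathrm{pun}}\ \forall (x,a,h)\notin\mathcal{U}_\ell\}$. At $k=k_\ell$ draw $\mu_{\mathrm{hal},\ell}$ from the posterior of $\mu_\star$ given $\lambda_{\mathrm{cens},\ell}$ and $\mathcal{E}_{\mathrm{pun},\ell}$, and form the hallucinated ledger $\lambda_{\mathrm{hal},\ell}$: censoring set $\mathcal{U}_\ell$, and each occurrence of a fully explored triple $(x,a,h)$ given an independent reward drawn from $R_{\mu_{\mathrm{hal},\ell}}(x,a,h)$. The signal is $\lambda_{\mathrm{hal},\ell}$ at $k=k_\ell$ and $\lambda_{\mathrm{hon},\ell}$ at the other episodes of phase $\ell$. *)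

(* Defs.v *)
From HB Require Import structures.
From mathcomp Require Import all_boot all_order all_algebra.
From mathcomp Require Import all_classical all_reals.
From mathcomp Require Import ereal topology normedtype sequences esum exp
  measure lebesgue_measure lebesgue_integral probability.

Set Implicit Arguments.
Unset Strict Implicit.
Unset Printing Implicit Defensive.

Import Order.TTheory GRing.Theory Num.Theory.
Local Open Scope classical_set_scope.
Local Open Scope ring_scope.

(* States are 'I_S, actions 'I_A, stages 'I_H (stage h of the paper is the   *)
(* ordinal h-1).  All reward distributions are supported on the common       *)
(* countable set  range rv  (rv : nat -> R, injective, values in [0,1]); a   *)
(* reward distribution is therefore a pmf over the index set nat, and an     *)
(* observed reward is recorded by its index (equivalent to recording the     *)
(* value, since rv is injective).                                            *)

Record mdp_model (R : realType) (S A H : nat) := MdpModel {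
  rew   : 'I_S -> 'I_A -> 'I_H -> nat -> R;   (* R_mu(x,a,h) as a pmf on indices *)
  trans : 'I_S -> 'I_A -> 'I_H -> 'I_S -> R;
  init  : 'I_S -> R
}.

Definition tri (S A H : nat) := ('I_S * 'I_A * 'I_H)%type.
Definition policy (S A H : nat) := {ffun 'I_S * 'I_H -> 'I_A}.
(* full trajectory: stage h |-> (x_h, a_h, index of r_h) *)
Definition ftraj (S A H : nat) := {ffun 'I_H -> 'I_S * 'I_A * nat}.
(* trajectory as recorded in a ledger: reward possibly removed *)
Definition ctraj (S A H : nat) := {ffun 'I_H -> 'I_S * 'I_A * option nat}.
(* ledger = (censoring set U, sequence of (policy, censored trajectory)) *)
Definition ledger (S A H : nat) :=
  ({set tri S A H} * seq (policy S A H * ctraj S A H))%type.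
Definition rawledger (S A H : nat) := seq (policy S A H * ftraj S A H).

Section MDP.
Context (R : realType) (S A H : nat).
Local Notation model := (mdp_model R S A H).
Local Notation tri := (tri S A H).
Local Notation policy := (policy S A H).
Local Notation ftraj := (ftraj S A H).
Local Notation ctraj := (ctraj S A H).
Local Notation ledger := (ledger S A H).
Local Notation rawledger := (rawledger S A H).

Definition model_valid (mu : model) : Prop :=
  [/\ (forall x a h n, 0 <= rew mu x a h n) /\
      (forall x a h, \esum_(n in [set: nat]) (rew mu x a h n)%:E = 1%E),
      (forall x a h y, 0 <= trans mu x a h y) /\
      (forall x a h, \sum_(y : 'I_S) trans mu x a h y = 1) &
      (forall y, 0 <= init mu y) /\ \sum_(y : 'I_S) init mu y = 1].

Definition next_stage (h : 'I_H) : option 'I_H := insub h.+1.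
Definition first_stage : option 'I_H := insub 0%N.

Definition rmean (rv : nat -> R) (mu : model) (t : tri) : R :=
  fine (\esum_(n in [set: nat]) (rew mu t.1.1 t.1.2 t.2 n * rv n)%:E).

Definition path_prob (mu : model) (pi : policy) (x : {ffun 'I_H -> 'I_S}) : R :=
  (if first_stage is Some h0 then init mu (x h0) else 1) *
  \prod_(h : 'I_H)
     (if next_stage h is Some h' then trans mu (x h) (pi (x h, h)) h (x h') else 1).

Definition value (rv : nat -> R) (pi : policy) (mu : model) : R :=
  \sum_(x : {ffun 'I_H -> 'I_S})
     path_prob mu pi x * \sum_(h : 'I_H) rmean rv mu (x h, pi (x h, h), h).

Definition occupancy (mu : model) (pi : policy) (t : tri) : R :=
  \sum_(x : {ffun 'I_H -> 'I_S} | (x t.2 == t.1.1) && (pi (t.1.1, t.2) == t.1.2))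
     path_prob mu pi x.

Definition reachable (rho : R) (mu : model) (t : tri) : Prop :=
  exists pi : policy, rho <= occupancy mu pi t.

Definition visits (t : tri) (tau : ftraj) : bool :=
  [exists h : 'I_H, t == ((tau h).1, h)].

Definition ftraj_prob (mu : model) (pi : policy) (tau : ftraj) : R :=
  (if first_stage is Some h0 then init mu (tau h0).1.1 else 1) *
  \prod_(h : 'I_H)
    ((if next_stage h is Some h' then
        trans mu (tau h).1.1 (tau h).1.2 h (tau h').1.1 else 1) *
     ((tau h).1.2 == pi ((tau h).1.1, h))%:R *
     rew mu (tau h).1.1 (tau h).1.2 h (tau h).2).

Definition ctraj_lik (mu : model) (U : {set tri}) (pi : policy) (tau : ctraj) : R :=
  (if first_stage is Some h0 then init mu (tau h0).1.1 else 1) *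
  \prod_(h : 'I_H)
    ((if next_stage h is Some h' then
        trans mu (tau h).1.1 (tau h).1.2 h (tau h').1.1 else 1) *
     ((tau h).1.2 == pi ((tau h).1.1, h))%:R *
     (if ((tau h).1, h) \in U then ((tau h).2 == None)%:R
      else if (tau h).2 is Some r then rew mu (tau h).1.1 (tau h).1.2 h r else 0)).

(* likelihood of a ledger: each listed policy run once, independently *)
Definition ledger_lik (mu : model) (lam : ledger) : R :=
  \prod_(e <- lam.2) ctraj_lik mu lam.1 e.1 e.2.

Definition censor (U : {set tri}) (tau : ftraj) : ctraj :=
  [ffun h => ((tau h).1, if ((tau h).1, h) \in U then None else Some (tau h).2)].

Definition cskel (tau : ctraj) : {ffun 'I_H -> 'I_S * 'I_A} := [ffun h => (tau h).1].
Definition fskel (tau : ftraj) : {ffun 'I_H -> 'I_S * 'I_A} := [ffun h => (tau h).1].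

Definition totally_censored (lam : ledger) : Prop := lam.1 = [set: tri]%SET.

End MDP.

(* The prior p is the law of mdl under a probability P on an abstract        *)
(* measurable space M (mu_star = mdl omega, omega ~ P).                      *)
Section Prior.
Context (R : realType) (S A H : nat) (d : measure_display) (M : measurableType d)
  (P : probability M R) (mdl : M -> mdp_model R S A H) (rv : nat -> R).
Local Notation tri := (tri S A H).
Local Notation policy := (policy S A H).
Local Notation ftraj := (ftraj S A H).
Local Notation ctraj := (ctraj S A H).
Local Notation ledger := (ledger S A H).
Local Notation rawledger := (rawledger S A H).

Definition ledger_marg (lam : ledger) : R :=
  fine (\int[P]_w (ledger_lik (mdl w) lam)%:E).

Definition can_prob (E : set M) (lam : ledger) : R :=
  fine (\int[P]_(w in E) (ledger_lik (mdl w) lam)%:E) / ledger_marg lam.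

Definition can_exp (f : M -> R) (lam : ledger) : R :=
  fine (\int[P]_w (f w * ledger_lik (mdl w) lam)%:E) / ledger_marg lam.

(* minima over ledgers of positive probability (read as infima) *)
Definition q_pun (eps : R) : R :=
  inf [set q | exists lam : ledger, [/\ totally_censored lam, 0 < ledger_marg lam &
         q = can_prob [set w | forall t : tri, rmean rv (mdl w) t <= eps] lam]].

Definition r_alt : R :=
  inf [set r | exists (lam : ledger) (t : tri), [/\ 0 < ledger_marg lam, t \in lam.1 &
         r = can_exp (fun w => rmean rv (mdl w) t) lam]].

(* Episodes are numbered 1,2,...; phase l >= 1 consists of the episodes      *)
(* kidx l i = (l-1) N + i + 1, i : 'I_N.                                     *)
Variables (N nlrn : nat) (eps : R).

Definition kidx (l : nat) (i : 'I_N) : nat := ((l.-1) * N + i).+1.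

Definition under_explored (rl : rawledger) : {set tri} :=
  [set t | (count (fun e => visits t e.2) rl < nlrn)%N]%SET.

Definition honest_ledger (rl : rawledger) : ledger :=
  (under_explored rl, [seq (e.1, censor (under_explored rl) e.2) | e <- rl]).

Definition censored_ledger (rl : rawledger) : ledger :=
  ([set: tri]%SET, [seq (e.1, censor [set: tri]%SET e.2) | e <- rl]).

Definition punish_event (rl : rawledger) : set M :=
  [set w | forall t : tri, t \notin under_explored rl -> rmean rv (mdl w) t <= eps].

(* law of the hallucinated ledger: mu_hal drawn from the canonical posterior
   given the censored ledger and the punish event; every occurrence of a fully
   explored triple receives an independent reward from R_{mu_hal}.  Its
   probability of being lam' is the posterior expectation of the product of
   the drawn reward probabilities, i.e. the ratio below. *)
Definition hal_prob (rl : rawledger) (lam' : ledger) : R :=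
  ((lam'.1 == under_explored rl) &&
   ([seq (e.1, cskel e.2) | e <- lam'.2] == [seq (e.1, fskel e.2) | e <- rl]))%:R *
  (fine (\int[P]_(w in punish_event rl) (ledger_lik (mdl w) lam')%:E) /
   fine (\int[P]_(w in punish_event rl) (ledger_lik (mdl w) (censored_ledger rl))%:E)).

(* outcome of one phase: hallucination offset (k_l = kidx l o), hallucinated
   ledger, trajectories of the N episodes of the phase *)
Definition phase_out := ('I_N * ledger * {ffun 'I_N -> ftraj})%type.

Variable pol : nat -> ledger -> policy.

Definition new_entry (l : nat) (ph : phase_out) : policy * ftraj :=
  (pol (kidx l ph.1.1) ph.1.2, ph.2 ph.1.1).

Fixpoint raw_after (l : nat) (rl : rawledger) (phs : seq phase_out) : rawledger :=
  if phs is ph :: rest then raw_after l.+1 (rcons rl (new_entry l ph)) rest else rl.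

Definition phase_prob (mu : mdp_model R S A H) (l : nat) (rl : rawledger)
    (ph : phase_out) : R :=
  N%:R^-1 * hal_prob rl ph.1.2 *
  \prod_(i : 'I_N)
     ftraj_prob mu (pol (kidx l i) (if i == ph.1.1 then ph.1.2 else honest_ledger rl))
       (ph.2 i).

Fixpoint hist_prob (mu : mdp_model R S A H) (l : nat) (rl : rawledger)
    (phs : seq phase_out) : R :=
  if phs is ph :: rest then
    phase_prob mu l rl ph * hist_prob mu l.+1 (rcons rl (new_entry l ph)) rest
  else 1.

(* Pr[ sigma_k = s | mu_star = mu ]: sum over the first (k-1)/N phases, the
   offset o and the hallucinated ledger lh of phase (k-1)/N + 1 *)
Definition signal_prob (k : nat) (mu : mdp_model R S A H) (s : ledger) : \bar R :=
  \esum_(z in [set z : seq phase_out * 'I_N * ledger |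
            size z.1.1 = (k.-1 %/ N)%N /\
            (if (z.1.2 : nat) == (k.-1 %% N)%N then z.2
             else honest_ledger (raw_after 1 [::] z.1.1)) = s])
    (hist_prob mu 1 [::] z.1.1 * N%:R^-1 * hal_prob (raw_after 1 [::] z.1.1) z.2)%:E.

Definition agent_value (k : nat) (s : ledger) (pi : policy) : R :=
  fine (\int[P]_w ((value rv pi (mdl w))%:E * signal_prob k (mdl w) s)) /
  fine (\int[P]_w signal_prob k (mdl w) s).

Definition best_responses : Prop :=
  forall (k : nat) (s : ledger), (0 < k)%N ->
    forall pi : policy, agent_value k s pi <= agent_value k s (pol k s).

Fixpoint visit_count (t : tri) (K l : nat) (phs : seq phase_out) : nat :=
  if phs is ph :: rest then
    (\sum_(i : 'I_N) ((kidx l i <= K)%N && visits t (ph.2 i)) + visit_count t K l.+1 rest)%N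
  else 0%N.

Definition explored (rho : R) (n K : nat) (mu : mdp_model R S A H)
    (phs : seq phase_out) : Prop :=
  forall t : tri, reachable rho mu t -> (n <= visit_count t K 1 phs)%N.

Definition explore_prob (rho : R) (n K : nat) : \bar R :=
  \int[P]_w (\esum_(phs in [set phs : seq phase_out |
                size phs = ((K + N.-1) %/ N)%N /\ explored rho n K (mdl w) phs])
                (hist_prob (mdl w) 1 [::] phs)%:E).

End Prior.

(* Submission.v *)
(* At each phase, the likelihood of the data given the model factors through the
   skeleton of the raw ledger, so the law of a signal is a mixture of an honest part,
   proportional to its canonical likelihood, and a hallucinated part of weight [1 / N].
   Hence for [N] large an agent who receives the hallucinated ledger acts almost
   optimally for its canonical posterior. That posterior concentrates on models which
   agree with the recorded frequencies, so rewards at the fully explored triples look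
   at most [eps_pun], while censored triples keep posterior mean at least [r_alt]; if
   some [rho]-reachable triple is censored, an optimal policy must therefore hit a
   censored triple with probability at least [p = r_alt * rho / (2 * H)].

   The exceptional events are controlled by exponential supermartingales along the
   phases (no union bound over policies is needed), transferred to hallucinated
   ledgers by a change of measure that costs a factor [1 / q_pun]. Outside of them
   the potential [2 ^ deficit], the deficit being the total number of missing visits,
   shrinks in expectation by the factor [1 - p / 2] at each phase. *)

Require Import Defs.
From HB Require Import structures.
From mathcomp Require Import all_boot all_order all_algebra.
From mathcomp Require Import all_classical all_reals.
From mathcomp Require Import ereal topology normedtype sequences esum exp
  measure lebesgue_measure lebesgue_integral probability.
From mathcomp Require Import measurable_realfun numfun.
From mathcomp Require Import ring lra zify.
Import Order.TTheory GRing.Theory Num.Theory.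
Local Open Scope classical_set_scope.
Local Open Scope ring_scope.

Set Implicit Arguments.
Unset Strict Implicit.
Unset Printing Implicit Defensive.

(** Agreement of a model with the data is measured by finitely many tests: a reward in either
    direction at a triple, a set of next states at a triple, a set of initial states. Testing all
    sets of states controls total variation; the number of tests is of order [S A H 2 ^ S], which is
    the origin of the term [S] in the threshold for [n].

    Under the posterior the rewards at censored triples may be correlated with the transitions, so
    the bound [r_alt] cannot be applied to the value of a policy directly. The value is therefore
    cut at the first censored triple. Up to that time only fully explored transitions are used, and
    these can be replaced by the transitions of the true model; what remains is linear in the
    censored rewards, with coefficients that are constant under the posterior.

    With [x = r_alt * rho] and [h = H], the choices [e = x / (72 h ^ 2)], [beta = x / (36 h)] and
    [N] of order [h / (q_pun x)] keep the losses in the incentive inequality below [x / 4], while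
    [h * p = x / 2] is to be reached. *)

Notation "\S_ x E" := (\esum_(x in [set: _]) E%E)
  (at level 36, x name, E at level 36, format "\S_ x  E") : ereal_scope.
Notation "\S_ ( x : T ) E" := (\esum_(x in [set: T]) E%E)
  (at level 36, x name, E at level 36, format "\S_ ( x  :  T )  E") : ereal_scope.

(** * Countable sums in the extended reals *)

Section Esum.
Context (R : realType).
Local Open Scope ereal_scope.

Lemma esumT_ge0 (T : choiceType) (f : T -> \bar R) :
  (forall x, 0 <= f x) -> 0 <= \S_x f x.
Proof. by move=> f0; apply: esum_ge0. Qed.

Lemma eq_esumT (T : choiceType) (f g : T -> \bar R) :
  f =1 g -> \S_x f x = \S_x g x.
Proof. by move=> fg; apply: eq_esum. Qed.

Lemma le_esumT (T : choiceType) (f g : T -> \bar R) :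
  (forall x, f x <= g x) -> \S_x f x <= \S_x g x.
Proof. by move=> fg; apply: le_esum. Qed.

Lemma esumTD (T : choiceType) (f g : T -> \bar R) :
  (forall x, 0 <= f x) -> (forall x, 0 <= g x) ->
  \S_x (f x + g x) = \S_x f x + \S_x g x.
Proof. by move=> f0 g0; apply: esumD. Qed.

Lemma reindex_esumT (T T' : choiceType) (e : T -> T') (f : T' -> \bar R) :
  bijective e -> \S_y f y = \S_x f (e x).
Proof.
move=> be; apply: reindex_esum; split => //.
  by move=> x y _ _; apply: (bij_inj be).
by case: be => g _ ge y _; exists (g y) => //; rewrite ge.
Qed.

Lemma esum_pair (T1 T2 : choiceType) (f : T1 -> T2 -> \bar R) :
  (forall x y, 0 <= f x y) -> \S_x \S_y f x y = \S_z f z.1 z.2.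
Proof.
move=> f0; rewrite esum_esum //; congr (esum _ _).
by apply/seteqP; split.
Qed.

Lemma esum_prod (T1 T2 : choiceType) (f : T1 * T2 -> \bar R) :
  (forall z, 0 <= f z) -> \S_(z : T1 * T2) f z = \S_(x : T1) \S_(y : T2) f (x, y).
Proof.
move=> f0; rewrite (esum_pair (f := fun x y => f (x, y))) //.
by apply: eq_esumT => -[].
Qed.

Lemma esum_exchange (T1 T2 : choiceType) (f : T1 -> T2 -> \bar R) :
  (forall x y, 0 <= f x y) -> \S_x \S_y f x y = \S_y \S_x f x y.
Proof.
move=> f0; rewrite !esum_pair //.
rewrite (reindex_esumT (fun z : T2 * T1 => f z.2 z.1) (e := fun z => (z.2, z.1))) //.
by exists (fun z => (z.2, z.1)) => -[].
Qed.

(** Enumeration by [pickle] turns the sum into a series, with [0] at the indices that encode no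
    element, so that the lemmas on series and their integrals apply. *)
Lemma esum_countE (T : countType) (f : T -> \bar R) :
  (forall x, 0 <= f x) ->
  \S_x f x = \sum_(n <oo) (oapp f 0 (@pickle_inv T n)).
Proof.
move=> f0; rewrite nneseries_esumT; last by move=> n; case: pickle_inv => /=.
pose D := [set n | @pickle_inv T n].
have -> : \S_n oapp f 0 (@pickle_inv T n) =
          \esum_(n in D) oapp f 0 (@pickle_inv T n).
  rewrite [RHS]esum_mkcond; apply: eq_esum => n _.
  case: ifPn => //; rewrite notin_setE /D /=.
  by case: (@pickle_inv T n) => //= x; case.
rewrite (reindex_esum [set: T] D pickle).
  by apply: eq_esum => x _; rewrite pickleK_inv.
split.
- by move=> x _; rewrite /D /= pickleK_inv.
- by move=> x y _ _; apply: (pcan_inj pickleK_inv).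
- move=> n; rewrite /D /=; case E: (@pickle_inv T n) => [x|] //= _.
  exists x => //; by have := @pickle_invK T n; rewrite /= E.
Qed.

Lemma esumTZl (T : countType) (c : R) (f : T -> \bar R) :
  (0 <= c)%R -> (forall x, 0 <= f x) -> \S_x (c%:E * f x) = c%:E * \S_x f x.
Proof.
move=> c0 f0; rewrite !esum_countE //; last by move=> x; rewrite mule_ge0.
transitivity (\sum_(n <oo) (c%:E * oapp f 0 (@pickle_inv T n))).
  by apply: eq_eseriesr => n _; case: pickle_inv => //=; rewrite mule0.
by rewrite nneseriesZl // => n _; case: pickle_inv => /=.
Qed.

Lemma esumTZr (T : countType) (c : R) (f : T -> \bar R) :
  (0 <= c)%R -> (forall x, 0 <= f x) -> \S_x (f x * c%:E) = (\S_x f x) * c%:E.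
Proof.
by move=> c0 f0; rewrite muleC -esumTZl //; apply: eq_esumT => x; rewrite muleC.
Qed.

Lemma esum_delta (T : choiceType) (a : T) (f : T -> \bar R) :
  0 <= f a -> (forall x, x != a -> f x = 0) -> \S_x f x = f a.
Proof.
move=> fa0 fx; rewrite -(@esum_set1 _ _ a) // [RHS]esum_mkcond.
apply: eq_esum => x _; case: ifPn => //; rewrite notin_setE /= => xa.
by apply: fx; apply/eqP.
Qed.

Lemma esum_fin (T : finType) (f : T -> \bar R) :
  (forall x, 0 <= f x) -> \S_x f x = \sum_(x : T) f x.
Proof.
move=> f0; have fT : finite_set [set: T] by exact: finite_finset.
rewrite esum_fset // fsbig_finite //=.
apply: perm_big; apply: uniq_perm; [exact: finmap.fset_uniq|exact: index_enum_uniq|move=> x].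
by rewrite mem_index_enum; apply: etrans (in_fset_set fT x) _; rewrite in_setT.
Qed.

Lemma esum_finR (T : finType) (f : T -> R) :
  (forall x, 0 <= f x)%R -> \S_x (f x)%:E = (\sum_(x : T) f x)%:E.
Proof. by move=> f0; rewrite esum_fin // ?sumEFin // => x; rewrite lee_fin. Qed.

Lemma esum_ge1 (T : choiceType) (f : T -> \bar R) a :
  (forall x, 0 <= f x) -> f a <= \S_x f x.
Proof.
move=> f0; rewrite -{1}(@esum_set1 _ _ a f) // esum_mkcond.
by apply: le_esumT => x; case: ifP.
Qed.

(** For [c = +oo] both sides are [+oo] as soon as one term is nonzero, and [0] otherwise. Extended
    real factors occur because the model-free weights of ledgers are themselves countable sums. *)
Lemma esumTZl_ereal (T : countType) (c : \bar R) (f : T -> \bar R) :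
  0 <= c -> (forall x, 0 <= f x) -> \S_x (c * f x) = c * \S_x f x.
Proof.
move=> + f0; case: c => [c| |] // c0; first exact: esumTZl.
case: (pselect (exists x, f x != 0)) => [[x fx]|fx].
  have fx0 : 0 < f x by rewrite lt0e fx f0.
  rewrite gt0_mulye; last exact: lt_le_trans fx0 (esum_ge1 x f0).
  apply/eqP; rewrite -leye_eq.
  apply: le_trans (esum_ge1 x _); first by rewrite gt0_mulye.
  by move=> y; rewrite mule_ge0.
have f00 x : f x = 0 by apply: contra_notP fx => /eqP ?; exists x.
by rewrite !esum1 ?mule0 // => x _; rewrite f00 ?mule0.
Qed.

(** The way to pass to an image law: raw ledgers are grouped by what censoring leaves of them, the
    trajectories of a phase by the one at the hallucination episode. *)
Lemma esum_fiber (T T' : countType) (g : T -> T') (f : T -> \bar R) :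
  (forall x, 0 <= f x) ->
  \S_x f x = \S_y \S_x ((g x == y)%:R%:E * f x).
Proof.
move=> f0; have h0 y x : 0 <= (g x == y)%:R%:E * f x.
  by rewrite mule_ge0 // lee_fin.
rewrite esum_exchange //; apply: eq_esumT => x.
rewrite (@esum_delta _ (g x)) ?eqxx ?mul1e // => y yx.
by rewrite eq_sym (negbTE yx) mul0e.
Qed.

Section Integral.
Context d (M : measurableType d) (P : {measure set M -> \bar R}) (T : countType).
Variable f : T -> M -> \bar R.
Hypothesis f0 : forall x w, 0 <= f x w.
Hypothesis mf : forall x, measurable_fun setT (f x).

Lemma measurable_esum : measurable_fun setT (fun w => \S_x f x w).
Proof.
under eq_fun do rewrite esum_countE //.
apply: ge0_emeasurable_sum => [n w _ _|n _]; case: pickle_inv => //=.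
Qed.

Lemma integral_esum : \int[P]_w (\S_x f x w) = \S_x \int[P]_w f x w.
Proof.
rewrite esum_countE; last by move=> x; apply: integral_ge0.
under eq_integral do rewrite esum_countE //.
rewrite integral_nneseries //; last 2 first.
- by move=> n; case: pickle_inv => //=.
- by move=> n w _; case: pickle_inv => //=.
apply: eq_eseriesr => n _; case: pickle_inv => //=.
exact: integral0.
Qed.

End Integral.

End Esum.

(** * Sums over finite powers of a type *)

Section FfunCons.
Context (T : Type) (n : nat).

Definition ffcons (x : T) (f : {ffun 'I_n -> T}) : {ffun 'I_n.+1 -> T} :=
  [ffun i => oapp f x (unlift ord0 i)].

Lemma ffcons0 x f : ffcons x f ord0 = x.
Proof. by rewrite ffunE unlift_none. Qed.

Lemma ffconsS x f i : ffcons x f (lift ord0 i) = f i.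
Proof. by rewrite ffunE liftK. Qed.

Lemma ffcons_bij : bijective (fun z : T * {ffun 'I_n -> T} => ffcons z.1 z.2).
Proof.
exists (fun f : {ffun 'I_n.+1 -> T} => (f ord0, [ffun i => f (lift ord0 i)])).
  case=> x f /=; rewrite ffcons0; congr pair.
  by apply/ffunP => i; rewrite ffunE ffconsS.
move=> f; apply/ffunP => i /=; rewrite ffunE.
by case: unliftP => [j ->|->] /=; rewrite ?ffunE.
Qed.

End FfunCons.

Lemma big_ffunS (R : realType) (T : finType) n (G : {ffun 'I_n.+1 -> T} -> R) :
  \sum_f G f = \sum_x \sum_f G (ffcons x f).
Proof.
rewrite pair_big /= (reindex (fun z : T * {ffun 'I_n -> T} => ffcons z.1 z.2)) //=.
exact/onW_bij/ffcons_bij.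
Qed.

Section EsumFfun.
Context (R : realType) (T : countType).
Local Open Scope ereal_scope.

Lemma esum_ffunS n (G : {ffun 'I_n.+1 -> T} -> \bar R) :
  (forall f, 0 <= G f) -> \S_f G f = \S_x \S_f G (ffcons x f).
Proof.
move=> G0; rewrite esum_pair //; apply: reindex_esumT; exact: ffcons_bij.
Qed.

(** Fubini for finitely many coordinates, by peeling off coordinate [0]. *)
Lemma esum_prod_ffun n (g : 'I_n -> T -> R) (s : 'I_n -> R) :
  (forall i x, 0 <= g i x)%R -> (forall i, \S_x (g i x)%:E = (s i)%:E) ->
  \S_(f : {ffun 'I_n -> T}) (\prod_(i < n) g i (f i))%R%:E = (\prod_(i < n) s i)%R%:E.
Proof.
elim: n g s => [|n IH] g s g0 gs.
  pose e : {ffun 'I_0 -> T} := ffun0 (card_ord 0).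
  rewrite big_ord0; apply: etrans (esum_delta (a := e) _ _) _.
  - by rewrite big_ord0 lee01.
  - by move=> x /eqP[]; apply/ffunP => -[].
  - by rewrite big_ord0.
rewrite esum_ffunS; last by move=> f; rewrite lee_fin prodr_ge0.
under eq_esumT => x.
  under eq_esumT => f.
    rewrite big_ord_recl ffcons0 EFinM.
    under eq_bigr do rewrite ffconsS.
    over.
  rewrite esumTZl //; last by move=> f; rewrite lee_fin prodr_ge0.
  rewrite (IH (fun i => g (lift ord0 i)) (fun i => s (lift ord0 i))) //.
  over.
have s0 i : (0 <= s i)%R.
  by rewrite -lee_fin -gs; apply: esumT_ge0 => x; rewrite lee_fin.
rewrite esumTZr ?prodr_ge0 //; last by move=> x; rewrite lee_fin.
by rewrite gs -EFinM big_ord_recl.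
Qed.

(** Marginal of a product law. Once [f o = y] is fixed, the indicator of this event is absorbed into
    the factor at [o], whose sum becomes [g o y] while the other sums remain [1]. *)
Lemma esum_prod_marginal n (g : 'I_n -> T -> R) (o : 'I_n) (F : T -> \bar R) :
  (forall i x, 0 <= g i x)%R -> (forall i, \S_x (g i x)%:E = 1) ->
  (forall x, 0 <= F x) ->
  \S_(f : {ffun 'I_n -> T}) ((\prod_(i < n) g i (f i))%R%:E * F (f o)) = \S_x ((g o x)%:E * F x).
Proof.
move=> g0 gs F0.
have p0 (f : {ffun 'I_n -> T}) : 0 <= (\prod_(i < n) g i (f i))%R%:E.
  by rewrite lee_fin prodr_ge0.
rewrite (esum_fiber (fun f : {ffun 'I_n -> T} => f o)); last first.
  by move=> f; rewrite mule_ge0.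
apply: eq_esumT => y.
pose g' i x := if i == o then (g o y * (x == y)%:R)%R else g i x.
transitivity (\S_(f : {ffun 'I_n -> T}) ((\prod_(i < n) g' i (f i))%R%:E * F y)).
  apply: eq_esumT => f; have [fy|fy] := eqVneq (f o) y.
    rewrite mul1e fy; congr (_%:E * _); apply: eq_bigr => i _; rewrite /g'.
    by have [->|//] := eqVneq i o; rewrite fy eqxx mulr1.
  by rewrite mul0e (bigD1 o) //= /g' eqxx (negbTE fy) mulr0 mul0r mul0e.
have g'0 i x : (0 <= g' i x)%R by rewrite /g'; case: ifP; rewrite ?mulr_ge0.
have -> : (g o y)%:E * F y = (\prod_(i < n) (if i == o then g o y else 1))%R%:E * F y.
  by congr (_%:E * _); rewrite -big_mkcond /= big_pred1_eq.
rewrite -(@esum_prod_ffun n g') //; last first.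
  move=> i; rewrite /g'; case: eqP => // _.
  under eq_esumT do rewrite EFinM.
  rewrite esumTZl //.
  rewrite (@esum_delta _ _ y) ?eqxx ?mule1 // => x /negbTE ->; exact: erefl.
have f0 (f : {ffun 'I_n -> T}) : 0 <= (\prod_(i < n) g' i (f i))%R%:E.
  by rewrite lee_fin prodr_ge0.
under eq_esumT do rewrite muleC.
by rewrite esumTZl_ereal // muleC.
Qed.

End EsumFfun.

(** * Time-inhomogeneous Markov chains on a finite set *)

Section Chain.
Context (R : realType) (T : finType) (k : nat -> T -> T -> R).

(** The last stage has no successor and contributes the factor [1]. The index [i] is the stage at
    which the path starts, so that inductions can shift paths. *)
Definition chain_weight n i (x : {ffun 'I_n.+1 -> T}) : R :=
  \prod_(h < n.+1)
    (if (insub h.+1 : option 'I_n.+1) is Some h' then k (i + h) (x h) (x h') else 1).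

Lemma chain_weight0 i (x : {ffun 'I_1 -> T}) : chain_weight i x = 1.
Proof. by rewrite /chain_weight big_ord1 insubF. Qed.

Lemma chain_weightS n i y (x : {ffun 'I_n.+1 -> T}) :
  chain_weight i (ffcons y x) = k i y (x ord0) * chain_weight i.+1 x.
Proof.
rewrite /chain_weight big_ord_recl addn0 ffcons0; congr (_ * _).
  rewrite (insubT (fun j => j < n.+2)%N (isT : (1 < n.+2)%N)) /=.
  by rewrite (_ : Sub _ _ = lift ord0 ord0) ?ffconsS //; apply: val_inj.
apply: eq_bigr => h _; rewrite ffconsS addSnnS.
have [hn|hn] := boolP (h.+1 < n.+1)%N.
  rewrite (insubT (fun j => j < n.+1)%N hn) (insubT (fun j => j < n.+2)%N (hn : h.+2 < n.+2)%N) /=.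
  congr (k _ _ _).
  by rewrite -(ffconsS y x); congr (ffcons y x _); apply: val_inj.
by rewrite !insubF //; apply/negbTE.
Qed.

(** Backward recursion for the expected sum of [c] over the stages [i] to [i + n] from state [y];
    [chain_hit] is the analogous probability of meeting [u]. *)
Fixpoint chain_value (c : nat -> T -> R) n i y : R :=
  c i y + if n is n'.+1 then \sum_z k i y z * chain_value c n' i.+1 z else 0.

Fixpoint chain_hit (u : nat -> T -> bool) n i y : R :=
  if u i y then 1
  else if n is n'.+1 then \sum_z k i y z * chain_hit u n' i.+1 z else 0.

Lemma sum_ffun1 (G : {ffun 'I_1 -> T} -> R) :
  \sum_x G x = \sum_y G [ffun=> y].
Proof.
rewrite (reindex (fun y => [ffun=> y] : {ffun 'I_1 -> T})) //.
exists (fun x : {ffun 'I_1 -> T} => x ord0) => [y _|x _]; first by rewrite ffunE.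
by apply/ffunP => j; rewrite ffunE (ord1 j).
Qed.

Lemma chain_sumS n i (a : T -> R) (G : {ffun 'I_n.+2 -> T} -> R) :
  \sum_(x : {ffun 'I_n.+2 -> T}) a (x ord0) * chain_weight i x * G x =
  \sum_y a y * \sum_(x : {ffun 'I_n.+1 -> T})
     k i y (x ord0) * chain_weight i.+1 x * G (ffcons y x).
Proof.
rewrite big_ffunS; apply: eq_bigr => y _; rewrite big_distrr; apply: eq_bigr => x _ /=.
by rewrite ffcons0 chain_weightS !mulrA.
Qed.

Lemma chain_sum0 i (a : T -> R) (G : {ffun 'I_1 -> T} -> R) :
  \sum_(x : {ffun 'I_1 -> T}) a (x ord0) * chain_weight i x * G x = \sum_y a y * G [ffun=> y].
Proof.
by rewrite sum_ffun1; apply: eq_bigr => y _; rewrite ffunE chain_weight0 mulr1.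
Qed.

(** Stated for substochastic kernels because it is applied to transition kernels tilted by an
    exponential factor. *)
Lemma chain_mass_le n i (a : T -> R) :
  (forall i y z, 0 <= k i y z) -> (forall i y, \sum_z k i y z <= 1) ->
  (forall y, 0 <= a y) ->
  \sum_(x : {ffun 'I_n.+1 -> T}) a (x ord0) * chain_weight i x <= \sum_y a y.
Proof.
move=> k0 k1; elim: n i a => [|n IH] i a a0.
  under eq_bigr do rewrite -[_ * _]mulr1.
  by rewrite (chain_sum0 _ _ (fun=> 1)); under eq_bigr do rewrite mulr1.
under eq_bigr do rewrite -[_ * _]mulr1.
rewrite (chain_sumS _ _ (fun=> 1)); apply: ler_sum => y _.
under eq_bigr do rewrite mulr1.
by rewrite ler_piMr // (le_trans (IH _ _ _)).
Qed.

Hypothesis k1 : forall i y, \sum_z k i y z = 1.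

Lemma chain_mass n i (a : T -> R) :
  \sum_(x : {ffun 'I_n.+1 -> T}) a (x ord0) * chain_weight i x = \sum_y a y.
Proof.
elim: n i a => [|n IH] i a.
  under eq_bigr do rewrite -[_ * _]mulr1.
  by rewrite (chain_sum0 _ _ (fun=> 1)); under eq_bigr do rewrite mulr1.
under eq_bigr do rewrite -[_ * _]mulr1.
rewrite (chain_sumS _ _ (fun=> 1)); apply: eq_bigr => y _.
under eq_bigr do rewrite mulr1.
by rewrite IH k1 mulr1.
Qed.

Lemma chain_valueP c n i (a : T -> R) :
  \sum_(x : {ffun 'I_n.+1 -> T})
    a (x ord0) * chain_weight i x * (\sum_(h < n.+1) c (i + h)%N (x h)) =
  \sum_y a y * chain_value c n i y.
Proof.
elim: n i a => [|n IH] i a.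
  rewrite (chain_sum0 _ _ (fun x => \sum_(h < 1) c (i + h)%N (x h))).
  by apply: eq_bigr => y _; rewrite big_ord1 ffunE addn0 /= addr0.
rewrite (chain_sumS _ _ (fun x => \sum_(h < n.+2) c (i + h)%N (x h))).
apply: eq_bigr => y _; congr (_ * _); rewrite [RHS]/= -IH.
rewrite -[c i y]mulr1 -(k1 i y) -(chain_mass n i.+1) mulr_sumr -big_split /=.
apply: eq_bigr => x _; rewrite big_ord_recl ffcons0 addn0 mulrDr [c i y * _]mulrC.
by congr (_ + _ * _); apply: eq_bigr => h _; rewrite ffconsS addSnnS.
Qed.

Lemma chain_hitP u n i (a : T -> R) :
  \sum_(x : {ffun 'I_n.+1 -> T})
    a (x ord0) * chain_weight i x * [exists h : 'I_n.+1, u (i + h)%N (x h)]%:R =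
  \sum_y a y * chain_hit u n i y.
Proof.
have exS (y : T) n' i' (x : {ffun 'I_n'.+1 -> T}) :
    [exists h : 'I_n'.+2, u (i' + h)%N (ffcons y x h)] =
    u i' y || [exists h : 'I_n'.+1, u (i'.+1 + h)%N (x h)].
  apply/existsP/orP => [[h]|[uy|/existsP[h uh]]].
  - case: (unliftP ord0 h) => [j|] -> ; rewrite ?ffconsS ?ffcons0 ?addn0; last by left.
    by move=> ux; right; apply/existsP; exists j; rewrite addSnnS.
  - by exists ord0; rewrite ffcons0 addn0.
  - by exists (lift ord0 h); rewrite ffconsS -addSnnS.
elim: n i a => [|n IH] i a.
  rewrite (chain_sum0 _ _ (fun x => [exists h : 'I_1, u (i + h)%N (x h)]%:R)).
  apply: eq_bigr => y _ /=; congr (_ * _).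
  suff -> : [exists h : 'I_1, u (i + h)%N ([ffun=> y] h)] = u i y by case: (u i y).
  apply/existsP/idP => [[h]|uy]; first by rewrite ffunE (ord1 h) addn0.
  by exists ord0; rewrite ffunE addn0.
rewrite (chain_sumS _ _ (fun x => [exists h : 'I_n.+2, u (i + h)%N (x h)]%:R)).
apply: eq_bigr => y _; congr (_ * _) => /=.
under eq_bigr do rewrite exS.
case: (u i y) => /=; last exact: IH.
by under eq_bigr do rewrite mulr1; rewrite chain_mass.
Qed.

End Chain.

(** * Trajectories and ledgers *)

Section Traj.
Context (R : realType) (S A H' : nat).
Local Notation H := H'.+1.
Context (mu : mdp_model R S A H) (pi : policy S A H).
Hypothesis muv : model_valid mu.

(** Chains number their stages by natural numbers, hence [inord]. An index beyond the last stage
    still gives a probability vector, so the kernel is stochastic for every [i]. *)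
Definition kernel_of i y z := trans mu y (pi (y, inord i)) (inord i) z.

Lemma kernel_of_ge0 i y z : 0 <= kernel_of i y z.
Proof. by case: muv => _ [+ _] _; apply. Qed.

Lemma kernel_of_sum1 i y : \sum_z kernel_of i y z = 1.
Proof. by case: muv => _ [_ +] _; apply. Qed.

Lemma init_ge0 y : 0 <= init mu y.
Proof. by case: muv => _ _ []. Qed.

Lemma init_sum1 : \sum_y init mu y = 1.
Proof. by case: muv => _ _ []. Qed.

Lemma path_probE (x : {ffun 'I_H -> 'I_S}) :
  path_prob mu pi x = init mu (x ord0) * chain_weight kernel_of 0 x.
Proof.
rewrite /path_prob /first_stage /next_stage /chain_weight insubT /=.
congr (init mu (x _) * _); first exact: val_inj.
apply: eq_bigr => h _; case: insub => // h'.
by rewrite /kernel_of add0n inord_val.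
Qed.

Lemma path_prob_ge0 x : 0 <= path_prob mu pi x.
Proof.
rewrite path_probE mulr_ge0 ?init_ge0 // prodr_ge0 // => h _.
by case: insub => [h'|] //; apply: kernel_of_ge0.
Qed.

Lemma path_prob_sum1 : \sum_x path_prob mu pi x = 1.
Proof.
under eq_bigr do rewrite path_probE.
by rewrite (chain_mass kernel_of_sum1) init_sum1.
Qed.

Definition mktraj (x : {ffun 'I_H -> 'I_S}) (r : {ffun 'I_H -> nat}) : ftraj S A H :=
  [ffun h => (x h, pi (x h, h), r h)].

Lemma rew_ge0 x a h n : 0 <= rew mu x a h n.
Proof. by case: muv => -[+ _] _ _; apply. Qed.

Lemma rew_sum1 x a h : (\S_n (rew mu x a h n)%:E = 1)%E.
Proof. by case: muv => -[_ +] _ _; apply. Qed.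

Lemma trans_ge0 x a h y : 0 <= trans mu x a h y.
Proof. by case: muv => _ [+ _] _; apply. Qed.

Lemma ftraj_prob_ge0 tau : 0 <= ftraj_prob mu pi tau.
Proof.
rewrite /ftraj_prob mulr_ge0 //.
  by case: first_stage => // h0; apply: init_ge0.
apply: prodr_ge0 => h _; rewrite !mulr_ge0 ?rew_ge0 //.
by case: next_stage => // h'; apply: trans_ge0.
Qed.

Local Open Scope ereal_scope.

Lemma ftraj_prob_mk x r : ftraj_prob mu pi (mktraj x r) =
  (path_prob mu pi x * \prod_h rew mu (x h) (pi (x h, h)) h (r h))%R.
Proof.
rewrite /ftraj_prob /path_prob -mulrA; congr (_ * _)%R.
  by case: first_stage => // h; rewrite ffunE.
rewrite -big_split /=; apply: eq_bigr => h _; rewrite !ffunE eqxx mulr1 /=.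
by case: next_stage => // h'; rewrite ffunE.
Qed.

(** Under a fixed policy a trajectory is a state path followed by independent rewards: the actions
    are forced, every other sequence of actions having weight [0]. *)
Lemma traj_esum (f : ftraj S A H -> \bar R) : (forall tau, 0 <= f tau) ->
  \S_(tau : ftraj S A H) ((ftraj_prob mu pi tau)%:E * f tau) =
  \S_(x : {ffun 'I_H -> 'I_S}) ((path_prob mu pi x)%:E *
     \S_(r : {ffun 'I_H -> nat})
        ((\prod_h rew mu (x h) (pi (x h, h)) h (r h))%R%:E * f (mktraj x r))).
Proof.
move=> f0.
pose mk (z : {ffun 'I_H -> 'I_S} * ({ffun 'I_H -> 'I_A} * {ffun 'I_H -> nat})) :
  ftraj S A H := [ffun h => (z.1 h, z.2.1 h, z.2.2 h)].
have g0 tau : 0 <= (ftraj_prob mu pi tau)%:E * f tau.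
  by rewrite mule_ge0 // lee_fin ftraj_prob_ge0.
rewrite (reindex_esumT (e := mk)); last first.
  exists (fun tau : ftraj S A H => ([ffun h => (tau h).1.1],
            ([ffun h => (tau h).1.2], [ffun h => (tau h).2]))).
    by case=> x [a r]; congr (_, (_, _)); apply/ffunP => h; rewrite !ffunE.
  by move=> tau; apply/ffunP => h; rewrite !ffunE /=; case: (tau h) => -[].
rewrite -(esum_pair (f := fun x z => (ftraj_prob mu pi (mk (x, z)))%:E * f (mk (x, z)))) //.
apply: eq_esumT => x.
rewrite -(esum_pair (f := fun a r => (ftraj_prob mu pi (mk (x, (a, r))))%:E * f (mk (x, (a, r))))) //.
rewrite (@esum_delta _ _ [ffun h => pi (x h, h)]); first last.
- move=> a /eqP ax; rewrite esum1 // => r _.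
  suff -> : ftraj_prob mu pi (mk (x, (a, r))) = 0%R by rewrite mul0e.
  have [h ah] : exists h, a h != pi (x h, h).
    apply: contra_notP ax => na; apply/ffunP => h; rewrite ffunE.
    by apply/eqP; apply: contra_notT na => ?; exists h.
  by rewrite /ftraj_prob (bigD1 h) //= !ffunE /= (negbTE ah) mulr0 !mul0r mulr0.
- exact: esumT_ge0.
have mkE r : mk (x, ([ffun h => pi (x h, h)], r)) = mktraj x r.
  by apply/ffunP => h; rewrite !ffunE.
under eq_esumT do rewrite mkE ftraj_prob_mk EFinM -muleA.
rewrite esumTZl ?path_prob_ge0 // => r.
by rewrite mule_ge0 // lee_fin prodr_ge0 // => h _; apply: rew_ge0.
Qed.

Lemma traj_esum_rew (g : 'I_H -> nat -> R) (x : {ffun 'I_H -> 'I_S}) (s : 'I_H -> R) :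
  (forall h n, 0 <= g h n)%R ->
  (forall h, \S_n (rew mu (x h) (pi (x h, h)) h n * g h n)%:E = (s h)%:E) ->
  \S_(r : {ffun 'I_H -> nat}) ((\prod_h rew mu (x h) (pi (x h, h)) h (r h))%R%:E *
      (\prod_h g h (r h))%R%:E) = (\prod_h s h)%R%:E.
Proof.
move=> g0 gs; under eq_esumT do rewrite -EFinM -big_split /=.
apply: (@esum_prod_ffun _ _ _ (fun h n => rew mu (x h) (pi (x h, h)) h n * g h n)%R s) => // h n.
by rewrite mulr_ge0 ?rew_ge0.
Qed.

Lemma traj_esum_path (f : ftraj S A H -> \bar R) (F : {ffun 'I_H -> 'I_S} -> R) :
  (forall tau, 0 <= f tau) -> (forall x r, f (mktraj x r) = (F x)%:E) ->
  \S_(tau : ftraj S A H) ((ftraj_prob mu pi tau)%:E * f tau) =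
  (\sum_x path_prob mu pi x * F x)%R%:E.
Proof.
move=> f0 fF; rewrite traj_esum //.
have F0 x : (0 <= F x)%R by rewrite -lee_fin -(fF x [ffun=> 0%N]).
rewrite -esum_finR; last by move=> x; rewrite mulr_ge0 ?path_prob_ge0.
apply: eq_esumT => x; rewrite [RHS]EFinM; congr (_ * _).
under eq_esumT do rewrite fF.
rewrite esumTZr //; last first.
  by move=> r; rewrite lee_fin prodr_ge0 // => h _; apply: rew_ge0.
have := @esum_prod_ffun R nat H (fun h => rew mu (x h) (pi (x h, h)) h) (fun=> 1%R).
rewrite big1 // => -> //; rewrite ?mul1e // => h *; [exact: rew_ge0|exact: rew_sum1].
Qed.

Lemma ftraj_prob_sum1 : \S_(tau : ftraj S A H) (ftraj_prob mu pi tau)%:E = 1.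
Proof.
have := traj_esum_path (f := fun=> 1) (F := fun=> 1%R) (fun=> lee01) (fun _ _ => erefl).
under eq_esumT do rewrite mule1.
by under eq_bigr do rewrite mulr1; rewrite path_prob_sum1.
Qed.

(** The probability of visiting [U], as [traj_hit] confirms. The recursive form is the one that can
    be compared with values stage by stage. *)
Definition hit (U : {set tri S A H}) : R :=
  (\sum_y init mu y * chain_hit kernel_of
     (fun i y => (y, pi (y, inord i), inord i) \in U) H' 0 y)%R.

Lemma hitE (U : {set tri S A H}) : (\sum_x path_prob mu pi x *
    [exists h : 'I_H, (x h, pi (x h, h), h) \in U]%:R = hit U)%R.
Proof.
rewrite /hit -(chain_hitP kernel_of_sum1); apply: eq_bigr => x _.
rewrite path_probE; congr (_ * _%:R)%R; congr nat_of_bool.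
by apply: eq_existsb => h; rewrite add0n inord_val.
Qed.

Lemma traj_hit (U : {set tri S A H}) :
  \S_(tau : ftraj S A H) ((ftraj_prob mu pi tau)%:E *
     [exists h : 'I_H, ((tau h).1, h) \in U]%:R%:E) = (hit U)%:E.
Proof.
rewrite -hitE; apply: traj_esum_path => [tau|x r]; first by rewrite lee_fin.
by congr (_%:R%:E); congr nat_of_bool; apply: eq_existsb => h; rewrite ffunE.
Qed.

Lemma occupancy_le_hit (U : {set tri S A H}) t : t \in U -> (occupancy mu pi t <= hit U)%R.
Proof.
move=> tU; rewrite -hitE /occupancy big_mkcond /=; apply: ler_sum => x _.
case: ifPn => [/andP[/eqP xt /eqP at_]|_]; last by rewrite mulr_ge0 ?path_prob_ge0.
suff -> : [exists h, (x h, pi (x h, h), h) \in U] by rewrite mulr1.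
by apply/existsP; exists t.2; rewrite xt at_; case: t tU {xt at_} => -[].
Qed.

Definition value_of (rv : nat -> R) : R :=
  (\sum_y init mu y * chain_value kernel_of
     (fun i y => rmean rv mu (y, pi (y, inord i), inord i)) H' 0 y)%R.

Lemma valueE rv : value rv pi mu = value_of rv.
Proof.
rewrite /value /value_of -(chain_valueP kernel_of_sum1); apply: eq_bigr => x _.
rewrite path_probE; congr (_ * _)%R; apply: eq_bigr => h _.
by rewrite add0n inord_val.
Qed.

(** Identifies [ctraj_lik] as the law of the censored trajectory. The states and actions of [c] fix
    the path; the sum over the reward index of a stage is [1] if the reward is removed and a single
    reward probability otherwise. *)
Lemma traj_censor U (c : ctraj S A H) :
  \S_(tau : ftraj S A H) ((ftraj_prob mu pi tau)%:E * (censor U tau == c)%:R%:E) =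
  (ctraj_lik mu U pi c)%:E.
Proof.
rewrite traj_esum; last by move=> tau; rewrite lee_fin.
pose x0 : {ffun 'I_H -> 'I_S} := [ffun h => (c h).1.1].
pose act_ok h : R := ((c h).1.2 == pi ((c h).1.1, h))%:R%R.
pose ob h n := (c h).2 == (if ((c h).1, h) \in U then None else Some n).
have cE x r : (censor U (mktraj x r) == c)%:R%R =
    ((x == x0)%:R * ((\prod_h act_ok h) * (\prod_h (ob h (r h))%:R)))%R :> R.
  rewrite -big_split /=; have [->|xx0] := eqVneq x x0; last first.
    rewrite mul0r; case: eqP => // E; case/eqP: xx0; apply/ffunP => h.
    by rewrite /x0 ffunE -E !ffunE.
  rewrite mul1r; have [cE|cE] := eqVneq (censor U (mktraj x0 r)) c.
    rewrite big1 // => h _; rewrite /act_ok /ob.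
    by move/ffunP/(_ h): cE; rewrite !ffunE /= => <- /=; rewrite !eqxx mulr1.
  have [h ch] : exists h, censor U (mktraj x0 r) h != c h.
    move/eqP: cE; apply: contra_notP => na; apply/ffunP => h.
    by apply/eqP; apply: contra_notT na => ?; exists h.
  apply/esym/eqP; rewrite prodf_seq_eq0; apply/hasP; exists h; rewrite ?mem_index_enum //=.
  move: ch; rewrite /act_ok /ob !ffunE mulf_eq0 !pnatr_eq0 !eqb0 /=.
  case: (c h) => -[xh ah] oh /=; rewrite -negb_and; apply: contra => /andP[/eqP <- /eqP ->].
  by [].
pose sh h := (if ((c h).1, h) \in U then ((c h).2 == None)%:R
      else if (c h).2 is Some r then rew mu (c h).1.1 (pi ((c h).1.1, h)) h r else 0)%R.
rewrite (@esum_delta _ _ x0); first last.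
- move=> x /negbTE xx0; rewrite esum1 ?mule0 // => r _.
  by rewrite cE xx0 mul0r mule0.
- rewrite mule_ge0 ?lee_fin ?path_prob_ge0 // esumT_ge0 // => r.
  by rewrite mule_ge0 // lee_fin // prodr_ge0 // => h _; apply: rew_ge0.
under eq_esumT do rewrite cE eqxx mul1r EFinM muleCA.
rewrite esumTZl; last 2 first.
- by rewrite prodr_ge0.
- by move=> r; rewrite mule_ge0 // lee_fin prodr_ge0 // => h _; apply: rew_ge0.
rewrite (@traj_esum_rew (fun h n => (ob h n)%:R%R) x0 sh) //; last first.
  move=> h; rewrite /sh /ob ffunE.
  case: ifP => _.
    under eq_esumT do rewrite EFinM.
    by rewrite esumTZr ?rew_sum1 ?mul1e // => n; rewrite lee_fin rew_ge0.
  case: (c h).2 => [n0|]; last by rewrite esum1 // => n _; rewrite mulr0.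
  rewrite (@esum_delta _ _ n0) ?eqxx ?mulr1 ?lee_fin ?rew_ge0 // => n.
  move=> nn0; suff -> : (Some n0 == Some n) = false by rewrite mulr0.
  by apply/eqP => -[] E; rewrite E eqxx in nn0.
rewrite -!EFinM; congr EFin; rewrite -big_split /ctraj_lik /path_prob -mulrA.
congr (_ * _)%R.
  by case: first_stage => // h; rewrite ffunE.
rewrite -big_split /=; apply: eq_bigr => h _; rewrite /act_ok /sh !ffunE.
have [->|_] := eqVneq (c h).1.2 (pi ((c h).1.1, h)); last by rewrite !(mul0r, mulr0).
rewrite mul1r mulr1; congr (_ * _)%R.
by case: next_stage => // h'; rewrite ffunE.
Qed.

End Traj.

Lemma esum_seq_cons (R : realType) (T : countType) (f : seq T -> \bar R) :
  (forall s, 0 <= f s)%E -> f [::] = 0%E ->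
  (\S_(s : seq T) f s = \S_(x : T) \S_(s : seq T) f (x :: s))%E.
Proof.
move=> f0 fnil; rewrite (esum_pair (f := fun x s => f (x :: s))) //.
rewrite -(reindex_esum [set: T * seq T] [set s | s != [::]] (fun z => z.1 :: z.2)).
  rewrite [RHS]esum_mkcond; apply: eq_esumT => s; case: ifPn => //.
  by rewrite notin_setE /=; case: s => // ? ? /(_ isT).
split => // [[x s] [y t] _ _ /= [-> ->] //|[|x s] //= _].
by exists (x, s).
Qed.

Lemma esum_seq_nil (R : realType) (T : countType) (f : seq T -> \bar R) :
  (0 <= f [::])%E -> (forall x s, f (x :: s) = 0%E) -> (\S_(s : seq T) f s = f [::])%E.
Proof. by move=> f0 fs; apply: esum_delta => // -[]. Qed.

Section Ledger.
Context (R : realType) (S A H' : nat).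
Local Notation H := H'.+1.
Local Notation policy := (policy S A H).
Local Notation ftraj := (ftraj S A H).
Local Notation ctraj := (ctraj S A H).
Local Notation rawledger := (rawledger S A H).

Definition skel (rl : rawledger) := [seq (e.1, fskel e.2) | e <- rl].
Definition skel_cens (cl : seq (policy * ctraj)) := [seq (e.1, cskel e.2) | e <- cl].
Definition cens (U : {set tri S A H}) (rl : rawledger) := [seq (e.1, censor U e.2) | e <- rl].
(* Only the skeleton matters; the reward index [0] is a placeholder. *)
Definition uncens (cl : seq (policy * ctraj)) : rawledger :=
  [seq (e.1, [ffun h => ((e.2 h).1, 0%N)] : ftraj) | e : policy * ctraj <- cl].

Lemma skel_cens_cens U rl : skel_cens (cens U rl) = skel rl.
Proof.
rewrite /skel_cens /skel -map_comp; apply: eq_map => e /=; congr pair.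
by apply/ffunP => h; rewrite !ffunE.
Qed.

Lemma skel_uncens cl : skel (uncens cl) = skel_cens cl.
Proof.
rewrite /skel_cens /skel -map_comp; apply: eq_map => e /=; congr pair.
by apply/ffunP => h; rewrite !ffunE.
Qed.

Lemma size_skel rl : size (skel rl) = size rl.
Proof. by rewrite size_map. Qed.

Lemma visits_fskel (t : tri S A H) (tau : ftraj) :
  visits t tau = [exists h : 'I_H, t == (fskel tau h, h)].
Proof. by apply: eq_existsb => h; rewrite ffunE. Qed.

Lemma count_visits_skel (t : tri S A H) (rl : rawledger) :
  count (fun e => visits t e.2) rl =
  count (fun e : policy * {ffun 'I_H -> 'I_S * 'I_A} =>
    [exists h : 'I_H, t == (e.2 h, h)]) (skel rl).
Proof. by rewrite count_map; apply: eq_count => e /=; rewrite visits_fskel. Qed.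

Lemma under_explored_skel n rl rl' : skel rl = skel rl' ->
  under_explored n rl = under_explored n rl'.
Proof. by move=> E; apply/setP => t; rewrite !inE !count_visits_skel E. Qed.

Lemma cens_setT_skel rl :
  cens [set: tri S A H]%SET rl = 
    [seq (e.1, [ffun h => (e.2 h, None)] : ctraj)
    | e : policy * {ffun 'I_H -> 'I_S * 'I_A} <- skel rl].
Proof.
rewrite /cens /skel -map_comp; apply: eq_map => e /=; congr pair.
by apply/ffunP => h; rewrite !ffunE inE.
Qed.

(** Removing all rewards leaves exactly the policies, states and actions, so the censored ledger and
    the skeleton carry the same information. *)
Lemma cens_setT_eq rl rl' :
  (cens [set: tri S A H]%SET rl == cens [set: tri S A H]%SET rl') = (skel rl == skel rl').
Proof.
apply/eqP/eqP => [E|E]; last by rewrite !cens_setT_skel E.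
by rewrite -(skel_cens_cens [set: tri S A H]%SET) E skel_cens_cens.
Qed.

Lemma censored_ledger_skel rl rl' : skel rl = skel rl' ->
  censored_ledger rl = censored_ledger rl'.
Proof.
by move=> /eqP; rewrite -cens_setT_eq => /eqP E; congr pair.
Qed.

Variable mu : mdp_model R S A H.
Hypothesis muv : model_valid mu.

Definition rawlik (rl : rawledger) : R := \prod_(e <- rl) ftraj_prob mu e.1 e.2.

Lemma rawlik_ge0 rl : 0 <= rawlik rl.
Proof. by apply: prodr_ge0 => e _; apply: ftraj_prob_ge0. Qed.

Lemma ctraj_lik_ge0 U pi (c : ctraj) : 0 <= ctraj_lik mu U pi c.
Proof. by rewrite -lee_fin -traj_censor //; apply: esumT_ge0 => tau; rewrite mule_ge0 ?lee_fin ?ftraj_prob_ge0. Qed.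

Lemma ledger_lik_ge0 lam : 0 <= ledger_lik mu lam.
Proof. by apply: prodr_ge0 => e _; apply: ctraj_lik_ge0. Qed.

Local Open Scope ereal_scope.

(** [traj_censor] for independent episodes; only raw ledgers with the same sequence of policies
    contribute. *)
Lemma rawlik_cens U (cl : seq (policy * ctraj)) :
  \S_(rl : rawledger) ((rawlik rl)%:E * (cens U rl == cl)%:R%:E) = (ledger_lik mu (U, cl))%:E.
Proof.
have pos (cl' : seq (policy * ctraj)) rl : 0 <= (rawlik rl)%:E * (cens U rl == cl')%:R%:E.
  by rewrite mule_ge0 // lee_fin rawlik_ge0.
rewrite /ledger_lik /=; elim: cl => [|[pi c] cl IH].
  rewrite big_nil esum_seq_nil; first by rewrite /rawlik big_nil mule1.
    by rewrite /rawlik big_nil mule1.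
  by move=> x s; rewrite mule0.
rewrite esum_seq_cons //; last by rewrite mule0.
rewrite esum_prod; last by move=> x; apply: esumT_ge0 => rl; apply: pos.
have E pi' tau rl : (rawlik ((pi', tau) :: rl))%:E * (cens U ((pi', tau) :: rl) == (pi, c) :: cl)%:R%:E
  = (pi' == pi)%:R%:E * ((ftraj_prob mu pi' tau * (censor U tau == c)%:R)%R%:E
     * ((rawlik rl)%:E * (cens U rl == cl)%:R%:E)).
  rewrite /rawlik big_cons /= eqseq_cons !xpair_eqE -!EFinM; congr EFin.
  by case: (pi' == pi); case: (censor U tau == c); case: (cens U rl == cl);
    rewrite /= ?(mul0r, mulr0, mul1r, mulr1).
rewrite (@esum_delta _ _ pi); first last.
- move=> pi' ne; rewrite esum1 // => tau _; rewrite esum1 // => rl _.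
  by rewrite E (negbTE ne) mul0e.
- by apply: esumT_ge0 => tau; apply: esumT_ge0 => rl; rewrite pos.
under eq_esumT => tau.
  under eq_esumT do rewrite E eqxx mul1e.
  rewrite esumTZl //; last by rewrite mulr_ge0 ?ftraj_prob_ge0.
  rewrite IH; over.
rewrite esumTZr; first by under eq_esumT do rewrite EFinM; rewrite traj_censor // big_cons EFinM.
  by apply: prodr_ge0 => e _; apply: ctraj_lik_ge0.
by move=> tau; rewrite lee_fin mulr_ge0 ?ftraj_prob_ge0.
Qed.

(** Both sides are the probability of the skeleton of [rl0] when its policies are run. This is what
    normalizes the law of the hallucinated ledger. *)
Lemma skel_lik_sum U (rl0 : rawledger) :
  \S_(cl : seq (policy * ctraj))
    ((skel_cens cl == skel rl0)%:R%:E * (ledger_lik mu (U, cl))%:E) =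
  (ledger_lik mu (censored_ledger rl0))%:E.
Proof.
transitivity (\S_(rl : rawledger) ((rawlik rl)%:E * (skel rl == skel rl0)%:R%:E)); last first.
  rewrite -rawlik_cens; apply: eq_esumT => rl.
  by rewrite -cens_setT_eq.
rewrite [RHS](esum_fiber (cens U)); last first.
  by move=> rl; rewrite mule_ge0 // lee_fin rawlik_ge0.
apply: eq_esumT => cl; rewrite -rawlik_cens -esumTZl //; last first.
  by move=> rl; rewrite mule_ge0 // lee_fin rawlik_ge0.
apply: eq_esumT => rl; have [<-|_] := eqVneq (cens U rl) cl; last by rewrite mul0e !mule0.
by rewrite skel_cens_cens mule1 mul1e muleC.
Qed.

End Ledger.

(** * Measurability over the prior *)

Section Expectation.
Context (R : realType) d (M : measurableType d) (P : probability M R).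
Implicit Types f g : M -> R.

(** A class closed under the operations that build likelihoods and values, on which integration
    against [P] is linear without further integrability conditions. *)
Definition bounded_mfun f := measurable_fun setT f /\ exists C, forall w, `|f w| <= C.

Lemma bmf_cst c : bounded_mfun (fun=> c).
Proof. by split => //; exists `|c|. Qed.

Lemma bmfD f g : bounded_mfun f -> bounded_mfun g -> bounded_mfun (fun w => f w + g w).
Proof.
move=> [mf [C fC]] [mg [D gD]]; split; first exact: measurable_funD.
by exists (C + D) => w; rewrite (le_trans (ler_normD _ _)) // lerD.
Qed.

Lemma bmfN f : bounded_mfun f -> bounded_mfun (fun w => - f w).
Proof.
move=> [mf [C fC]]; split; first exact: measurableT_comp.
by exists C => w; rewrite normrN.
Qed.

Lemma bmfB f g : bounded_mfun f -> bounded_mfun g -> bounded_mfun (fun w => f w - g w).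
Proof. by move=> bf bg; apply: bmfD => //; apply: bmfN. Qed.

Lemma bmfM f g : bounded_mfun f -> bounded_mfun g -> bounded_mfun (fun w => f w * g w).
Proof.
move=> [mf [C fC]] [mg [D gD]]; split; first exact: measurable_funM.
by exists (C * D) => w; rewrite normrM ler_pM.
Qed.

Lemma bmfZ c f : bounded_mfun f -> bounded_mfun (fun w => c * f w).
Proof. by move=> bf; apply: bmfM => //; exact: bmf_cst. Qed.

Lemma bmf_sum (I : Type) (r : seq I) (F : I -> M -> R) :
  (forall i, bounded_mfun (F i)) -> bounded_mfun (fun w => \sum_(i <- r) F i w).
Proof.
move=> bF; elim: r => [|i r IH].
  by under eq_fun do rewrite big_nil; exact: bmf_cst.
by under eq_fun do rewrite big_cons; exact: bmfD.
Qed.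

Lemma bmf_prod (I : Type) (r : seq I) (F : I -> M -> R) :
  (forall i, bounded_mfun (F i)) -> bounded_mfun (fun w => \prod_(i <- r) F i w).
Proof.
move=> bF; elim: r => [|i r IH].
  by under eq_fun do rewrite big_nil; exact: bmf_cst.
by under eq_fun do rewrite big_cons; exact: bmfM.
Qed.

Lemma bmf_indic (E : set M) : measurable E -> bounded_mfun (\1_E : M -> R).
Proof.
move=> mE; split; first exact: measurable_indic.
by exists 1 => w; rewrite indicE; case: (_ \in _); rewrite ?normr1 ?normr0.
Qed.

Lemma bmf_integrable f : bounded_mfun f -> P.-integrable setT (EFin \o f).
Proof.
move=> [mf [C fC]]; apply: measurable_bounded_integrable => //.
  by apply: (le_lt_trans (probability_le1 P measurableT)); rewrite ltry.
exists C; split; first by rewrite realE; case: leP => //= ?; rewrite ltW.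
by move=> x Cx w _ /=; rewrite (le_trans (fC w)) // ltW.
Qed.

Definition Ex f : R := \int[P]_w f w.

Lemma ExE f : bounded_mfun f -> (Ex f)%:E = (\int[P]_w (f w)%:E)%E.
Proof.
by move=> bf; rewrite /Ex /Rintegral fineK //; apply/integrable_fin_num => //; exact: bmf_integrable.
Qed.

Lemma ExD f g : bounded_mfun f -> bounded_mfun g -> Ex (fun w => f w + g w) = Ex f + Ex g.
Proof. by move=> bf bg; apply: RintegralD => //; exact: bmf_integrable. Qed.

Lemma ExZ c f : bounded_mfun f -> Ex (fun w => c * f w) = c * Ex f.
Proof. by move=> bf; apply: RintegralZl => //; exact: bmf_integrable. Qed.

Lemma Ex_cst c : Ex (fun=> c) = c.
Proof. by rewrite /Ex Rintegral_cst //= probability_setT mulr1. Qed.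

Lemma Ex_le f g : bounded_mfun f -> bounded_mfun g -> (forall w, f w <= g w) -> Ex f <= Ex g.
Proof. by move=> bf bg fg; apply: le_Rintegral => //; exact: bmf_integrable. Qed.

Lemma Ex_ge0 f : (forall w, 0 <= f w) -> 0 <= Ex f.
Proof. by move=> f0; apply: Rintegral_ge0 => w _. Qed.

Lemma eq_Ex f g : f =1 g -> Ex f = Ex g.
Proof. by move=> /funext ->. Qed.

Lemma ExB f g : bounded_mfun f -> bounded_mfun g -> Ex (fun w => f w - g w) = Ex f - Ex g.
Proof. by move=> bf bg; apply: RintegralB => //; exact: bmf_integrable. Qed.

Lemma Ex_sum (I : Type) (r : seq I) (F : I -> M -> R) :
  (forall i, bounded_mfun (F i)) -> Ex (fun w => \sum_(i <- r) F i w) = \sum_(i <- r) Ex (F i).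
Proof.
move=> bF; elim: r => [|i r IH].
  by under eq_Ex do rewrite big_nil; rewrite Ex_cst big_nil.
by under eq_Ex do rewrite big_cons; rewrite ExD ?IH ?big_cons //; exact: bmf_sum.
Qed.

Lemma fine_integral_in (E : set M) f :
  fine (\int[P]_(w in E) (f w)%:E)%E = Ex (fun w => \1_E w * f w).
Proof.
rewrite integral_mkcond /Ex /Rintegral; congr fine; apply: eq_integral => w _.
by rewrite patchE indicE; case: (w \in E); rewrite ?mul1r ?mul0r.
Qed.

End Expectation.

Definition regular_prior (R : realType) (S A H : nat) d (M : measurableType d)
    (mdl : M -> mdp_model R S A H) (rv : nat -> R) :=
  [/\ forall w, model_valid (mdl w),
      forall x a h n, measurable_fun [set: M] (fun w => rew (mdl w) x a h n),
      forall x a h y, measurable_fun [set: M] (fun w => trans (mdl w) x a h y),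
      forall y, measurable_fun [set: M] (fun w => init (mdl w) y) &
      forall n, 0 <= rv n <= 1].

Section Regular.
Context (R : realType) (S A H' : nat).
Local Notation H := H'.+1.
Context d (M : measurableType d) (P : probability M R).
Context (mdl : M -> mdp_model R S A H) (rv : nat -> R).
Hypothesis reg : regular_prior mdl rv.

Lemma reg_valid w : model_valid (mdl w). Proof. by case: reg. Qed.

Let muv := reg_valid.

Lemma bmf_rew x a h n : bounded_mfun (fun w => rew (mdl w) x a h n).
Proof.
split; first by case: reg.
exists 1 => w; rewrite ger0_norm ?(rew_ge0 (muv w)) // -lee_fin -(rew_sum1 (muv w) x a h).
by apply: (esum_ge1 (f := fun n => (rew (mdl w) x a h n)%:E)) => m; rewrite lee_fin (rew_ge0 (muv w)).
Qed.

Lemma bmf_trans x a h y : bounded_mfun (fun w => trans (mdl w) x a h y).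
Proof.
split; first by case: reg.
exists 1 => w; have [_ [t0 t1] _] := muv w.
rewrite ger0_norm // -(t1 x a h) (bigD1 y) //= lerDl sumr_ge0 //.
Qed.

Lemma bmf_init y : bounded_mfun (fun w => init (mdl w) y).
Proof.
split; first by case: reg.
exists 1 => w; have [_ _ [t0 t1]] := muv w.
rewrite ger0_norm // -t1 (bigD1 y) //= lerDl sumr_ge0 //.
Qed.

Lemma rv_ge0 n : 0 <= rv n. Proof. by case: reg => _ _ _ _ /(_ n)/andP[]. Qed.
Lemma rv_le1 n : rv n <= 1. Proof. by case: reg => _ _ _ _ /(_ n)/andP[]. Qed.

Lemma rmeanE w t :
  ((rmean rv (mdl w) t)%:E = \S_n (rew (mdl w) t.1.1 t.1.2 t.2 n * rv n)%:E)%E.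
Proof.
rewrite /rmean fineK // ge0_fin_numE; last first.
  by apply: esumT_ge0 => n; rewrite lee_fin mulr_ge0 ?rv_ge0 ?(rew_ge0 (muv w)).
apply: (@le_lt_trans _ _ 1%E); last exact: ltry.
rewrite -(rew_sum1 (muv w) t.1.1 t.1.2 t.2); apply: le_esumT => n.
by rewrite lee_fin ler_piMr ?rv_le1 ?(rew_ge0 (muv w)).
Qed.

Lemma rmean_ge0 w t : 0 <= rmean rv (mdl w) t.
Proof.
rewrite -lee_fin rmeanE; apply: esumT_ge0 => n.
by rewrite lee_fin mulr_ge0 ?rv_ge0 ?(rew_ge0 (muv w)).
Qed.

Lemma rmean_le1 w t : rmean rv (mdl w) t <= 1.
Proof.
rewrite -lee_fin rmeanE -(rew_sum1 (muv w) t.1.1 t.1.2 t.2); apply: le_esumT => n.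
by rewrite lee_fin ler_piMr ?rv_le1 ?(rew_ge0 (muv w)).
Qed.

Lemma bmf_rmean t : bounded_mfun (fun w => rmean rv (mdl w) t).
Proof.
split; last by exists 1 => w; rewrite ger0_norm ?rmean_ge0 ?rmean_le1.
apply/measurable_EFinP.
rewrite (_ : _ \o _ = fun w => (\S_n (rew (mdl w) t.1.1 t.1.2 t.2 n * rv n)%:E)%E); last first.
  by apply/funext => w /=; rewrite rmeanE.
apply: measurable_esum => [n w|n].
  by rewrite lee_fin mulr_ge0 ?rv_ge0 ?(rew_ge0 (muv w)).
apply/measurable_EFinP; apply: measurable_funM => //; first by case: (bmf_rew t.1.1 t.1.2 t.2 n).
Qed.

Lemma bmf_ftraj_prob pi tau : bounded_mfun (fun w => ftraj_prob (mdl w) pi tau).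
Proof.
rewrite /ftraj_prob; apply: bmfM.
  by case: (first_stage H) => [h|]; [exact: bmf_init|exact: bmf_cst].
apply: bmf_prod => h; apply: bmfM; last exact: bmf_rew.
apply: bmfM; last exact: bmf_cst.
by case: (next_stage h) => [h'|]; [exact: bmf_trans|exact: bmf_cst].
Qed.

Lemma bmf_rawlik rl : bounded_mfun (fun w => rawlik (mdl w) rl).
Proof. by apply: bmf_prod => e; apply: bmf_ftraj_prob. Qed.

Lemma bmf_ctraj_lik U pi c : bounded_mfun (fun w => ctraj_lik (mdl w) U pi c).
Proof.
rewrite /ctraj_lik; apply: bmfM.
  by case: (first_stage H) => [h|]; [exact: bmf_init|exact: bmf_cst].
apply: bmf_prod => h; apply: bmfM.
  apply: bmfM; last exact: bmf_cst.
  by case: (next_stage h) => [h'|]; [exact: bmf_trans|exact: bmf_cst].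
case: (((c h).1, h) \in U); first exact: bmf_cst.
by case: (c h).2 => [n|]; [exact: bmf_rew|exact: bmf_cst].
Qed.

Lemma bmf_lik lam : bounded_mfun (fun w => ledger_lik (mdl w) lam).
Proof. by apply: bmf_prod => e; apply: bmf_ctraj_lik. Qed.

Lemma bmf_path_prob pi x : bounded_mfun (fun w => path_prob (mdl w) pi x).
Proof.
rewrite /path_prob; apply: bmfM.
  by case: (first_stage H) => [h|]; [exact: bmf_init|exact: bmf_cst].
apply: bmf_prod => h.
by case: (next_stage h) => [h'|]; [exact: bmf_trans|exact: bmf_cst].
Qed.

Lemma bmf_value pi : bounded_mfun (fun w => value rv pi (mdl w)).
Proof.
rewrite /value; apply: bmf_sum => x; apply: bmfM; first exact: bmf_path_prob.
by apply: bmf_sum => h; apply: bmf_rmean.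
Qed.

Lemma value_ge0 pi w : 0 <= value rv pi (mdl w).
Proof.
apply: sumr_ge0 => x _; rewrite mulr_ge0 ?path_prob_ge0 //.
by apply: sumr_ge0 => h _; apply: rmean_ge0.
Qed.

Lemma value_le pi w : value rv pi (mdl w) <= H%:R.
Proof.
apply: (@le_trans _ _ (\sum_x path_prob (mdl w) pi x * H%:R)); last first.
  by rewrite -mulr_suml (path_prob_sum1 pi (muv w)) mul1r.
apply: ler_sum => x _; rewrite ler_wpM2l ?path_prob_ge0 //.
apply: (@le_trans _ _ (\sum_(h < H) 1)); last by rewrite sumr_const card_ord.
by apply: ler_sum => h _; apply: rmean_le1.
Qed.

Lemma measurable_reachable rho t : measurable [set w | reachable rho (mdl w) t].
Proof.
rewrite (_ : [set _ | _] = \bigcup_(pi in [set: policy S A H])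
   [set w | rho <= occupancy (mdl w) pi t]); last first.
  by apply/seteqP; split => w; [case=> pi h; exists pi|case=> pi _ h; exists pi].
apply: fin_bigcup_measurable; first exact: finite_finset.
move=> pi _; rewrite -[X in measurable X]setTI; apply: measurable_fun_ler => //.
rewrite /occupancy; under eq_fun do rewrite big_mkcond.
apply: (fun F => proj1 (bmf_sum _ F)) => x.
by case: (_ && _); [exact: bmf_path_prob|exact: bmf_cst].
Qed.

Definition small_rewards (T : {set tri S A H}) eps : set M :=
  [set w | forall t, t \in T -> rmean rv (mdl w) t <= eps].

Lemma measurable_small_rewards T eps : measurable (small_rewards T eps).
Proof.
rewrite (_ : small_rewards T eps = \bigcap_(t in [set` T]) [set w | rmean rv (mdl w) t <= eps]); last first.
  by apply/seteqP; split.
apply: fin_bigcap_measurable; first exact: finite_finset.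
move=> t _; have [mr _] := bmf_rmean t.
rewrite -[X in measurable X]setTI; exact: measurable_fun_ler.
Qed.

End Regular.

(** * Hallucinated ledgers and phases *)

Section Hallucination.
Context (R : realType) (S A H' : nat).
Local Notation H := H'.+1.
Context d (M : measurableType d) (P : probability M R).
Context (mdl : M -> mdp_model R S A H) (rv : nat -> R).
Hypothesis reg : regular_prior mdl rv.
Local Notation policy := (policy S A H).
Local Notation ftraj := (ftraj S A H).
Local Notation ctraj := (ctraj S A H).
Local Notation ledger := (ledger S A H).
Local Notation rawledger := (rawledger S A H).
Context (nlrn : nat) (eps : R).
Local Notation under := (@under_explored S A H nlrn).

Let muv := reg_valid reg.

(* unnormalized canonical posterior probability of the event [E] *)
Definition lik_in (E : set M) (lam : ledger) : R :=
  Ex P (fun w => \1_E w * ledger_lik (mdl w) lam).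

Definition punish (U : {set tri S A H}) : set M := small_rewards mdl rv (~: U) eps.

Lemma measurable_punish U : measurable (punish U).
Proof. exact: measurable_small_rewards. Qed.

Lemma punish_eventE rl : punish_event mdl rv nlrn eps rl = punish (under rl).
Proof. by apply/seteqP; split => w h t tU; apply: h; move: tU; rewrite finset.in_setC. Qed.

Lemma bmf_lik_in E lam : measurable E ->
  bounded_mfun (fun w => \1_E w * ledger_lik (mdl w) lam).
Proof. by move=> mE; apply: bmfM; [exact: bmf_indic|exact: (bmf_lik reg)]. Qed.

Lemma lik_in_ge0 E lam : 0 <= lik_in E lam.
Proof. by apply: Ex_ge0 => w; rewrite mulr_ge0 // ledger_lik_ge0. Qed.

Local Notation hal := (hal_prob P mdl rv nlrn eps).

Lemma hal_probE rl lam : hal rl lam =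
  ((lam.1 == under rl) && (skel_cens lam.2 == skel rl))%:R *
  (lik_in (punish (under rl)) lam / lik_in (punish (under rl)) (censored_ledger rl)).
Proof. by rewrite /hal_prob !fine_integral_in punish_eventE. Qed.

Lemma hal_ge0 rl lam : 0 <= hal rl lam.
Proof. by rewrite hal_probE mulr_ge0 // divr_ge0 // lik_in_ge0. Qed.

(** The mechanism behind the incentives: recorded rewards have no influence on the hallucinated
    ledger. *)
Lemma hal_skel rl rl' lam : skel rl = skel rl' -> hal rl lam = hal rl' lam.
Proof.
by move=> E; rewrite !hal_probE E (under_explored_skel nlrn E) (censored_ledger_skel E).
Qed.

Definition hal_defined rl := 0 < lik_in (punish (under rl)) (censored_ledger rl).

Local Open Scope ereal_scope.

(** By [skel_lik_sum] the numerators add up to the denominator. If the denominator is [0], the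
    quotients are [0] and the mass is [0] instead of [1]; [integral_run_one] shows that this loses
    nothing on average. *)
Lemma hal_sum rl : \S_(lam : ledger) (hal rl lam)%:E = (hal_defined rl)%:R%:E.
Proof.
set U := under rl; set D := lik_in (punish U) (censored_ledger rl).
rewrite esum_prod; last by move=> z; rewrite lee_fin hal_ge0.
rewrite (@esum_delta _ _ U); first last.
- move=> U' ne; rewrite esum1 // => cl _; rewrite hal_probE /=.
  by rewrite (negbTE ne) mul0r.
- by apply: esumT_ge0 => cl; rewrite lee_fin hal_ge0.
have -> : \S_(cl : seq (policy * ctraj)) (hal rl (U, cl))%:E =
          \S_(cl : seq (policy * ctraj)) ((skel_cens cl == skel rl)%:R * lik_in (punish U) (U, cl))%R%:E * D^-1%:E.
  rewrite -esumTZr ?invr_ge0 ?lik_in_ge0 //; last first.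
    by move=> cl; rewrite lee_fin mulr_ge0 // lik_in_ge0.
  by apply: eq_esumT => cl; rewrite hal_probE eqxx /= -EFinM mulrA.
have -> : \S_(cl : seq (policy * ctraj)) ((skel_cens cl == skel rl)%:R * lik_in (punish U) (U, cl))%R%:E = D%:E.
  rewrite /D /lik_in ExE; last exact/bmf_lik_in/measurable_punish.
  have -> : \int[P]_w (\1_(punish U) w * ledger_lik (mdl w) (censored_ledger rl))%:E =
      \int[P]_w \S_(cl : seq (policy * ctraj))
        (\1_(punish U) w * ((skel_cens cl == skel rl)%:R * ledger_lik (mdl w) (U, cl)))%R%:E.
    apply: eq_integral => w _; rewrite EFinM -(skel_lik_sum (muv w) U) -esumTZl //.
      by move=> cl; rewrite -EFinM lee_fin mulr_ge0 // ledger_lik_ge0.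
  have bm cl : bounded_mfun (fun w => \1_(punish U) w *
      ((skel_cens cl == skel rl)%:R * ledger_lik (mdl w) (U, cl)))%R.
    apply: bmfM; first exact/bmf_indic/measurable_punish.
    exact/bmfZ/(bmf_lik reg).
  rewrite integral_esum; last 2 first.
  - by move=> cl w; rewrite lee_fin !mulr_ge0 // ledger_lik_ge0.
  - by move=> cl; apply/measurable_EFinP; case: (bm cl).
  apply: eq_esumT => cl; rewrite -ExE //; congr EFin.
  rewrite -ExZ; last exact/bmf_lik_in/measurable_punish.
  by apply: eq_Ex => w; rewrite mulrCA.
rewrite /hal_defined -/U -/D -EFinM.
have := lik_in_ge0 (punish U) (censored_ledger rl); rewrite -/D le0r.
by case/orP => [/eqP ->|D0]; rewrite ?mul0r ?ltxx // D0 divff // gt_eqF.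
Qed.

Lemma hal_sum_le1 rl : \S_(lam : ledger) (hal rl lam)%:E <= 1.
Proof. by rewrite hal_sum; case: (hal_defined rl). Qed.

Context (N : nat) (pol : nat -> ledger -> policy).
Hypothesis N0 : (0 < N)%N.

Lemma nhal_ge0 rl lam : 0 <= (N%:R^-1 * hal rl lam)%R%:E.
Proof. by rewrite lee_fin mulr_ge0 ?invr_ge0 ?hal_ge0. Qed.

(** Conditional probability, given the raw ledger, that the hallucination episode runs [pi]. The
    true model does not occur in it. *)
Definition step_weight l rl (pi : policy) : \bar R :=
  \S_(o : 'I_N) \S_(lam : ledger)
    ((N%:R^-1 * hal rl lam)%R%:E * (pol (kidx l o) lam == pi)%:R%:E).

Lemma step_weight_ge0 l rl pi : 0 <= step_weight l rl pi.
Proof.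
apply: esumT_ge0 => o; apply: esumT_ge0 => lam.
by rewrite mule_ge0 ?nhal_ge0 ?lee_fin.
Qed.

Lemma sum_ord_inv : \S_(o : 'I_N) (N%:R^-1 : R)%:E = 1.
Proof.
rewrite esum_finR ?sumr_const ?card_ord; last by move=> _; rewrite invr_ge0.
by rewrite -(mulr_natr (N%:R^-1)) mulVf // pnatr_eq0 -lt0n.
Qed.

Lemma step_weight_sum l rl : \S_(pi : policy) step_weight l rl pi <= 1.
Proof.
have t0 o lam pi : 0 <= (N%:R^-1 * hal rl lam)%R%:E * (pol (@kidx N l o) lam == pi)%:R%:E.
  by rewrite mule_ge0 ?nhal_ge0 ?lee_fin.
rewrite /step_weight esum_exchange; last first.
  by move=> pi o; apply: esumT_ge0.
rewrite -sum_ord_inv; apply: le_esumT => o; rewrite esum_exchange //.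
apply: (@le_trans _ _ (\S_(lam : ledger) ((N%:R^-1)%:E * (hal rl lam)%:E))).
  apply: le_esumT => lam; rewrite (@esum_delta _ _ (pol (kidx l o) lam)) //.
    by rewrite eqxx mule1 EFinM.
  by move=> pi; rewrite eq_sym => /negbTE ->; rewrite mule0.
rewrite esumTZl ?invr_ge0 //; last by move=> lam; rewrite lee_fin hal_ge0.
by rewrite -[leRHS]mule1 lee_pmul2l ?hal_sum_le1 // lte_fin invr_gt0 ltr0n.
Qed.

Lemma step_weight_le1 l rl pi : step_weight l rl pi <= 1.
Proof.
apply: le_trans (step_weight_sum l rl).
by apply: (esum_ge1 (f := step_weight l rl)) => ?; exact: step_weight_ge0.
Qed.

Lemma step_weight_skel l rl rl' pi : skel rl = skel rl' ->
  step_weight l rl pi = step_weight l rl' pi.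
Proof.
move=> E; apply: eq_esumT => o; apply: eq_esumT => lam.
by rewrite (hal_skel _ E).
Qed.

(** Collects the choices of the algorithm and of the agents along a raw ledger; by [raw_weight_skel]
    it is a function of skeletons. *)
Fixpoint raw_weight l (rl rest : rawledger) : \bar R :=
  if rest is e :: rest' then step_weight l rl e.1 * raw_weight l.+1 (rcons rl e) rest'
  else 1.

Lemma raw_weight_ge0 l rl rest : 0 <= raw_weight l rl rest.
Proof.
by elim: rest l rl => //= e rest IH l rl; rewrite mule_ge0 ?step_weight_ge0.
Qed.

Lemma raw_weight_le1 l rl rest : raw_weight l rl rest <= 1.
Proof.
elim: rest l rl => //= e rest IH l rl; rewrite -[leRHS]mule1.
by rewrite lee_pmul ?step_weight_ge0 ?raw_weight_ge0 ?step_weight_le1.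
Qed.

Lemma raw_weight_skel l rl rl' rest rest' : skel rl = skel rl' -> skel rest = skel rest' ->
  raw_weight l rl rest = raw_weight l rl' rest'.
Proof.
elim: rest l rl rl' rest' => [|e rest IH] l rl rl' [|e' rest'] //= E [E1 E2 E3].
rewrite E1 (step_weight_skel _ _ E); congr (_ * _); apply: IH => //.
by rewrite /skel !map_rcons -!/(skel _) E E1 E2.
Qed.

Section Run.
Variable mu : mdp_model R S A H.
Hypothesis mu_valid : model_valid mu.

(** One phase seen through the raw ledger: offset of the hallucination episode, hallucinated ledger,
    trajectory of that episode. *)
Definition step l rl (F : rawledger -> \bar R) : \bar R :=
  \S_(o : 'I_N) \S_(lam : ledger) ((N%:R^-1 * hal rl lam)%R%:E *
    \S_(tau : ftraj) ((ftraj_prob mu (pol (kidx l o) lam) tau)%:E *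
                       F (rcons rl (pol (kidx l o) lam, tau)))).

(* Operator form of [hist_prob]: the expectation of [F] at the raw ledger reached
   after [m] further phases. *)
Fixpoint run m l rl (F : rawledger -> \bar R) : \bar R :=
  if m is m'.+1 then step l rl (fun rl' => run m' l.+1 rl' F) else F rl.

Lemma step_ge0 l rl F : (forall rl, 0 <= F rl) -> 0 <= step l rl F.
Proof.
move=> F0; apply: esumT_ge0 => o; apply: esumT_ge0 => lam.
rewrite mule_ge0 ?nhal_ge0 //; apply: esumT_ge0 => tau.
by rewrite mule_ge0 // lee_fin ftraj_prob_ge0.
Qed.

Lemma le_step l rl F G : (forall e, F (rcons rl e) <= G (rcons rl e)) ->
  step l rl F <= step l rl G.
Proof.
move=> FG; apply: le_esumT => o; apply: le_esumT => lam.
rewrite lee_wpmul2l ?nhal_ge0 //; apply: le_esumT => tau.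
by rewrite lee_wpmul2l // lee_fin ftraj_prob_ge0.
Qed.

Lemma run_ge0 m l rl F : (forall rl, 0 <= F rl) -> 0 <= run m l rl F.
Proof. by move=> F0; elim: m l rl => //= m IH l rl; apply: step_ge0. Qed.

Lemma le_run m l rl F G : (forall rl, F rl <= G rl) -> run m l rl F <= run m l rl G.
Proof. by move=> FG; elim: m l rl => //= m IH l rl; apply: le_step. Qed.

Lemma step_le_cst l rl F (c : R) : (0 <= c)%R ->
  (forall pi, \S_(tau : ftraj) ((ftraj_prob mu pi tau)%:E * F (rcons rl (pi, tau))) <= c%:E) ->
  step l rl F <= c%:E.
Proof.
move=> c0 Fc; apply: (@le_trans _ _ (\S_(o : 'I_N) ((N%:R^-1)%:E * c%:E))); last first.
  by rewrite esumTZr ?sum_ord_inv ?mul1e // => o; rewrite lee_fin invr_ge0.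
apply: le_esumT => o.
apply: (@le_trans _ _ (\S_(lam : ledger) ((N%:R^-1 * c)%R%:E * (hal rl lam)%:E))).
  apply: le_esumT => lam.
  have -> : (N%:R^-1 * c)%R%:E * (hal rl lam)%:E = (N%:R^-1 * hal rl lam)%R%:E * c%:E.
    by rewrite -!EFinM mulrAC.
  by rewrite lee_wpmul2l ?nhal_ge0.
rewrite esumTZl ?mulr_ge0 ?invr_ge0 //; last by move=> lam; rewrite lee_fin hal_ge0.
by rewrite -EFinM -[leRHS]mule1 lee_wpmul2l ?hal_sum_le1 // lee_fin mulr_ge0 ?invr_ge0.
Qed.

(** The inequality is required for every policy, so the way in which agents react to the past does
    not matter. Mass lost at undefined hallucinations only lowers the left side. *)
Lemma run_supermartingale m l rl (f : rawledger -> R) : (forall rl, 0 <= f rl)%R ->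
  (forall rl pi, \S_(tau : ftraj) ((ftraj_prob mu pi tau * f (rcons rl (pi, tau)))%R%:E)
     <= (f rl)%:E) ->
  run m l rl (fun rl' => (f rl')%:E) <= (f rl)%:E.
Proof.
move=> f0 fS; elim: m l rl => //= m IH l rl.
apply: le_trans (_ : step l rl (fun rl' => (f rl')%:E) <= _); first exact: le_step.
by apply: step_le_cst => // pi; under eq_esumT do rewrite -EFinM; exact: fS.
Qed.

Lemma run_le1 m l rl F : (forall rl, 0 <= F rl <= 1) -> run m l rl F <= 1.
Proof.
move=> F1; apply: le_trans (_ : run m l rl (fun=> 1%R%:E) <= _).
  by apply: le_run => rl'; case/andP: (F1 rl').
apply: (@run_supermartingale m l rl (fun=> 1%R)) => // rl' pi.
by under eq_esumT do rewrite mulr1; rewrite ftraj_prob_sum1.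
Qed.

Lemma stepD l rl F G : (forall rl, 0 <= F rl) -> (forall rl, 0 <= G rl) ->
  step l rl (fun x => F x + G x) = step l rl F + step l rl G.
Proof.
move=> F0 G0.
have p0 pi tau (K : rawledger -> \bar R) : (forall rl, 0 <= K rl) ->
  0 <= (ftraj_prob mu pi tau)%:E * K (rcons rl (pi, tau)).
  by move=> K0; rewrite mule_ge0 // lee_fin ftraj_prob_ge0.
have q0 o lam (K : rawledger -> \bar R) : (forall rl, 0 <= K rl) ->
  0 <= (N%:R^-1 * hal rl lam)%R%:E * \S_(tau : ftraj)
    ((ftraj_prob mu (pol (@kidx N l o) lam) tau)%:E * K (rcons rl (pol (kidx l o) lam, tau))).
  by move=> K0; rewrite mule_ge0 ?nhal_ge0 //; apply: esumT_ge0 => tau; exact: p0.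
rewrite /step -esumTD; last 2 first.
- by move=> o; apply: esumT_ge0 => lam; exact: q0.
- by move=> o; apply: esumT_ge0 => lam; exact: q0.
apply: eq_esumT => o; rewrite -esumTD; last 2 first.
- by move=> lam; exact: q0.
- by move=> lam; exact: q0.
apply: eq_esumT => lam; rewrite -ge0_muleDr; last 2 first.
- by apply: esumT_ge0 => tau; exact: p0.
- by apply: esumT_ge0 => tau; exact: p0.
congr (_ * _); rewrite -esumTD; last 2 first.
- by move=> tau; exact: p0.
- by move=> tau; exact: p0.
by apply: eq_esumT => tau; rewrite ge0_muleDr.
Qed.

Lemma step_weightE l rl F : (forall rl, 0 <= F rl) -> step l rl F =
  \S_(e : policy * ftraj) (step_weight l rl e.1 *
      ((ftraj_prob mu e.1 e.2)%:E * F (rcons rl e))).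
Proof.
move=> F0.
have p0 pi tau : 0 <= (ftraj_prob mu pi tau)%:E * F (rcons rl (pi, tau)).
  by rewrite mule_ge0 // lee_fin ftraj_prob_ge0.
pose G pi := \S_(tau : ftraj) ((ftraj_prob mu pi tau)%:E * F (rcons rl (pi, tau))).
have G0 pi : 0 <= G pi by apply: esumT_ge0.
have q0 pi o lam : 0 <= (N%:R^-1 * hal rl lam)%R%:E *
    (pol (@kidx N l o) lam == pi)%:R%:E.
  by rewrite mule_ge0 ?nhal_ge0 ?lee_fin.
rewrite esum_prod; last by move=> -[pi tau]; rewrite mule_ge0 ?step_weight_ge0 ?p0.
transitivity (\S_(pi : policy) (step_weight l rl pi * G pi)); last first.
  by apply: eq_esumT => pi; rewrite -esumTZl_ereal ?step_weight_ge0.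
transitivity (\S_(pi : policy) \S_(o : 'I_N) \S_(lam : ledger)
   ((N%:R^-1 * hal rl lam)%R%:E * (pol (kidx l o) lam == pi)%:R%:E * G pi)); last first.
  apply: eq_esumT => pi; rewrite /step_weight muleC -esumTZl_ereal //; last first.
    by move=> o; apply: esumT_ge0.
  apply: eq_esumT => o; rewrite -esumTZl_ereal //.
  by apply: eq_esumT => lam; rewrite muleC.
rewrite esum_exchange; last first.
  by move=> pi o; apply: esumT_ge0 => lam; rewrite mule_ge0.
apply: eq_esumT => o; rewrite esum_exchange; last first.
  by move=> pi lam; rewrite mule_ge0.
apply: eq_esumT => lam; rewrite (@esum_delta _ _ (pol (kidx l o) lam)).
- by rewrite eqxx mule1.
- by rewrite mule_ge0.
- by move=> pi; rewrite eq_sym => /negbTE ->; rewrite mule0 mul0e.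
Qed.

(** The law of the raw ledger factors into a model-free weight and the likelihood of its
    trajectories; all posterior computations rest on this. *)
Lemma run_weightE m l rl F : (forall rl, 0 <= F rl) -> run m l rl F =
  \S_(rest : rawledger) ((size rest == m)%:R%:E * (raw_weight l rl rest *
      ((rawlik mu rest)%:E * F (rl ++ rest)))).
Proof.
have t0 F' (F0 : forall rl, 0 <= F' rl) l' rl1 rl2 rest : 0 <= raw_weight l' rl1 rest *
      ((rawlik mu rest)%:E * F' rl2).
  by rewrite mule_ge0 ?raw_weight_ge0 ?mule_ge0 // lee_fin rawlik_ge0.
move=> F0; elim: m l rl => [|m IH] l rl /=.
  rewrite esum_seq_nil; first by rewrite /rawlik big_nil /= !mul1e cats0.
    by rewrite mule_ge0 ?t0 // lee_fin.
  by move=> x s; rewrite mul0e.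
rewrite step_weightE; last by move=> ?; apply: run_ge0.
rewrite esum_seq_cons; last by rewrite mul0e.
  apply: eq_esumT => e; rewrite IH -esumTZl ?ftraj_prob_ge0 //; last first.
    by move=> rest; rewrite mule_ge0 ?t0 // lee_fin.
  rewrite -esumTZl_ereal ?step_weight_ge0 //; last first.
    by move=> rest; rewrite mule_ge0 ?lee_fin ?ftraj_prob_ge0 // mule_ge0 ?t0 // lee_fin.
  apply: eq_esumT => rest /=; rewrite eqSS cat_rcons.
  rewrite /rawlik big_cons -/(rawlik mu rest) (EFinM (ftraj_prob mu e.1 e.2)).
  rewrite -!muleA [RHS]muleCA; congr (_ * _).
  by rewrite [LHS]muleCA; congr (_ * _); rewrite [LHS]muleCA.
by move=> s; rewrite mule_ge0 ?t0 // lee_fin.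
Qed.

Lemma run_addn m m' l rl F : run (m + m') l rl F = run m l rl (fun rl' => run m' (l + m) rl' F).
Proof.
elim: m l rl => [|m IH] l rl /=; first by rewrite addn0.
congr (step _ _ _); apply/funext => rl'; rewrite IH.
by congr (run _ _ _ _); apply/funext => rl''; rewrite addSnnS.
Qed.

Local Notation hist := (hist_prob P mdl rv nlrn eps pol mu).
Local Notation phase_outN := (phase_out S A H N).

Lemma phase_prob_ge0 l rl ph :
  (0 <= phase_prob P mdl rv nlrn eps pol mu (N := N) l rl ph)%R.
Proof.
apply: mulr_ge0; first by rewrite mulr_ge0 ?invr_ge0 ?hal_ge0.
by apply: prodr_ge0 => i _; exact: ftraj_prob_ge0.
Qed.

Lemma hist_ge0 l rl (phs : seq phase_outN) : (0 <= hist l rl phs)%R.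
Proof.
elim: phs l rl => //= ph phs IH l rl; by apply: mulr_ge0 => //; exact: phase_prob_ge0.
Qed.

(** Only the hallucination episode is recorded; the trajectories of the other episodes are
    integrated out with mass [1]. *)
Lemma phase_sum l rl (F : rawledger -> \bar R) : (forall rl, 0 <= F rl) ->
  \S_(ph : phase_outN) ((phase_prob P mdl rv nlrn eps pol mu l rl ph)%:E *
     F (rcons rl (new_entry pol l ph))) = step l rl F.
Proof.
move=> F0; have q0 (ph : phase_outN) : 0 <= (phase_prob P mdl rv nlrn eps pol mu l rl ph)%:E *
     F (rcons rl (new_entry pol l ph)).
  by rewrite mule_ge0 // lee_fin phase_prob_ge0.
rewrite (@esum_prod R ('I_N * ledger)%type {ffun 'I_N -> ftraj}) //.
rewrite esum_prod; last by move=> z; apply: esumT_ge0.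
apply: eq_esumT => o; apply: eq_esumT => lam.
rewrite /phase_prob /new_entry /=.
pose g (i : 'I_N) := ftraj_prob mu (pol (kidx l i) (if i == o then lam else honest_ledger nlrn rl)).
have g0 i tau : (0 <= g i tau)%R by exact: ftraj_prob_ge0.
have := esum_prod_marginal (g := g) o (F := fun tau => F (rcons rl (pol (kidx l o) lam, tau))).
rewrite {4}/g eqxx => <- //; last by move=> i; apply: ftraj_prob_sum1.
rewrite -esumTZl; first last.
- by move=> f; rewrite mule_ge0 // lee_fin prodr_ge0.
- by rewrite -lee_fin nhal_ge0.
by apply: eq_esumT => f; rewrite EFinM -muleA.
Qed.

Lemma hist_sum m l rl F : (forall rl, 0 <= F rl) ->
  \S_(phs : seq phase_outN) ((size phs == m)%:R%:E * ((hist l rl phs)%:E *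
     F (raw_after pol l rl phs))) = run m l rl F.
Proof.
move=> F0; have t0 (b : bool) l' rl' rl'' (phs : seq phase_outN) :
    0 <= b%:R%:E * ((hist l' rl' phs)%:E * F rl'').
  by rewrite mule_ge0 ?lee_fin // mule_ge0 // lee_fin hist_ge0.
elim: m l rl => [|m IH] l rl /=.
  rewrite esum_seq_nil /=; [by rewrite !mul1e|by rewrite !mul1e|].
  by move=> x s; rewrite mul0e.
rewrite esum_seq_cons //; last by rewrite mul0e.
rewrite -phase_sum; last by move=> rl'; apply: run_ge0.
apply: eq_esumT => ph; rewrite -IH -esumTZl //.
  apply: eq_esumT => phs /=; rewrite eqSS (EFinM (phase_prob P mdl rv nlrn eps pol mu l rl ph)) muleCA -!muleA.
  by congr (_ * _); exact: muleCA.
exact: phase_prob_ge0.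
Qed.

Lemma hist_sum_take m m' l rl F : (forall rl, 0 <= F rl) ->
  \S_(phs : seq phase_outN) ((size phs == (m + m')%N)%:R%:E * ((hist l rl phs)%:E *
     F (raw_after pol l rl (take m phs)))) =
  run m l rl (fun rl' => F rl' * run m' (l + m) rl' (fun=> 1)).
Proof.
move=> F0; have t0 (b : bool) l' rl' rl'' (phs : seq phase_outN) :
    0 <= b%:R%:E * ((hist l' rl' phs)%:E * F rl'').
  by rewrite mule_ge0 ?lee_fin // mule_ge0 // lee_fin hist_ge0.
elim: m l rl => [|m IH] l rl /=.
  rewrite addn0 -hist_sum // -esumTZl_ereal //; last first.
    by move=> phs; rewrite mule_ge0 ?lee_fin // mulr1 hist_ge0.
  apply: eq_esumT => phs; rewrite take0 /= mule1 add0n [RHS]muleCA.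
  by congr (_ * _); exact: muleC.
rewrite addSn esum_seq_cons //; last by rewrite mul0e.
rewrite -phase_sum; last first.
  by move=> rl'; apply: run_ge0 => rl''; rewrite mule_ge0 // run_ge0.
apply: eq_esumT => ph; have := IH l.+1 (rcons rl (new_entry pol l ph)).
rewrite addSnnS => <-; rewrite -esumTZl //.
  apply: eq_esumT => phs /=; rewrite eqSS (EFinM (phase_prob P mdl rv nlrn eps pol mu l rl ph)) muleCA -!muleA.
  by congr (_ * _); exact: muleCA.
exact: phase_prob_ge0.
Qed.

End Run.

End Hallucination.

(** * Signals and best responses *)

Section Agent.
Context (R : realType) (S A H' : nat).
Local Notation H := H'.+1.
Context d (M : measurableType d) (P : probability M R).
Context (mdl : M -> mdp_model R S A H) (rv : nat -> R).
Hypothesis reg : regular_prior mdl rv.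
Local Notation policy := (policy S A H).
Local Notation ledger := (ledger S A H).
Local Notation rawledger := (rawledger S A H).
Context (nlrn : nat) (eps : R).
Local Notation under := (@under_explored S A H nlrn).
Local Notation hal := (hal_prob P mdl rv nlrn eps).
Local Notation punish := (punish mdl rv eps).
Local Notation lik_in := (lik_in P mdl).
Local Notation hal_defined := (hal_defined P mdl rv nlrn eps).

Let muv := reg_valid reg.

Definition lik_ex lam := Ex P (fun w => ledger_lik (mdl w) lam).

Lemma lik_ex_ge0 lam : 0 <= lik_ex lam.
Proof. by apply: Ex_ge0 => w; exact: ledger_lik_ge0. Qed.

Lemma lik_in_le E lam : measurable E -> lik_in E lam <= lik_ex lam.
Proof.
move=> mE; apply: Ex_le => [||w]; [exact: (bmf_lik_in reg)|exact: (bmf_lik reg)|].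
by rewrite indicE; case: (_ \in _); rewrite ?mul1r // mul0r ledger_lik_ge0.
Qed.

Lemma ledger_marg_lik_ex lam : ledger_marg P mdl lam = lik_ex lam.
Proof. by []. Qed.

Lemma can_prob_lik E lam : can_prob P mdl E lam = lik_in E lam / lik_ex lam.
Proof. by rewrite /can_prob fine_integral_in ledger_marg_lik_ex. Qed.

(** The event that all rewards are small is contained in every punish event. A ledger of probability
    [0] is not covered by the infimum, but then the left side is [0]. *)
Lemma q_pun_le rl : q_pun P mdl rv eps * lik_ex (censored_ledger rl) <=
  lik_in (punish (under rl)) (censored_ledger rl).
Proof.
have [m0|m0] := eqVneq (lik_ex (censored_ledger rl)) 0.
  by rewrite m0 mulr0; exact: (lik_in_ge0 P reg).
have {}m0 : 0 < lik_ex (censored_ledger rl) by rewrite lt_neqAle eq_sym m0 lik_ex_ge0.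
pose E := [set w | forall t : tri S A H, rmean rv (mdl w) t <= eps].
have mE : measurable E.
  rewrite (_ : E = small_rewards mdl rv [set: tri S A H]%SET eps); first exact: measurable_small_rewards.
  by apply/seteqP; split => w h t //; apply: h; rewrite finset.in_setT.
rewrite -ler_pdivlMr //.
apply: (@le_trans _ _ (lik_in E (censored_ledger rl) / lik_ex (censored_ledger rl))).
  rewrite -can_prob_lik; apply: ge_inf.
    exists 0 => _ [lam [_ _ ->]]; rewrite can_prob_lik divr_ge0 ?lik_ex_ge0 //.
    exact: (lik_in_ge0 P reg).
  by exists (censored_ledger rl); split.
rewrite ler_pM2r ?invr_gt0 //; apply: Ex_le => [||w].
- exact: (bmf_lik_in reg).
- by apply: (bmf_lik_in reg); exact: measurable_punish.
rewrite ler_wpM2r ?ledger_lik_ge0 // !indicE.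
case: (boolP (w \in E)) => // /set_mem wE; case: (boolP (w \in _)) => //.
by rewrite notin_setE; case => t _; exact: wE.
Qed.

Lemma r_alt_le lam t : 0 < lik_ex lam -> t \in lam.1 ->
  r_alt P mdl rv * lik_ex lam <= Ex P (fun w => rmean rv (mdl w) t * ledger_lik (mdl w) lam).
Proof.
move=> m0 tl; rewrite -ler_pdivlMr //; apply: ge_inf; last by exists lam, t; split.
exists 0 => _ [lam' [t' [_ _ ->]]]; rewrite divr_ge0 ?lik_ex_ge0 //.
apply: (@Ex_ge0 _ _ _ P) => w; rewrite mulr_ge0 ?ledger_lik_ge0 //.
exact: (rmean_ge0 reg).
Qed.

Context (N : nat) (pol : nat -> ledger -> policy).
Hypothesis N0 : (0 < N)%N.
Local Notation raw_weight := (raw_weight P mdl rv nlrn eps N pol).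

Local Open Scope ereal_scope.

(* Probability that the raw ledger of phase [m.+1] has the policies and the
   skeletons of [s], without the model-dependent factor. *)
Definition ledger_weight m (s : ledger) : \bar R :=
  ((size s.2 == m) && (s.1 == under (uncens s.2)))%:R%:E * raw_weight 1 [::] (uncens s.2).

Lemma ledger_weight_ge0 m s : 0 <= ledger_weight m s.
Proof. by rewrite mule_ge0 ?lee_fin // (raw_weight_ge0 _ reg). Qed.

Lemma ledger_weight_fin m s : ledger_weight m s \is a fin_num.
Proof.
rewrite fin_numM // ge0_fin_numE; last exact: (raw_weight_ge0 _ reg).
apply: le_lt_trans (ltry 1); exact: (raw_weight_le1 _ reg).
Qed.

(** All raw ledgers with honest ledger [s] share one skeleton, hence one weight; their likelihoods
    add up to that of [s] by [rawlik_cens]. *)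
Lemma honest_sum w m s :
  \S_(rl : rawledger) ((size rl == m)%:R%:E * (raw_weight 1 [::] rl *
     ((rawlik (mdl w) rl)%:E * (honest_ledger nlrn rl == s)%:R%:E))) =
  ledger_weight m s * (ledger_lik (mdl w) s)%:E.
Proof.
case: s => U cl; rewrite -(rawlik_cens (muv w) U cl) -esumTZl_ereal ?ledger_weight_ge0 //; last first.
  by move=> rl; rewrite mule_ge0 ?lee_fin // rawlik_ge0.
apply: eq_esumT => rl; rewrite /honest_ledger xpair_eqE -/(cens _ _) /ledger_weight /=.
have [E|ne] := eqVneq (cens U rl) cl; last first.
  have [EU|_] := eqVneq (under rl) U; last by rewrite /= !mule0.
  by rewrite EU (negbTE ne) /= !mule0.
have sk : skel rl = skel (uncens cl) by rewrite skel_uncens -E skel_cens_cens.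
rewrite -(under_explored_skel nlrn sk).
rewrite -(@raw_weight_skel _ _ _ _ _ _ P mdl rv nlrn eps N pol 1 [::] [::] rl (uncens cl)) //.
rewrite (_ : size cl = size rl); last by rewrite -E size_map.
have [EU|_] := eqVneq (under rl) U; last by rewrite eq_sym /= andbF !mule0 !mul0e.
by rewrite EU E !eqxx !andbT !muleA.
Qed.

(** The raw ledger enters through its skeleton alone, which [s] determines; summing its likelihood
    over the rewards gives that of the censored ledger. *)
Lemma hal_raw_sum w m s :
  \S_(rl : rawledger) ((size rl == m)%:R%:E * (raw_weight 1 [::] rl *
     ((rawlik (mdl w) rl)%:E * (hal rl s)%:E))) =
  ledger_weight m s * (hal (uncens s.2) s *
     ledger_lik (mdl w) (censored_ledger (uncens s.2)))%R%:E.
Proof.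
case: s => U cl; set u := uncens cl; set s := (U, cl).
rewrite EFinM -(rawlik_cens (muv w)) -/(cens _ _) -esumTZl ?(hal_ge0 P reg) //; last first.
  by move=> rl; rewrite mule_ge0 ?lee_fin // rawlik_ge0.
rewrite -esumTZl_ereal ?ledger_weight_ge0 //; last first.
  move=> rl; apply: mule_ge0; first by rewrite lee_fin (hal_ge0 P reg).
  by rewrite mule_ge0 ?lee_fin // rawlik_ge0.
apply: eq_esumT => rl; rewrite cens_setT_eq /ledger_weight /= -/u.
have [sk|ne] := eqVneq (skel rl) (skel u); last first.
  have -> : hal rl s = 0%R; last by rewrite !mule0.
  by rewrite (hal_probE P mdl rv) /= -skel_uncens -/u [skel u == _]eq_sym (negbTE ne) andbF mul0r.
rewrite (hal_skel P mdl rv nlrn eps s sk).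
rewrite (raw_weight_skel P mdl rv nlrn eps N pol 1 (erefl (skel [::])) sk).
rewrite (_ : size cl = size rl); last by rewrite -(size_skel rl) sk size_skel size_map.
have [EU|ne] := eqVneq U (under u); last first.
  have -> : hal u s = 0%R; last by rewrite !mul0e !mule0.
  by rewrite (hal_probE P mdl rv) /= (negbTE ne) mul0r.
rewrite andbT mule1 -!muleA; congr (_ * (_ * _)); exact: muleC.
Qed.

Definition weight m s : R := fine (ledger_weight m s).

Lemma weightE m s : (weight m s)%:E = ledger_weight m s.
Proof. by rewrite fineK ?ledger_weight_fin. Qed.

Lemma weight_ge0 m s : (0 <= weight m s)%R.
Proof. by rewrite -lee_fin weightE ledger_weight_ge0. Qed.

(* The two summands come from [kidx m.+1 o] being the hallucination episode or
   not. Under honesty [s] enters through its own likelihood, and under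
   hallucination only through that of its censored version. *)
Lemma signal_probE w m (o : 'I_N) s :
  signal_prob P mdl rv N nlrn eps pol (kidx m.+1 o) (mdl w) s =
  (weight m s * N%:R^-1 * (hal (uncens s.2) s *
       ledger_lik (mdl w) (censored_ledger (uncens s.2)) +
     N.-1%:R * (hal_defined (uncens s.2))%:R * ledger_lik (mdl w) s))%R%:E.
Proof.
rewrite /signal_prob /kidx /= divnMDl // modnMDl divn_small // modn_small // addn0.
set hist := hist_prob _ _ _ _ _ _ _.
pose last_step rl : \bar R := \S_(o' : 'I_N) \S_(lam : ledger)
  (((if o' == o then lam else honest_ledger nlrn rl) == s)%:R%:E * (N%:R^-1 * hal rl lam)%R%:E).
have nh := nhal_ge0 P reg nlrn eps N.
have bh (b : bool) rl lam : 0 <= b%:R%:E * (N%:R^-1 * hal rl lam)%R%:E.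
  by rewrite mule_ge0 ?lee_fin // -lee_fin nh.
have ls0 rl : 0 <= last_step rl.
  by apply: esumT_ge0 => o'; apply: esumT_ge0 => lam.
have hon_def rl : honest_ledger nlrn rl == s -> hal_defined rl = hal_defined (uncens s.2).
  move=> /eqP E; have sk : skel rl = skel (uncens s.2).
    by rewrite skel_uncens -E /= -/(cens _ _) skel_cens_cens.
  by rewrite /Submission.hal_defined (under_explored_skel nlrn sk) (censored_ledger_skel sk).
transitivity (run P mdl rv nlrn eps N pol (mdl w) m 1 [::] last_step).
  rewrite -(hist_sum P reg nlrn eps N pol (muv w) m 1 [::] ls0) [LHS]esum_mkcond.
  have t0 (z : seq (phase_out S A H N) * 'I_N * ledger) :
      (0 <= hist 1 [::] z.1.1 * N%:R^-1 * hal (raw_after pol 1 [::] z.1.1) z.2)%R.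
    rewrite -mulrA mulr_ge0 //; first exact: (hist_ge0 P reg _ _ _ (muv w)).
    by rewrite -lee_fin nh.
  rewrite (@esum_prod R (seq (phase_out S A H N) * 'I_N)%type ledger); last first.
    by move=> z; case: ifP => // _; rewrite lee_fin t0.
  rewrite (@esum_prod R (seq (phase_out S A H N)) 'I_N); last first.
    by move=> z; apply: esumT_ge0 => lam; case: ifP => // _; rewrite lee_fin t0.
  have h0 phs : (0 <= hist 1 [::] phs)%R by exact: (hist_ge0 P reg _ _ _ (muv w)).
  apply: eq_esumT => phs; rewrite -esumTZl //; last first.
    by move=> o'; apply: esumT_ge0 => lam; exact: bh.
  rewrite -esumTZl //; last first.
    move=> o'; apply: mule_ge0; last by apply: esumT_ge0 => lam; exact: bh.
    by rewrite lee_fin h0.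
  apply: eq_esumT => o'; rewrite -esumTZl //.
  rewrite -esumTZl //; last first.
    by move=> lam; apply: mule_ge0; [rewrite lee_fin h0|exact: bh].
  apply: eq_esumT => lam /=; set D := [set z | _].
  have -> : ((phs, o', lam) \in D) = (size phs == m) &&
     ((if o' == o then lam else honest_ledger nlrn (raw_after pol 1 [::] phs)) == s).
    apply/idP/andP; first by move=> /set_mem[/= -> /eqP ->].
    by move=> [/eqP h1 /eqP h2]; apply/mem_set; split.
  case: (size phs == m) => /=; last by rewrite mul0e.
  rewrite mul1e; case: (_ == s); last by rewrite mul0e mule0.
  by rewrite mul1e -EFinM; congr EFin; exact: (esym (mulrA _ _ _)).
rewrite (run_weightE P reg nlrn eps N pol (muv w) m 1 [::] ls0).
(* Share of the [N - 1] offsets at which the signal is honest. An undefined hallucination gives the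
   whole phase mass [0], its honest signals included. *)
pose c : R := (N.-1%:R * N%:R^-1 * (hal_defined (uncens s.2))%:R)%R.
have c0 : (0 <= c)%R by rewrite /c !mulr_ge0 ?invr_ge0.
have lsE rl : last_step rl = (N%:R^-1 * hal rl s + c * (honest_ledger nlrn rl == s)%:R)%R%:E.
  pose g (o' : 'I_N) : R := (if o' == o then N%:R^-1 * hal rl s else
      (honest_ledger nlrn rl == s)%:R * N%:R^-1 * (hal_defined rl)%:R)%R.
  have gE o' : \S_(lam : ledger)
      (((if o' == o then lam else honest_ledger nlrn rl) == s)%:R%:E *
       (N%:R^-1 * hal rl lam)%R%:E) = (g o')%:E.
    rewrite /g; case: (o' == o).
      rewrite (@esum_delta _ _ s) ?eqxx ?mul1e //.
      by move=> lam /negbTE ->; rewrite mul0e.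
    rewrite esumTZl // -mulrA [in RHS]EFinM; congr (_ * _).
    under eq_esumT do rewrite EFinM.
    rewrite esumTZl ?invr_ge0 //; last by move=> lam; rewrite lee_fin (hal_ge0 P reg).
    by rewrite (hal_sum P reg) -EFinM.
  rewrite /last_step; under eq_esumT do rewrite gE.
  have g0 o' : (0 <= g o')%R.
    by rewrite -lee_fin -gE; apply: esumT_ge0 => lam; exact: bh.
  rewrite esum_finR // (bigD1 o) //= {1}/g eqxx; congr (_ + _)%R%:E.
  rewrite (eq_bigr (fun=> (honest_ledger nlrn rl == s)%:R * N%:R^-1 * (hal_defined rl)%:R)%R); last first.
    by move=> o' /negbTE; rewrite /g => ->.
  rewrite sumr_const cardC1 card_ord /c -(mulr_natr _ N.-1).
  have [E|_] := boolP (_ == s); last by rewrite /=; ring.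
  rewrite (hon_def _ E); ring.
under eq_esumT => rl.
  rewrite /= lsE.
  have -> : (size rl == m)%:R%:E * (raw_weight 1 [::] rl * ((rawlik (mdl w) rl)%:E *
      (N%:R^-1 * hal rl s + c * (honest_ledger nlrn rl == s)%:R)%R%:E)) =
    (N%:R^-1)%:E * ((size rl == m)%:R%:E * (raw_weight 1 [::] rl *
     ((rawlik (mdl w) rl)%:E * (hal rl s)%:E))) +
    c%:E * ((size rl == m)%:R%:E * (raw_weight 1 [::] rl *
     ((rawlik (mdl w) rl)%:E * (honest_ledger nlrn rl == s)%:R%:E))).
    have <- : (fine (raw_weight 1 [::] rl))%:E = raw_weight 1 [::] rl.
      rewrite fineK // ge0_fin_numE; last exact: (raw_weight_ge0 P reg).
      exact: le_lt_trans (raw_weight_le1 P reg _ _ _ N0 _ _ _) (ltry _).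
    rewrite -!EFinM -EFinD; congr EFin; ring.
  over.
have wt0 rl (x : R) : (0 <= x)%R -> 0 <= (size rl == m)%:R%:E * (raw_weight 1 [::] rl *
     ((rawlik (mdl w) rl)%:E * x%:E)).
  move=> x0; rewrite mule_ge0 ?lee_fin // mule_ge0 ?(raw_weight_ge0 P reg) //.
  by rewrite mule_ge0 ?lee_fin ?rawlik_ge0.
rewrite esumTD; last 2 first.
- by move=> rl; apply: mule_ge0; rewrite ?lee_fin ?invr_ge0 // wt0 // (hal_ge0 P reg).
- by move=> rl; apply: mule_ge0; rewrite ?lee_fin // wt0.
rewrite !esumTZl ?invr_ge0 //; first last.
- by move=> rl; rewrite wt0 // (hal_ge0 P reg).
- by move=> rl; rewrite wt0.
rewrite hal_raw_sum honest_sum -weightE -!EFinM -EFinD; congr EFin; rewrite /c; ring.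
Qed.

End Agent.

(** * Incentives created by a hallucinated ledger *)

Section BestResponse.
Context (R : realType) (S A H' : nat).
Local Notation H := H'.+1.
Context d (M : measurableType d) (P : probability M R).
Context (mdl : M -> mdp_model R S A H) (rv : nat -> R).
Hypothesis reg : regular_prior mdl rv.
Local Notation policy := (policy S A H).
Local Notation ledger := (ledger S A H).
Context (nlrn : nat) (eps : R).
Local Notation under := (@under_explored S A H nlrn).
Local Notation hal := (hal_prob P mdl rv nlrn eps).
Local Notation punish := (punish mdl rv eps).
Local Notation lik_in := (lik_in P mdl).
Local Notation lik_ex := (lik_ex P mdl).
Local Notation q := (q_pun P mdl rv eps).

Let muv := reg_valid reg.

Lemma hal_gt0 u s : 0 < hal u s ->
  [/\ s.1 = under u, 0 < lik_in (punish s.1) s & 0 < lik_in (punish s.1) (censored_ledger u)].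
Proof.
rewrite (hal_probE P mdl rv).
have [EU|ne] := eqVneq s.1 (under u); last by rewrite mul0r ltxx.
have s0 := lik_in_ge0 P reg (punish s.1) s.
have c0 := lik_in_ge0 P reg (punish s.1) (censored_ledger u).
case: (_ == _); last by rewrite mul0r ltxx.
rewrite mul1r -EU => h; split => //; rewrite lt_neqAle eq_sym ?s0 ?c0 andbT.
  by apply: contraTneq h => ->; rewrite mul0r ltxx.
by apply: contraTneq h => ->; rewrite invr0 mulr0 ltxx.
Qed.

(** [hal u s] is a ratio whose denominator, the unnormalized posterior probability of the punish
    event, is at least [q] times the probability of the censored ledger. *)
Lemma hal_cens_le_in u s : 0 < q -> 0 < hal u s ->
  hal u s * lik_ex (censored_ledger u) <= q^-1 * lik_in (punish s.1) s.
Proof.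
move=> q0 h; have [EU s0 c0] := hal_gt0 h.
have halE : hal u s = lik_in (punish s.1) s / lik_in (punish s.1) (censored_ledger u).
  move: h; rewrite (hal_probE P mdl rv) EU eqxx.
  by case: (_ == _); rewrite ?mul1r // mul0r ltxx.
rewrite halE mulrAC ler_pdivrMr // mulrAC [leRHS]mulrC ler_wpM2l ?(ltW s0) //.
by rewrite mulrC ler_pdivlMr // mulrC EU; exact: (q_pun_le P reg).
Qed.

Lemma hal_cens_le u s : 0 < q -> 0 < hal u s ->
  hal u s * lik_ex (censored_ledger u) <= q^-1 * lik_ex s.
Proof.
move=> q0 h; apply: le_trans (hal_cens_le_in q0 h) _.
rewrite ler_wpM2l ?invr_ge0 ?(ltW q0) //; apply: (lik_in_le P reg).
exact: measurable_punish.
Qed.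

Context (N : nat) (pol : nat -> ledger -> policy).
Hypothesis N0 : (0 < N)%N.
Hypothesis br : best_responses P mdl rv N nlrn eps pol.
Hypothesis q0 : 0 < q.

(** The agent maximizes against the mixture of [signal_probE]. Values lie between [0] and [H], so
    the hallucinated part shifts the comparison by at most [H] times its mass, which [hal_cens_le]
    bounds by [q^-1 * lik_ex s]; the honest part has weight [N - 1]. *)
Lemma best_response_gap m (o : 'I_N) s pi' :
  0 < weight P mdl rv nlrn eps N pol m s -> 0 < hal (uncens s.2) s ->
  N.-1%:R * (Ex P (fun w => value rv pi' (mdl w) * ledger_lik (mdl w) s) -
    Ex P (fun w => value rv (pol (kidx m.+1 o) s) (mdl w) * ledger_lik (mdl w) s)) <=
  H%:R * q^-1 * lik_ex s.
Proof.
set u := uncens s.2; move=> c0 h0.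
have [EU s0 cens0] := hal_gt0 h0.
pose L1 w := ledger_lik (mdl w) (censored_ledger u).
pose L2 w := ledger_lik (mdl w) s.
pose c := weight P mdl rv nlrn eps N pol m s * N%:R^-1.
have {}c0 : 0 < c by rewrite divr_gt0 // ltr0n.
pose g w := hal u s * L1 w + N.-1%:R * L2 w.
have bL1 : bounded_mfun L1 by exact: (bmf_lik reg).
have bL2 : bounded_mfun L2 by exact: (bmf_lik reg).
have bV pi : bounded_mfun (fun w => value rv pi (mdl w)) by exact: (bmf_value reg).
have bg : bounded_mfun g by apply: bmfD; exact: bmfZ.
have L1_ge0 w : 0 <= L1 w by exact: ledger_lik_ge0.
have L2_ge0 w : 0 <= L2 w by exact: ledger_lik_ge0.
have sE w : signal_prob P mdl rv N nlrn eps pol (kidx m.+1 o) (mdl w) s = (c * g w)%:E.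
  rewrite (signal_probE P reg nlrn eps pol N0) -/u (_ : hal_defined _ _ _ _ _ u) ?mulr1 //.
  by rewrite /hal_defined -EU.
have avE pi : agent_value P mdl rv N nlrn eps pol (kidx m.+1 o) s pi =
    Ex P (fun w => value rv pi (mdl w) * g w) / Ex P g.
  rewrite /agent_value.
  under eq_integral do rewrite sE -EFinM.
  under [X in _ / fine X]eq_integral do rewrite sE.
  rewrite -/(Rintegral _ _ _) -/(Rintegral _ _ _) -/(Ex P _) -/(Ex P _).
  under eq_Ex do rewrite mulrCA.
  rewrite !ExZ //; last exact: bmfM.
  by rewrite -mulf_div divff ?mul1r // gt_eqF.
have exL1 : 0 < Ex P L1.
  apply: lt_le_trans cens0 _; apply: (lik_in_le P reg).
  by rewrite EU; exact: measurable_punish.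
have g0 : 0 < Ex P g.
  rewrite /g ExD ?ExZ //; [|exact: bmfZ|exact: bmfZ].
  apply: (@lt_le_trans _ _ (hal u s * Ex P L1)); first exact: mulr_gt0.
  by rewrite lerDl mulr_ge0 // Ex_ge0.
have := br s (isT : (0 < kidx m.+1 o)%N) pi'.
rewrite !avE ler_pM2r ?invr_gt0 //.
have gE pi : Ex P (fun w => value rv pi (mdl w) * g w) =
   hal u s * Ex P (fun w => value rv pi (mdl w) * L1 w) +
   N.-1%:R * Ex P (fun w => value rv pi (mdl w) * L2 w).
  rewrite -!ExZ -?ExD; try exact: bmfM; try by apply: bmfZ; exact: bmfM.
  by apply: eq_Ex => w; rewrite /g; ring.
rewrite !gE => hle.
have V0 : 0 <= hal u s * Ex P (fun w => value rv pi' (mdl w) * L1 w).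
  rewrite mulr_ge0 ?(ltW h0) //; apply: (@Ex_ge0 _ _ _ P) => w.
  by rewrite mulr_ge0 // (value_ge0 reg).
have VH : hal u s * Ex P (fun w => value rv (pol (kidx m.+1 o) s) (mdl w) * L1 w) <=
    H%:R * q^-1 * lik_ex s.
  apply: (@le_trans _ _ (H%:R * (hal u s * lik_ex (censored_ledger u)))); last first.
    by rewrite -mulrA ler_wpM2l // hal_cens_le.
  rewrite mulrCA ler_wpM2l ?(ltW h0) // -ExZ //.
  apply: Ex_le => [||w]; [exact: bmfM|exact: bmfZ|].
  by rewrite ler_wpM2r // (value_le reg).
rewrite mulrBr; lra.
Qed.

End BestResponse.

(** * Deviation of empirical averages *)

Section MomentGenerating.
Context (R : realType).

(** From [1 - z <= expR (- z)], that is [expR z <= 1 / (1 - z)]. *)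
Lemma expR_le_quad (z : R) : z <= 2^-1 -> expR z <= 1 + z + 2 * z ^+ 2.
Proof.
move=> z2; have z1 : 0 < 1 - z by lra.
have h : 1 - z <= expR (- z) by exact: expR_ge1Dx.
have e0 := expR_gt0 z.
have : expR z * (1 - z) <= 1.
  apply: (@le_trans _ _ (expR z * expR (- z))); last by rewrite expRxMexpNx_1.
  by rewrite ler_wpM2l // ltW.
move=> h2; rewrite -(ler_pM2r z1); apply: le_trans h2 _.
rewrite -subr_ge0 (_ : _ - 1 = z ^+ 2 * (1 - 2 * z)); last by ring.
by rewrite mulr_ge0 ?sqr_ge0 //; lra.
Qed.

Variables (T : countType) (p v : T -> R) (m eta : R).
Hypotheses (p0 : forall x, 0 <= p x) (p1 : (\S_x (p x)%:E = 1)%E).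
Hypotheses (v01 : forall x, 0 <= v x <= 1) (pv : (\S_x (p x * v x)%:E = m%:E)%E).
Hypotheses (eta0 : 0 <= eta) (eta1 : eta <= 2^-1).

Lemma mgf_mean : 0 <= m <= 1.
Proof.
apply/andP; split; rewrite -lee_fin -pv.
  by apply: esumT_ge0 => x; rewrite lee_fin mulr_ge0 //; case/andP: (v01 x).
by rewrite -p1; apply: le_esumT => x; rewrite lee_fin ler_piMr //; case/andP: (v01 x).
Qed.

(** Since [(v x - m) ^+ 2 <= 1], the quadratic bound on the exponential is majorized by an affine
    function of [v x] with mean [1 + 2 * eta ^+ 2]. The compensator [2 * eta ^+ 2] then gives a
    supermartingale increment. *)
Lemma mgf_le1 :
  (\S_x (p x * expR (eta * (v x - m) - 2 * eta ^+ 2))%:E <= 1)%E.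
Proof.
have /andP[m0 m1] := mgf_mean.
have a0 : 0 <= 1 + 2 * eta ^+ 2 - eta * m.
  have em : eta * m <= eta by rewrite ler_piMr.
  have e2 := sqr_ge0 eta; have e1 := eta1; lra.
pose a := 1 + 2 * eta ^+ 2 - eta * m; rewrite -/a in a0.
apply: (@le_trans _ _ (\S_x ((expR (- (2 * eta ^+ 2)))%:E * (p x * a + eta * (p x * v x))%:E))%E).
  apply: le_esumT => x; rewrite -EFinM lee_fin.
  have -> : p x * a + eta * (p x * v x) = p x * (a + eta * v x) by ring.
  rewrite expRD mulrA [leRHS]mulrC ler_wpM2r ?expR_ge0 // ler_wpM2l //.
  apply: le_trans (expR_le_quad _) _.
    apply: (@le_trans _ _ (eta * 1)); last by rewrite mulr1.
    have /andP[v0 v1] := v01 x.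
    by rewrite ler_wpM2l //; lra.
  have /andP[v0 v1] := v01 x.
  have vm : (v x - m) ^+ 2 <= 1.
    rewrite -subr_ge0 (_ : 1 - _ = (1 - (v x - m)) * (1 + (v x - m))); last by ring.
    by apply: mulr_ge0; lra.
  have := ler_wpM2l (sqr_ge0 eta) vm; rewrite /a exprMn mulr1 => h; lra.
rewrite esumTZl ?expR_ge0 //; last first.
  move=> x; rewrite lee_fin addr_ge0 ?mulr_ge0 //; by case/andP: (v01 x).
have -> : (\S_x (p x * a + eta * (p x * v x))%:E = (1 + 2 * eta ^+ 2)%:E)%E.
  under eq_esumT do rewrite EFinD EFinM (EFinM eta).
  rewrite esumTD; last 2 first.
  - by move=> x; rewrite -EFinM lee_fin mulr_ge0.
  - by move=> x; rewrite -EFinM lee_fin !mulr_ge0 //; case/andP: (v01 x).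
  rewrite esumTZr // esumTZl //; last by move=> x; rewrite lee_fin mulr_ge0 //; case/andP: (v01 x).
  by rewrite p1 pv mul1e -EFinM -EFinD; congr EFin; rewrite /a; ring.
rewrite -EFinM lee_fin expRN mulrC ler_pdivrMr ?expR_gt0 // mul1r.
exact: expR_ge1Dx.
Qed.

End MomentGenerating.

(** * Tests of a model against a ledger and their exponential factors *)

Section Tests.
Context (R : realType) (S A H' : nat).
Local Notation H := H'.+1.
Local Notation tri := (tri S A H).
Local Notation ftraj := (ftraj S A H).
Local Notation ctraj := (ctraj S A H).
Local Notation ledger := (ledger S A H).

(* Empirical averages compared with their means: signed rewards at a triple,
   next states at a triple lying in a set, initial states lying in a set. *)
Definition test := ((bool * tri) + (tri * {set 'I_S}) + {set 'I_S})%type.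

Definition at_triple (t : tri) (c : ctraj) := (c t.2).1 == t.1.

Definition trials (th : test) (c : ctraj) : bool :=
  match th with
  | inl (inl (_, t)) => at_triple t c
  | inl (inr (t, _)) => at_triple t c
  | inr _ => true
  end.

Definition relevant n (th : test) (s : ledger) : bool :=
  match th with
  | inl (inl (_, t)) => t \notin s.1
  | inl (inr (t, _)) => t \notin s.1
  | inr _ => (n <= size s.2)%N
  end.

(** A missing reward is read as [0]; relevant reward tests concern only triples outside the
    censoring set. At the last stage there is no next state and the deviation is [0]. *)
Definition deviation (rv : nat -> R) (mu : mdp_model R S A H) (th : test) (c : ctraj) : R :=
  match th with
  | inl (inl (b, t)) =>
      if at_triple t c then (-1) ^+ b * (oapp rv 0 (c t.2).2 - rmean rv mu t) else 0
  | inl (inr (t, B)) =>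
      if at_triple t c then
        if next_stage t.2 is Some h' then
          ((c h').1.1 \in B)%:R - \sum_(y in B) trans mu t.1.1 t.1.2 t.2 y
        else 0
      else 0
  | inr B => ((c ord0).1.1 \in B)%:R - \sum_(y in B) init mu y
  end.

Definition deviates rv n (e : R) (s : ledger) (mu : mdp_model R S A H) : bool :=
  [exists th : test, relevant n th s &&
    (e * (\sum_(x <- s.2) (trials th x.2)%:R) < \sum_(x <- s.2) deviation rv mu th x.2)].

Context d (M : measurableType d).
Context (mdl : M -> mdp_model R S A H) (rv : nat -> R).
Hypothesis reg : regular_prior mdl rv.

Let muv := reg_valid reg.

Section Factor.
Variables (eta : R).
Hypotheses (eta0 : 0 <= eta) (eta1 : eta <= 2^-1).

(** Taken on the uncensored trajectory: the censoring set changes from phase to phase, and by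
    [deviation_censor] relevant tests do not see it. *)
Definition test_factor w th (tau : ftraj) : R :=
  expR (eta * deviation rv (mdl w) th (censor finset.set0 tau) -
        2 * eta ^+ 2 * (trials th (censor finset.set0 tau))%:R).

Lemma factor_ge0 w th tau : (0 <= (test_factor w th tau)%:E)%E.
Proof. by rewrite lee_fin expR_ge0. Qed.

Lemma path_avg_le1 w pi (F : {ffun 'I_H -> 'I_S} -> R) : (forall x, F x <= 1) ->
  \sum_x path_prob (mdl w) pi x * F x <= 1.
Proof.
move=> F1; rewrite -(path_prob_sum1 pi (muv w)); apply: ler_sum => x _.
by rewrite ler_piMr ?path_prob_ge0.
Qed.

Lemma sum_mem_indic (p : 'I_S -> R) (B : {set 'I_S}) : \sum_(y in B) p y = \sum_y p y * (y \in B)%:R.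
Proof.
rewrite big_mkcond /=; apply: eq_bigr => y _.
by case: (y \in B); rewrite ?mulr1 ?mulr0.
Qed.

Lemma indicator_mgf (p : 'I_S -> R) (B : {set 'I_S}) : (forall y, 0 <= p y) -> \sum_y p y = 1 ->
  \sum_y p y * expR (eta * ((y \in B)%:R - \sum_(y in B) p y) - 2 * eta ^+ 2) <= 1.
Proof.
move=> p0 p1; rewrite -lee_fin -esum_finR; last by move=> y; rewrite mulr_ge0 ?expR_ge0.
apply: (mgf_le1 (v := fun y => (y \in B)%:R)) => //.
- by rewrite esum_finR // p1.
- by move=> y; case: (y \in B); rewrite /= lexx ler01.
- by rewrite esum_finR ?sum_mem_indic // => y; rewrite mulr_ge0.
Qed.

(** The factor is absorbed into the initial distribution, whose tilted mass is at most [1]. *)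
Lemma test_factor_init w pi B : (\S_(tau : ftraj) ((ftraj_prob (mdl w) pi tau)%:E *
   (test_factor w (inr B) tau)%:E) <= 1)%E.
Proof.
pose f y := expR (eta * ((y \in B)%:R - \sum_(y in B) init (mdl w) y) - 2 * eta ^+ 2).
rewrite (traj_esum_path (muv w) (F := fun x => f (x ord0)) (factor_ge0 w _)); last first.
  by move=> x r; rewrite /test_factor /f /deviation !ffunE /= mulr1.
rewrite lee_fin; under eq_bigr do rewrite path_probE mulrAC.
apply: le_trans (_ : \sum_y init (mdl w) y * f y <= 1).
  apply: (chain_mass_le _ _ (a := fun y => init (mdl w) y * f y)).
  - by move=> *; apply: kernel_of_ge0.
  - by move=> *; rewrite kernel_of_sum1.
  - by move=> y; rewrite mulr_ge0 ?expR_ge0 // init_ge0.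
by apply: indicator_mgf => [y|]; [exact: init_ge0|exact: init_sum1].
Qed.

(** The factor is absorbed into the kernel at stage [t.2]. By [indicator_mgf] the tilted kernel is
    substochastic, so the path weights still add up to at most [1]. At the last stage the factor
    itself is at most [1]. *)
Lemma test_factor_trans w pi t B : (\S_(tau : ftraj) ((ftraj_prob (mdl w) pi tau)%:E *
   (test_factor w (inl (inr (t, B))) tau)%:E) <= 1)%E.
Proof.
pose p := trans (mdl w) t.1.1 t.1.2 t.2.
pose f y := expR (eta * ((y \in B)%:R - \sum_(y in B) p y) - 2 * eta ^+ 2).
pose at_ (x : {ffun 'I_H -> 'I_S}) := (x t.2, pi (x t.2, t.2)) == t.1.
pose F x := if at_ x then
  if next_stage t.2 is Some h' then f (x h') else expR (- (2 * eta ^+ 2)) else 1.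
rewrite (traj_esum_path (muv w) (F := F) (factor_ge0 w _)); last first.
  move=> x r; rewrite /test_factor /F /deviation /trials /at_triple /at_ !ffunE /=.
  case: (_ == t.1); last by rewrite /= ?mulr0n !mulr0 subr0 expR0.
  case: (next_stage t.2) => [h'|]; last by rewrite mulr0 mulr1 add0r.
  by rewrite mulr1 !ffunE.
rewrite lee_fin; have [hE|[h' hE]] : next_stage t.2 = None \/ exists h', next_stage t.2 = Some h'.
    by case: (next_stage t.2) => [h'|]; [right; exists h'|left].
  apply: path_avg_le1 => x; rewrite /F hE; case: ifP => // _.
  by rewrite -expR0 ler_expR oppr_le0 mulr_ge0 ?sqr_ge0.
pose phi y z := if (y, pi (y, t.2)) == t.1 then f z else 1.
pose k' i y z := kernel_of (mdl w) pi i y z * (if i == t.2 :> nat then phi y z else 1).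
have pathE x : path_prob (mdl w) pi x * F x = init (mdl w) (x ord0) * chain_weight k' 0 x.
  rewrite path_probE -mulrA; congr (_ * _).
  have -> : F x = \prod_(h < H)
     (if (insub h.+1 : option 'I_H) is Some h'' then
        if h == t.2 then phi (x h) (x h'') else 1 else 1).
    rewrite (bigD1 t.2) //= eqxx; move: hE; rewrite /F /next_stage => ->.
    rewrite big1 ?mulr1 /phi /at_ // => h /negbTE ne; case: insub => // ?.
    by rewrite ne.
  rewrite /chain_weight -big_split; apply: eq_bigr => h _ /=.
  by case: insub => [h''|]; rewrite ?mulr1 // /k' add0n.
under eq_bigr do rewrite pathE.
rewrite -(init_sum1 (muv w)); apply: chain_mass_le => [i y z|i y|y]; last exact: init_ge0.
  rewrite mulr_ge0 ?kernel_of_ge0 // /phi; do 2! case: ifP => // _.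
  exact: expR_ge0.
rewrite /k'; have [it|_] := eqVneq i (t.2 : nat); last first.
  by under eq_bigr do rewrite mulr1; rewrite kernel_of_sum1.
rewrite /phi; have [yt|_] := eqVneq (y, pi (y, t.2)) t.1; last first.
  by under eq_bigr do rewrite mulr1; rewrite kernel_of_sum1.
have kE z : kernel_of (mdl w) pi i y z = p z.
  by rewrite /kernel_of it inord_val /p -yt.
under eq_bigr do rewrite kE.
have [_ [t0 t1] _] := muv w.
by apply: indicator_mgf => [z|]; [exact: t0|exact: t1].
Qed.

(** A negative sign is removed by passing to the rewards [1 - rv n], again in the unit interval.
    Given the state path, rewards are independent and only the one at stage [t.2] carries a
    factor. *)
Lemma test_factor_reward w pi b t : (\S_(tau : ftraj) ((ftraj_prob (mdl w) pi tau)%:E *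
   (test_factor w (inl (inl (b, t))) tau)%:E) <= 1)%E.
Proof.
have r0 x a h n := rew_ge0 (muv w) x a h n.
pose p n := rew (mdl w) t.1.1 t.1.2 t.2 n.
pose v n := if b then 1 - rv n else rv n.
pose m := if b then 1 - rmean rv (mdl w) t else rmean rv (mdl w) t.
pose f n := expR (eta * (v n - m) - 2 * eta ^+ 2).
have f0 n : 0 <= f n by exact: expR_ge0.
have p0 n : 0 <= p n by exact: r0.
have rv0 := rv_ge0 reg; have rv1 := rv_le1 reg.
have pv : (\S_n (p n * v n)%:E = m%:E)%E.
  rewrite /v /m; case: ifP => _; last by rewrite (rmeanE reg).
  have : (\S_n (p n * (1 - rv n))%:E + \S_n (p n * rv n)%:E = 1)%E.
    rewrite -esumTD; last 2 first.
    - by move=> n; rewrite lee_fin mulr_ge0 ?subr_ge0 ?p0 ?rv1.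
    - by move=> n; rewrite lee_fin mulr_ge0 ?p0 ?rv0.
    rewrite -(rew_sum1 (muv w) t.1.1 t.1.2 t.2); apply: eq_esumT => n.
    by rewrite -EFinD; congr EFin; rewrite /p; ring.
  rewrite -(rmeanE reg) => /(congr1 (fun z => z - (rmean rv (mdl w) t)%:E)%E).
  by rewrite addeK // => ->.
have fle : (\S_n (p n * f n)%:E <= 1)%E.
  apply: (mgf_le1 (v := v)) => //; first exact: (rew_sum1 (muv w)).
  by move=> n; rewrite /v; case: ifP => _; apply/andP; split; rewrite ?subr_ge0 ?gerBl.
have fS : (\S_n (p n * f n)%:E = (fine (\S_n (p n * f n)%:E))%:E)%E.
  rewrite fineK // ge0_fin_numE; first exact: le_lt_trans fle (ltry _).
  by apply: esumT_ge0 => n; rewrite lee_fin mulr_ge0 ?p0.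
rewrite traj_esum //; last by move=> tau; exact: factor_ge0.
rewrite -[leRHS](_ : (\sum_x path_prob (mdl w) pi x)%:E = _)%E; last by rewrite path_prob_sum1.
rewrite -esum_finR; last by move=> x; exact: path_prob_ge0.
apply: le_esumT => x; rewrite -[leRHS]mule1 lee_wpmul2l ?lee_fin ?path_prob_ge0 //.
pose at_ := (x t.2, pi (x t.2, t.2)) == t.1.
pose g (h : 'I_H) n := if (h == t.2) && at_ then f n else 1.
pose sg (h : 'I_H) := if (h == t.2) && at_ then fine (\S_n (p n * f n)%:E)%E else 1.
have gE r : test_factor w (inl (inl (b, t))) (mktraj pi x r) = \prod_h g h (r h).
  rewrite (bigD1 t.2) //= [X in _ * X]big1 => [|h /negbTE ne]; last by rewrite /g ne.
  rewrite mulr1 /g eqxx /test_factor /deviation /trials /at_triple !ffunE /= -/at_.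
  case: ifP => _ /=; last by rewrite ?mulr0n !mulr0 subr0 expR0.
  rewrite finset.in_set0 mulr1 /f /v /m; congr (expR (eta * _ - _)).
  by case: (b); rewrite /= ?expr1 ?expr0; ring.
under eq_esumT do rewrite gE.
rewrite (traj_esum_rew (muv w) (s := sg)); last 2 first.
- by move=> h n; rewrite /g; case: ifP.
- move=> h; rewrite /g /sg; case: ifP => [/andP[/eqP -> xt]|_].
    by rewrite -fS; apply: eq_esumT => n; rewrite /p -(eqP xt).
  by under eq_esumT do rewrite mulr1; exact: rew_sum1.
rewrite lee_fin; apply: prodr_ile1 => h _; rewrite /sg; case: ifP => _; last by rewrite ler01 lexx.
rewrite -!lee_fin -fS fle andbT.
by apply: esumT_ge0 => n; rewrite lee_fin mulr_ge0 ?p0.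
Qed.

Lemma test_factor_le1 w th pi : (\S_(tau : ftraj) ((ftraj_prob (mdl w) pi tau)%:E *
   (test_factor w th tau)%:E) <= 1)%E.
Proof.
case: th => [[[b t]|[t B]]|B].
- exact: test_factor_reward.
- exact: test_factor_trans.
- exact: test_factor_init.
Qed.

End Factor.
End Tests.

Section DeviationBound.
Context (R : realType) (S A H' : nat).
Local Notation H := H'.+1.
Context d (M : measurableType d) (P : probability M R).
Context (mdl : M -> mdp_model R S A H) (rv : nat -> R).
Hypothesis reg : regular_prior mdl rv.
Local Notation policy := (policy S A H).
Local Notation ftraj := (ftraj S A H).
Local Notation ledger := (ledger S A H).
Local Notation rawledger := (rawledger S A H).
Context (nlrn : nat) (eps : R).
Local Notation honest := (@honest_ledger S A H nlrn).

Let muv := reg_valid reg.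

Lemma trials_censor th U (tau : ftraj) :
  trials th (censor U tau) = trials th (censor finset.set0 tau).
Proof. by case: th => [[[b t]|[t B]]|B] //=; rewrite /at_triple !ffunE. Qed.

Lemma visits_at_triple t (tau : ftraj) : visits t tau = at_triple t (censor finset.set0 tau).
Proof.
rewrite /at_triple ffunE /=; apply/existsP/eqP => [[h /eqP ->] //|E].
by exists t.2; rewrite E; case: (t) => -[].
Qed.

Lemma relevant_trials th (rl : rawledger) : relevant nlrn th (honest rl) ->
  (nlrn <= \sum_(x <- rl) trials th (censor finset.set0 x.2))%N.
Proof.
have vis t : t \notin under_explored nlrn rl ->
    (nlrn <= \sum_(x <- rl) at_triple t (censor finset.set0 x.2))%N.
  rewrite inE -leqNgt => /leq_trans; apply; rewrite -sum1_count big_mkcond /=.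
  by apply: leq_sum => x _; rewrite visits_at_triple; case: at_triple.
case: th => [[[b t]|[t B]]|B] /=; [exact: vis|exact: vis|].
by rewrite sum1_size size_map.
Qed.

Lemma deviation_censor mu th (rl : rawledger) (tau : ftraj) : relevant nlrn th (honest rl) ->
  deviation rv mu th (censor (under_explored nlrn rl) tau) =
  deviation rv mu th (censor finset.set0 tau).
Proof.
case: th => [[[b t]|[t B]]|B] /= tU; last by rewrite !ffunE.
  rewrite /at_triple !ffunE /=; case: eqP => // tt.
  have -> : ((tau t.2).1, t.2) = t by rewrite tt; case: (t) => -[].
  by rewrite (negbTE tU) finset.in_set0.
rewrite /at_triple !ffunE /=; case: eqP => // tt.
by case: next_stage => // h'; rewrite !ffunE.
Qed.

Variable e : R.
Hypotheses (e0 : 0 <= e) (e1 : e <= 1).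

(** Chernoff bound for one test at [eta = e / 4], where [eta * e - 2 * eta ^+ 2 = e ^+ 2 / 8] per
    trial, times the number of tests. *)
Definition test_bound : R := #|{: test S A H'}|%:R * expR (- (e ^+ 2 * nlrn%:R / 8)).

(** The number of trials of a test is random; compensating once per trial avoids conditioning on
    it. *)
Definition test_martingale w (rl : rawledger) : R :=
  \sum_(th : test S A H') expR (- (e ^+ 2 * nlrn%:R / 8)) *
     \prod_(x <- rl) test_factor mdl rv (e / 4) w th x.2.

Lemma test_martingale_ge0 w rl : 0 <= test_martingale w rl.
Proof.
apply: sumr_ge0 => th _; rewrite mulr_ge0 ?expR_ge0 //.
by apply: prodr_ge0 => x _; exact: expR_ge0.
Qed.

(** A relevant test that deviates after [Tr >= nlrn] trials has a product of factors of at least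
    [expR (e ^+ 2 * Tr / 8)], which the normalization brings to at least [1]. *)
Lemma deviates_le_martingale w rl :
  (deviates rv nlrn e (honest rl) (mdl w))%:R <= test_martingale w rl.
Proof.
case: (boolP (deviates _ _ _ _ _)) => [/existsP[th /andP[rel dev]]|_]; last first.
  exact: test_martingale_ge0.
rewrite /test_martingale (bigD1 th) //= -[leLHS]addr0 lerD //; last first.
  apply: sumr_ge0 => th' _; rewrite mulr_ge0 ?expR_ge0 //.
  by apply: prodr_ge0 => x _; exact: expR_ge0.
have tr := relevant_trials rel; move: dev; rewrite /= !big_map /=.
under eq_bigr do rewrite trials_censor.
under [X in _ < X]eq_bigr do rewrite (deviation_censor _ _ rel).
set D := \sum_(x <- rl) deviation _ _ _ _.
rewrite /test_factor -expR_sum -expRD -[leLHS]expR0 ler_expR.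
rewrite big_split /= -mulr_sumr sumrN -mulr_sumr -/D.
move: tr; rewrite -(ler_nat R) natr_sum; set Tr := \sum_(x <- rl) _ => tr eT.
have e0' := e0; have e20 := sqr_ge0 e.
have h1 : e * (e * Tr) <= e * D by rewrite ler_wpM2l // ltW.
have h2 : e ^+ 2 * nlrn%:R <= e ^+ 2 * Tr by rewrite ler_wpM2l.
rewrite (_ : _ + _ = (e * D - e * (e * Tr)) / 4 + (e ^+ 2 * Tr - e ^+ 2 * nlrn%:R) / 8); last by field.
by rewrite addr_ge0 // divr_ge0 ?subr_ge0.
Qed.

Context (N : nat) (pol : nat -> ledger -> policy).
Hypothesis N0 : (0 < N)%N.

Lemma deviation_bound w m :
  (run P mdl rv nlrn eps N pol (mdl w) m 1 [::]
    (fun rl => (deviates rv nlrn e (honest rl) (mdl w))%:R%:E) <= test_bound%:E)%E.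
Proof.
have start : test_martingale w [::] = test_bound.
  rewrite /test_martingale /test_bound; under eq_bigr do rewrite big_nil mulr1.
  by rewrite sumr_const mulr_natl.
apply: (@le_trans _ _ (run P mdl rv nlrn eps N pol (mdl w) m 1 [::]
    (fun rl => (test_martingale w rl)%:E))).
  apply: (le_run P reg _ _ _ _ (muv w)) => rl.
  by rewrite lee_fin; exact: deviates_le_martingale.
rewrite -start; apply: (run_supermartingale P reg _ _ _ N0 (muv w)).
  exact: test_martingale_ge0.
move=> rl pi.
have f0 tau th : 0 <= test_factor mdl rv (e / 4) w th tau by exact: expR_ge0.
pose a th : R := expR (- (e ^+ 2 * nlrn%:R / 8)) *
     \prod_(x <- rl) test_factor mdl rv (e / 4) w th x.2.
have a0 th : 0 <= a th by rewrite mulr_ge0 ?expR_ge0 ?prodr_ge0.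
have E tau : (ftraj_prob (mdl w) pi tau * test_martingale w (rcons rl (pi, tau)))%:E =
   (\sum_(th : test S A H') (a th)%:E * ((ftraj_prob (mdl w) pi tau)%:E *
      (test_factor mdl rv (e / 4) w th tau)%:E))%E.
  under [RHS]eq_bigr do rewrite -!EFinM.
  rewrite sumEFin; congr EFin; rewrite /test_martingale mulr_sumr.
  by apply: eq_bigr => th _; rewrite big_rcons /a /=; ring.
under eq_esumT do rewrite E.
have t0 tau th : (0 <= (a th)%:E * ((ftraj_prob (mdl w) pi tau)%:E *
      (test_factor mdl rv (e / 4) w th tau)%:E))%E.
  by rewrite -!EFinM lee_fin mulr_ge0 // mulr_ge0 // (ftraj_prob_ge0 pi (muv w)).
rewrite esum_sum; last by move=> tau th _ _; exact: t0.
rewrite /test_martingale -sumEFin; apply: lee_sum => th _; rewrite -/(a th).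
rewrite esumTZl //; last first.
  by move=> tau; rewrite -EFinM lee_fin mulr_ge0 // (ftraj_prob_ge0 pi (muv w)).
rewrite -[leRHS]mule1 lee_wpmul2l ?lee_fin //.
have e0' := e0; have e1' := e1.
by apply: (test_factor_le1 reg); lra.
Qed.

Lemma bmf_deviation th c : bounded_mfun (fun w => deviation rv (mdl w) th c).
Proof.
have bs (f : M -> 'I_S -> R) (B : {set 'I_S}) : (forall y, bounded_mfun (f^~ y)) ->
    bounded_mfun (fun w => \sum_(y in B) f w y).
  move=> bf; under eq_fun do rewrite big_mkcond /=.
  by apply: (bmf_sum _ (F := fun y w => if y \in B then f w y else 0)) => y;
    case: (y \in B) => //; exact: bmf_cst.
case: th => [[[b t]|[t B]]|B] /=.
- case: (at_triple t c); last exact: bmf_cst.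
  by apply/bmfZ/bmfB; [exact: bmf_cst|exact: (bmf_rmean reg)].
- case: (at_triple t c); last exact: bmf_cst.
  case: (next_stage t.2) => [h'|]; last exact: bmf_cst.
  by apply: bmfB; [exact: bmf_cst|apply: bs => y; exact: (bmf_trans reg)].
- by apply: bmfB; [exact: bmf_cst|apply: bs => y; exact: (bmf_init reg)].
Qed.

Lemma measurable_deviates s : measurable [set w | deviates rv nlrn e s (mdl w)].
Proof.
rewrite (_ : [set _ | _] = \bigcup_(th in [set th : test S A H' | relevant nlrn th s])
   [set w | e * (\sum_(x <- s.2) (trials th x.2)%:R) < \sum_(x <- s.2) deviation rv (mdl w) th x.2]); last first.
  apply/seteqP; split => [w /existsP[th /andP[h1 h2]]|w [th h1 h2]]; first by exists th.
  by apply/existsP; exists th; rewrite h1.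
apply: fin_bigcup_measurable; first exact: finite_finset.
move=> th _; rewrite -[X in measurable X]setTI; apply: measurable_fun_ltr => //.
by case: (bmf_sum s.2 (F := fun x w => deviation rv (mdl w) th x.2)) => // x; exact: bmf_deviation.
Qed.

End DeviationBound.

(** Among functions with values in the unit interval the left side is largest for the indicator of
    [p y < p' y]; this is why tests on sets of states suffice. *)
Lemma sum_diff_le (R : realType) (T : finType) (p p' f : T -> R) (c : R) :
  (forall B : {set T}, \sum_(y in B) p' y - \sum_(y in B) p y <= c) ->
  (forall y, 0 <= f y <= 1) ->
  \sum_y p' y * f y - \sum_y p y * f y <= c.
Proof.
move=> pB f01; pose B := [set y | p y < p' y]%SET.
apply: le_trans (pB B); rewrite -!sumrB [leRHS]big_mkcond /=.
apply: ler_sum => y _; rewrite inE; have /andP[f0 f1] := f01 y.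
by case: ltP => h; rewrite -mulrBl; nra.
Qed.

Lemma sum_setC (R : realType) (T : finType) (f : T -> R) (B : {set T}) :
  \sum_(y in (~: B)%SET) f y = \sum_(y | y \notin B) f y.
Proof. by apply: eq_bigl => y; rewrite finset.in_setC. Qed.

(** * Near-optimal policies hit censored triples *)

Section Simulation.
Context (R : realType) (S A H' : nat).
Local Notation H := H'.+1.
Local Notation ctraj := (ctraj S A H).
Local Notation ledger := (ledger S A H).
Context d (M : measurableType d).
Context (mdl : M -> mdp_model R S A H) (rv : nat -> R).
Hypothesis reg : regular_prior mdl rv.
Context (nlrn : nat) (e : R).
Hypothesis n0 : (0 < nlrn)%N.
Local Notation under := (@under_explored S A H nlrn).

Let muv := reg_valid reg.

Definition num_trials th (s : ledger) : R := \sum_(x <- s.2) (trials th x.2)%:R.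
Definition sum_deviation w th (s : ledger) : R := \sum_(x <- s.2) deviation rv (mdl w) th x.2.

Lemma deviatesPn s w : ~~ deviates rv nlrn e s (mdl w) ->
  forall th, relevant nlrn th s -> sum_deviation w th s <= e * num_trials th s.
Proof.
move=> /existsPn h th rel; have := h th.
by rewrite rel /= -leNgt.
Qed.

Definition blank (k : {ffun 'I_H -> 'I_S * 'I_A}) : ctraj := [ffun h => (k h, None)].

Lemma num_trials_skel th (s s' : ledger) : skel_cens s.2 = skel_cens s'.2 ->
  num_trials th s = num_trials th s'.
Proof.
have E (s0 : ledger) : num_trials th s0 = \sum_(x <- skel_cens s0.2) (trials th (blank x.2))%:R.
  rewrite big_map /=; apply: eq_bigr => x _.
  by case: th => [[[b t]|[t B]]|B] //=; rewrite /at_triple !ffunE.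
by move=> ss; rewrite !E ss.
Qed.

Definition state_test (th : test S A H') : bool := if th is inl (inl _) then false else true.

Lemma sum_deviation_skel w th (s s' : ledger) : state_test th ->
  skel_cens s.2 = skel_cens s'.2 -> sum_deviation w th s = sum_deviation w th s'.
Proof.
move=> st; have E (s0 : ledger) :
    sum_deviation w th s0 = \sum_(x <- skel_cens s0.2) deviation rv (mdl w) th (blank x.2).
  rewrite big_map /=; apply: eq_bigr => x _.
  case: th st => [[[b t]|[t B]]|B] //= _; last by rewrite !ffunE.
  rewrite /at_triple !ffunE; case: eqP => // _.
  by case: next_stage => // h'; rewrite !ffunE.
by move=> ss; rewrite !E ss.
Qed.

(** Agreement with the recorded states, rewards left aside. The true model can satisfy it on a
    hallucinated ledger, whose rewards come from another model. *)
Definition fits w (s : ledger) := forall th, state_test th -> relevant nlrn th s ->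
  sum_deviation w th s <= e * num_trials th s.

(** Tests on states see only the skeleton and the censoring set, which the honest and the
    hallucinated ledger share. *)
Lemma fits_deviates w s s' : ~~ deviates rv nlrn e s (mdl w) ->
  s.1 = s'.1 -> skel_cens s.2 = skel_cens s'.2 -> fits w s'.
Proof.
move=> dv s1 s2 th st rel.
rewrite -(sum_deviation_skel w st s2) -(num_trials_skel th s2).
apply: (deviatesPn dv); case: s s' s1 s2 rel {dv} => U cl [U' cl'] /= <- sk.
case: th st => [[[b t]|[t B]]|B] //= _.
by rewrite -(size_map (fun e => (e.1, cskel e.2)) cl) -/(skel_cens cl) sk size_map.
Qed.

Variable s : ledger.
Hypothesis s_under : s.1 = under (uncens s.2).

Lemma num_trials_gt0 th : relevant nlrn th s -> 0 < num_trials th s.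
Proof.
have rel' : relevant nlrn th s -> relevant nlrn th (honest_ledger nlrn (uncens s.2)).
  case: th => [[[b t]|[t B]]|B] /=; rewrite ?s_under //.
  by rewrite !size_map.
move=> /rel'/relevant_trials h.
rewrite /num_trials -natr_sum ltr0n; apply: leq_trans n0 (leq_trans h _).
rewrite big_map /=; apply: leq_sum => x _.
by case: (th) => [[[b t]|[t B]]|B] //=; rewrite /at_triple !ffunE.
Qed.

Section TwoModels.
Variables (w w' : M).
Hypotheses (fw : fits w s) (fw' : fits w' s).

(** [B] is tested under [w] and its complement under [w']: the observed frequencies cancel, and the
    deviations add up to the difference of the probabilities times the number of trials. *)
Lemma fits_trans t h' (B : {set 'I_S}) : t \notin s.1 -> next_stage t.2 = Some h' ->
  \sum_(y in B) trans (mdl w') t.1.1 t.1.2 t.2 y -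
  \sum_(y in B) trans (mdl w) t.1.1 t.1.2 t.2 y <= 2 * e.
Proof.
move=> tU nx; pose th := inl (inr (t, B)) : test S A H'.
pose th' := inl (inr (t, ~: B)%SET) : test S A H'.
have h1 := fw (th := th) isT tU; have h2 := fw' (th := th') isT tU.
have cnt := num_trials_gt0 (th := th) tU.
set p' := \sum_(y in B) _; set p := \sum_(y in B) _.
have E : sum_deviation w th s + sum_deviation w' th' s = (p' - p) * num_trials th s.
  rewrite /sum_deviation -big_split /= /num_trials mulr_sumr; apply: eq_bigr => x _.
  rewrite /= nx; case: (at_triple t x.2); last by rewrite addr0 mulr0.
  have [_ [_ t1] _] := muv w'.
  have := t1 t.1.1 t.1.2 t.2; rewrite (bigID (mem B)) /= => t1'.
  rewrite sum_setC finset.in_setC -/p -/p'; move: t1'; rewrite -/p'; case: (_ \in B) => /= t1'; lra.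
have E2 : num_trials th' s = num_trials th s by [].
by rewrite -(ler_pM2r cnt) -E; move: h1 h2; rewrite E2; lra.
Qed.

Lemma fits_init (B : {set 'I_S}) : (nlrn <= size s.2)%N ->
  \sum_(y in B) init (mdl w') y - \sum_(y in B) init (mdl w) y <= 2 * e.
Proof.
move=> sz; pose th := inr B : test S A H'.
pose th' := inr (~: B)%SET : test S A H'.
have h1 := fw (th := th) isT sz; have h2 := fw' (th := th') isT sz.
have cnt := num_trials_gt0 (th := th) sz.
set p' := \sum_(y in B) _; set p := \sum_(y in B) _.
have E : sum_deviation w th s + sum_deviation w' th' s = (p' - p) * num_trials th s.
  rewrite /sum_deviation -big_split /= /num_trials mulr_sumr; apply: eq_bigr => x _ /=.
  have [_ _ [_ t1]] := muv w'.
  move: t1; rewrite (bigID (mem B)) /= => t1'.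
  rewrite sum_setC finset.in_setC -/p -/p'; move: t1'; rewrite -/p'; case: (_ \in B) => /= t1'; lra.
have E2 : num_trials th' s = num_trials th s by [].
by rewrite -(ler_pM2r cnt) -E; move: h1 h2; rewrite E2; lra.
Qed.

End TwoModels.

(** Both means are within [e] of the same empirical mean, one sign of the reward test being used for
    each model. *)
Lemma reward_close w w' t : ~~ deviates rv nlrn e s (mdl w) -> ~~ deviates rv nlrn e s (mdl w') ->
  t \notin s.1 -> rmean rv (mdl w) t <= rmean rv (mdl w') t + 2 * e.
Proof.
move=> dw dw' tU; pose th := inl (inl (true, t)) : test S A H'.
pose th' := inl (inl (false, t)) : test S A H'.
have h1 := deviatesPn dw (th := th) tU; have h2 := deviatesPn dw' (th := th') tU.
have cnt := num_trials_gt0 (th := th) tU.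
have E : sum_deviation w th s + sum_deviation w' th' s =
    (rmean rv (mdl w) t - rmean rv (mdl w') t) * num_trials th s.
  rewrite /sum_deviation -big_split /= /num_trials mulr_sumr; apply: eq_bigr => x _ /=.
  by case: (at_triple t x.2); rewrite ?addr0 ?mulr0 // ?expr1 ?expr0 /=; ring.
have E2 : num_trials th' s = num_trials th s by [].
rewrite -lerBlDl -(ler_pM2r cnt) -E; move: h1 h2; rewrite E2; lra.
Qed.

End Simulation.

(** * Chains stopped at their first entry into a set *)

Section ChainStop.
Context (R : realType) (T : finType) (u : nat -> T -> bool).

(** Expected reward [c] at the first entry into [u]. Stopping keeps the expectation in the unit
    interval and uses the kernel only off [u], where transitions are well estimated. *)
Fixpoint chain_stop (k : nat -> T -> T -> R) (c : nat -> T -> R) n i y : R :=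
  if u i y then c i y
  else if n is n'.+1 then \sum_z k i y z * chain_stop k c n' i.+1 z else 0.

Lemma chain_hit_stop k n i y : chain_hit k u n i y = chain_stop k (fun _ _ => 1) n i y.
Proof.
elim: n i y => [|n IH] i y //=; case: (u i y) => //.
by apply: eq_bigr => z _; rewrite IH.
Qed.

Variable k : nat -> T -> T -> R.
Hypotheses (k0 : forall i y z, 0 <= k i y z) (k1 : forall i y, \sum_z k i y z = 1).

Lemma avg_le i y (f : T -> R) c : (forall z, f z <= c) -> \sum_z k i y z * f z <= c.
Proof.
move=> fc; rewrite -[leRHS]mul1r -(k1 i y) mulr_suml.
by apply: ler_sum => z _; rewrite ler_wpM2l.
Qed.

Lemma chain_stop_bounds c n i y : (forall i y, 0 <= c i y <= 1) ->
  0 <= chain_stop k c n i y <= 1.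
Proof.
move=> c01; elim: n i y => [|n IH] i y /=; case: (u i y) => //; first by rewrite lexx ler01.
rewrite sumr_ge0 /=; last by move=> z _; rewrite mulr_ge0 //; case/andP: (IH i.+1 z).
by apply: avg_le => z; case/andP: (IH i.+1 z).
Qed.

Lemma chain_value_ge0 c n i y : (forall i y, 0 <= c i y) -> 0 <= chain_value k c n i y.
Proof.
move=> c0; elim: n i y => [|n IH] i y /=; rewrite addr_ge0 // sumr_ge0 // => z _.
by rewrite mulr_ge0.
Qed.

Lemma chain_value_le c n i y : (forall i y, c i y <= 1) -> chain_value k c n i y <= n.+1%:R.
Proof.
move=> c1; elim: n i y => [|n IH] i y /=; first by rewrite addr0.
by rewrite -[n.+2%:R]natr1 addrC lerD // avg_le.
Qed.

Lemma chain_stop_value c n i y : (forall i y, 0 <= c i y) ->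
  chain_stop k c n i y <= chain_value k c n i y.
Proof.
move=> c0; elim: n i y => [|n IH] i y /=; case: (u i y); rewrite ?addr0 //.
  by rewrite lerDl sumr_ge0 // => z _; rewrite mulr_ge0 // chain_value_ge0.
rewrite -[leLHS]add0r lerD //; apply: ler_sum => z _.
by rewrite ler_wpM2l.
Qed.

(** Before [u] is met each stage earns at most [b]; from then on the remaining stages earn at most
    [h] together. *)
Lemma chain_value_hit c n i y h (b : R) : 0 <= b -> (forall i y, c i y <= 1) ->
  (forall i y, ~~ u i y -> c i y <= b) -> (n < h)%N ->
  chain_value k c n i y <= n.+1%:R * b + h%:R * chain_hit k u n i y.
Proof.
move=> b0 c1 cb; elim: n i y => [|n IH] i y nh.
  rewrite /= addr0 mul1r; case: ifPn => [_|uy]; last by rewrite mulr0 addr0 cb.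
  apply: le_trans (c1 _ _) _; rewrite mulr1.
  by apply: (@le_trans _ _ h%:R); rewrite ?ler1n ?lerDr.
rewrite [chain_hit _ _ _ _ _]/=; case: ifPn => [_|uy].
  apply: (le_trans (chain_value_le _ _ _ c1)); rewrite mulr1.
  by rewrite -[leLHS]add0r lerD ?mulr_ge0 // ler_nat.
rewrite -(natr1 n.+1) mulrDl mul1r addrAC addrC /= lerD ?cb //.
rewrite mulr_sumr -[X in _ <= X + _]mul1r -[X in _ <= X * _ + _](k1 i y) mulr_suml -big_split /=.
apply: ler_sum => z _; rewrite [h%:R * _]mulrCA -mulrDr ler_wpM2l // IH //.
exact: ltnW.
Qed.

End ChainStop.

Section HitLower.
Context (R : realType) (S A H' : nat).
Local Notation H := H'.+1.
Local Notation policy := (policy S A H).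
Local Notation ledger := (ledger S A H).
Context d (M : measurableType d) (P : probability M R).
Context (mdl : M -> mdp_model R S A H) (rv : nat -> R).
Hypothesis reg : regular_prior mdl rv.
Context (nlrn : nat) (e : R).
Hypothesis n0 : (0 < nlrn)%N.
Hypothesis e0 : 0 <= e.
Local Notation under := (@under_explored S A H nlrn).
Variable s : ledger.
Hypothesis s_under : s.1 = under (uncens s.2).

Let muv := reg_valid reg.

Section Policy.
Variable pi : policy.
Let u i y := (y, pi (y, inord i), inord i) \in s.1.
Let kern w := kernel_of (mdl w) pi.

Lemma kern_ge0 w i y z : 0 <= kern w i y z. Proof. exact: kernel_of_ge0. Qed.
Lemma kern_sum1 w i y : \sum_z kern w i y z = 1. Proof. exact: kernel_of_sum1. Qed.

Definition stop_value w (c : nat -> 'I_S -> R) : R :=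
  \sum_y init (mdl w) y * chain_stop u (kern w) c H' 0 y.

Lemma hit_stop w : hit (mdl w) pi s.1 = stop_value w (fun _ _ => 1).
Proof. by apply: eq_bigr => y _; rewrite chain_hit_stop. Qed.

(** Simulation argument: transitions are exchanged one stage at a time, at the price [2 * e] because
    the continuation has values in the unit interval. At censored triples the chain stops, so their
    transitions are never compared. *)
Lemma chain_stop_close w w' c n i y : fits mdl rv nlrn e w s -> fits mdl rv nlrn e w' s ->
  (forall i y, 0 <= c i y <= 1) -> (i + n = H')%N ->
  chain_stop u (kern w') c n i y <= chain_stop u (kern w) c n i y + n%:R * (2 * e).
Proof.
move=> fw fw' c01; elim: n i y => [|n IH] i y inH /=; first by rewrite mul0r addr0.
have e0' := e0.
case: ifPn => [_|uy]; first by rewrite lerDl !mulr_ge0.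
have iH : (i.+1 < H)%N by rewrite -inH addnS !ltnS leq_addr.
have [h' nx] : exists h', next_stage (inord i : 'I_H) = Some h'.
  rewrite /next_stage inordK ?(ltnW iH) // (insubT (fun j => j < H)%N iH).
  by eexists.
apply: (@le_trans _ _ (\sum_z kern w' i y z * chain_stop u (kern w) c n i.+1 z + n%:R * (2 * e))).
  rewrite -[X in _ <= _ + X]mul1r -[X in _ <= _ + X * _](kern_sum1 w' i y) mulr_suml -big_split /=.
  apply: ler_sum => z _; rewrite -mulrDr ler_wpM2l ?kern_ge0 // IH //.
  by rewrite addSnnS.
rewrite (_ : n.+1%:R * (2 * e) = 2 * e + n%:R * (2 * e)) ?addrA ?lerD2r; last by rewrite -(natr1 n); ring.
rewrite -lerBlDl; apply: sum_diff_le.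
  by move=> B; apply: (fits_trans reg n0 s_under fw fw' B uy nx).
by move=> z; apply: chain_stop_bounds => //; [exact: kern_ge0|exact: kern_sum1].
Qed.

Lemma stop_value_close w w' c : fits mdl rv nlrn e w s -> fits mdl rv nlrn e w' s ->
  (nlrn <= size s.2)%N -> (forall i y, 0 <= c i y <= 1) ->
  stop_value w' c <= stop_value w c + H%:R * (2 * e).
Proof.
move=> fw fw' sz c01.
have i0 y := init_ge0 (muv w') y; have i1 := init_sum1 (muv w').
apply: (@le_trans _ _ (\sum_y init (mdl w') y * chain_stop u (kern w) c H' 0 y + H'%:R * (2 * e))).
  rewrite -[X in _ <= _ + X]mul1r -[X in _ <= _ + X * _]i1 mulr_suml -big_split /=.
  by apply: ler_sum => z _; rewrite -mulrDr ler_wpM2l // chain_stop_close.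
rewrite (_ : H%:R * (2 * e) = 2 * e + H'%:R * (2 * e)) ?addrA ?lerD2r; last by rewrite -(natr1 H'); ring.
rewrite -lerBlDl; apply: sum_diff_le.
  by move=> B; exact: (fits_init reg n0 s_under fw fw').
by move=> z; apply: chain_stop_bounds => //; [exact: kern_ge0|exact: kern_sum1].
Qed.

Let c w i y := rmean rv (mdl w) (y, pi (y, inord i), inord i).

Let c01 w i y : 0 <= c w i y <= 1.
Proof. by rewrite (rmean_ge0 reg) (rmean_le1 reg). Qed.

Lemma value_ge_stop w : stop_value w (c w) <= value rv pi (mdl w).
Proof.
rewrite (valueE _ (muv w)); apply: ler_sum => y _; rewrite ler_wpM2l ?(init_ge0 (muv w)) //.
apply: chain_stop_value => [|i' y']; first exact: kern_ge0.
by case/andP: (c01 w i' y').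
Qed.

Lemma value_le_hit w b : 0 <= b -> (forall t, t \notin s.1 -> rmean rv (mdl w) t <= b) ->
  value rv pi (mdl w) <= H%:R * b + H%:R * hit (mdl w) pi s.1.
Proof.
move=> b0 rb; rewrite (valueE _ (muv w)) /value_of /hit.
rewrite mulr_sumr -[X in _ <= X + _]mul1r -[X in _ <= X * _ + _](init_sum1 (muv w)) mulr_suml -big_split /=.
apply: ler_sum => y _; rewrite [X in _ <= _ + X]mulrCA -mulrDr ler_wpM2l ?(init_ge0 (muv w)) //.
apply: chain_value_hit => // [|i' y'|i' y'|i' y']; [exact: kern_ge0|exact: kern_sum1| |].
  by case/andP: (c01 w i' y').
exact: rb.
Qed.

Lemma bmf_chain_stop wstar n i y :
  bounded_mfun (fun w => chain_stop u (kern wstar) (c w) n i y).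
Proof.
elim: n i y => [|n IH] i y /=; case: (u i y); do ?exact: (bmf_rmean reg).
  exact: bmf_cst.
by apply: bmf_sum => z; apply: bmfZ.
Qed.

Lemma bmf_stop_value wstar : bounded_mfun (fun w => stop_value wstar (c w)).
Proof. by apply: bmf_sum => z; apply: bmfZ; exact: bmf_chain_stop. Qed.

Let L w := ledger_lik (mdl w) s.
Let bL : bounded_mfun L. Proof. exact: (bmf_lik reg). Qed.
Let L0 w : 0 <= L w. Proof. exact: ledger_lik_ge0. Qed.

(** The kernel belongs to the single model [wstar], so its entries do not vary with [w]: the
    posterior expectation passes through the recursion down to the rewards at censored triples,
    where [r_alt_le] applies. *)
Lemma ex_stop_ge wstar : 0 < lik_ex P mdl s ->
  r_alt P mdl rv * lik_ex P mdl s * hit (mdl wstar) pi s.1 <=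
  Ex P (fun w => stop_value wstar (c w) * L w).
Proof.
move=> lex0; set r := r_alt P mdl rv * lik_ex P mdl s.
have step n i y : r * chain_stop u (kern wstar) (fun _ _ => 1) n i y <=
    Ex P (fun w => chain_stop u (kern wstar) (c w) n i y * L w).
  elim: n i y => [|n IH] i y /=; case: ifPn => uy.
  - by rewrite mulr1; exact: (r_alt_le reg lex0 uy).
  - by rewrite mulr0; apply: (@Ex_ge0 _ _ _ P) => w; rewrite mul0r.
  - by rewrite mulr1; exact: (r_alt_le reg lex0 uy).
  have -> : Ex P (fun w => (\sum_z kern wstar i y z *
        chain_stop u (kern wstar) (c w) n i.+1 z) * L w) =
      \sum_z kern wstar i y z * Ex P (fun w => chain_stop u (kern wstar) (c w) n i.+1 z * L w).
    under eq_Ex do rewrite mulr_suml; rewrite Ex_sum; last first.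
      by move=> z; apply: bmfM => //; apply: bmfZ; exact: bmf_chain_stop.
    apply: eq_bigr => z _; rewrite -ExZ; last by apply: bmfM => //; exact: bmf_chain_stop.
    by apply: eq_Ex => w; rewrite mulrA.
  by rewrite mulr_sumr; apply: ler_sum => z _; rewrite mulrCA ler_wpM2l ?kern_ge0.
rewrite hit_stop /stop_value.
under eq_Ex do rewrite mulr_suml; rewrite Ex_sum; last first.
  by move=> z; apply: bmfM => //; apply: bmfZ; exact: bmf_chain_stop.
rewrite mulr_sumr; apply: ler_sum => y _.
under eq_Ex do rewrite -mulrA.
rewrite ExZ; last by apply: bmfM => //; exact: bmf_chain_stop.
by rewrite mulrCA ler_wpM2l ?(init_ge0 (muv wstar)).
Qed.

Local Notation dev w := (deviates rv nlrn e s (mdl w)).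

(** A deviating model is charged [1], an upper bound for the stopped reward; for the others the
    stopped reward is moved from [wstar] to [w]. *)
Lemma value_ge wstar w : (nlrn <= size s.2)%N -> fits mdl rv nlrn e wstar s ->
  stop_value wstar (c w) - H%:R * (2 * e) - (dev w)%:R <= value rv pi (mdl w).
Proof.
move=> sz fs; have e0' := e0; have [dw|dw] := boolP (dev w).
  apply: le_trans (value_ge0 reg pi w).
  have : stop_value wstar (c w) <= 1.
    rewrite -(init_sum1 (muv wstar)); apply: ler_sum => y _.
    rewrite ler_piMr ?(init_ge0 (muv wstar)) //.
    by case/andP: (chain_stop_bounds u (kern_ge0 wstar) (kern_sum1 wstar) H' 0 y (c01 w)).
  have : 0 <= H%:R * (2 * e) by rewrite !mulr_ge0.
  by move=> /= h1 h2; lra.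
rewrite subr0 lerBlDr; apply: le_trans (lerD (value_ge_stop w) (lexx _)).
apply: stop_value_close => //; exact: (fits_deviates dw).
Qed.

(** The witness [w0] has small rewards and agrees with the data; hence every model that agrees with
    the data has rewards at most [b + 2 * e] off the censored triples. The hitting probability is
    moved to [wstar], and a deviating model is charged the maximal value [H]. *)
Lemma value_le_dev wstar w b w0 : (nlrn <= size s.2)%N -> fits mdl rv nlrn e wstar s ->
  0 <= b -> (forall t, t \notin s.1 -> rmean rv (mdl w0) t <= b) -> ~~ dev w0 ->
  value rv pi (mdl w) <= H%:R * (b + 2 * e) +
    H%:R * (hit (mdl wstar) pi s.1 + H%:R * (2 * e)) + H%:R * (dev w)%:R.
Proof.
move=> sz fs b0 rb dw0; have e0' := e0.
have he : 0 <= H%:R * (2 * e) by rewrite !mulr_ge0.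
have one01 (i : nat) (y : 'I_S) : 0 <= (1 : R) <= 1 by rewrite lexx ler01.
have hit0 : 0 <= hit (mdl wstar) pi s.1.
  rewrite hit_stop; apply: sumr_ge0 => y _; rewrite mulr_ge0 ?(init_ge0 (muv wstar)) //.
  by case/andP: (chain_stop_bounds u (kern_ge0 wstar) (kern_sum1 wstar) H' 0 y one01).
have [dw|dw] := boolP (dev w).
  apply: (le_trans (value_le reg pi w)); rewrite mulr1 lerDr addr_ge0 // mulr_ge0 //.
    by rewrite addr_ge0 // mulr_ge0.
  by rewrite addr_ge0.
rewrite mulr0 addr0; apply: (@le_trans _ _ (H%:R * (b + 2 * e) + H%:R * hit (mdl w) pi s.1)).
  apply: value_le_hit; first by rewrite addr_ge0 // mulr_ge0.
  move=> t tU; apply: (le_trans (reward_close n0 s_under dw dw0 tU)).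
  by rewrite lerD2r rb.
rewrite lerD2l ler_wpM2l // !hit_stop; apply: stop_value_close => //.
exact: (fits_deviates dw).
Qed.

End Policy.

Lemma bmf_dev : bounded_mfun (fun w => (deviates rv nlrn e s (mdl w))%:R : R).
Proof.
have := bmf_indic R (measurable_deviates reg nlrn e s).
congr bounded_mfun; apply/funext => w; rewrite indicE; congr (_%:R); congr nat_of_bool.
by apply/idP/idP => [/set_mem|?] //; apply/mem_set.
Qed.

(* Under a posterior that hardly puts mass on models contradicting the data, an
   optimal policy must hit the censored triples: off them the rewards are at
   most [b], on them they have posterior mean at least [r_alt]. *)
Lemma hit_lower_bound wstar w0 (pi pi' : policy) (b beta g : R) :
  (nlrn <= size s.2)%N -> fits mdl rv nlrn e wstar s ->
  0 < lik_ex P mdl s -> 0 <= b ->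
  (forall t, t \notin s.1 -> rmean rv (mdl w0) t <= b) ->
  ~~ deviates rv nlrn e s (mdl w0) ->
  Ex P (fun w => (deviates rv nlrn e s (mdl w))%:R * ledger_lik (mdl w) s) <=
    beta * lik_ex P mdl s ->
  Ex P (fun w => value rv pi' (mdl w) * ledger_lik (mdl w) s) -
  Ex P (fun w => value rv pi (mdl w) * ledger_lik (mdl w) s) <= g * lik_ex P mdl s ->
  r_alt P mdl rv * hit (mdl wstar) pi' s.1 - H%:R * (2 * e) - beta - g <=
  H%:R * (b + 2 * e) + H%:R * (hit (mdl wstar) pi s.1 + H%:R * (2 * e)) + H%:R * beta.
Proof.
move=> sz fs lex0 b0 rb dw0 exdev gap.
pose L w := ledger_lik (mdl w) s; pose D w : R := (deviates rv nlrn e s (mdl w))%:R.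
have bL : bounded_mfun L by exact: (bmf_lik reg).
have bD : bounded_mfun D by exact: bmf_dev.
have L0 w : 0 <= L w by exact: ledger_lik_ge0.
have bV p : bounded_mfun (fun w => value rv p (mdl w)) by exact: (bmf_value reg).
have exL : Ex P L = lik_ex P mdl s by [].
set l := lik_ex P mdl s in lex0 exdev gap exL *.
pose a := H%:R * (b + 2 * e) + H%:R * (hit (mdl wstar) pi s.1 + H%:R * (2 * e)).
have up : Ex P (fun w => value rv pi (mdl w) * L w) <= a * l + H%:R * Ex P (fun w => D w * L w).
  have b1 : bounded_mfun (fun w => a * L w) by exact: bmfZ.
  have b3 : bounded_mfun (fun w => D w * L w) by exact: bmfM.
  have b2 : bounded_mfun (fun w => H%:R * (D w * L w)) by exact: bmfZ.
  rewrite -exL -(ExZ P _ bL) -(ExZ P _ b3) -(ExD P b1 b2).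
  apply: Ex_le; [exact: bmfM|exact: bmfD|].
  move=> w; rewrite mulrA -mulrDl ler_wpM2r //.
  exact: (@value_le_dev pi wstar w b w0).
pose sv w := stop_value pi' wstar (fun i y => rmean rv (mdl w) (y, pi' (y, inord i), inord i)).
have bsv : bounded_mfun sv by exact: bmf_stop_value.
have lo : Ex P (fun w => sv w * L w) - H%:R * (2 * e) * l - Ex P (fun w => D w * L w) <=
    Ex P (fun w => value rv pi' (mdl w) * L w).
  have b1 : bounded_mfun (fun w => sv w * L w) by exact: bmfM.
  have b2 : bounded_mfun (fun w => H%:R * (2 * e) * L w) by exact: bmfZ.
  have b3 : bounded_mfun (fun w => D w * L w) by exact: bmfM.
  have b12 := bmfB b1 b2.
  rewrite -exL -(ExZ P _ bL) -(ExB P b1 b2) -(ExB P b12 b3).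
  apply: Ex_le; [exact: bmfB|exact: bmfM|].
  by move=> w; rewrite -!mulrBl ler_wpM2r //; exact: value_ge.
have st := ex_stop_ge pi' wstar lex0; rewrite -/l -/(sv _) in st.
have exdev' : H%:R * Ex P (fun w => D w * L w) <= H%:R * (beta * l) by rewrite ler_wpM2l.
rewrite -(ler_pM2r lex0) -/a !mulrBl [leRHS]mulrDl.
rewrite (_ : _ * hit _ _ _ * l = r_alt P mdl rv * l * hit (mdl wstar) pi' s.1); last by ring.
rewrite -/a in up.
have exdev0 : Ex P (fun w => D w * L w) <= beta * l by [].
move: st lo up gap exdev' exdev0; rewrite -/(L _) -mulrA; lra.
Qed.

End HitLower.

(** * Probability of misleading ledgers *)

Section Unreliable.
Context (R : realType) (S A H' : nat).
Local Notation H := H'.+1.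
Context d (M : measurableType d) (P : probability M R).
Context (mdl : M -> mdp_model R S A H) (rv : nat -> R).
Hypothesis reg : regular_prior mdl rv.
Local Notation policy := (policy S A H).
Local Notation ledger := (ledger S A H).
Local Notation rawledger := (rawledger S A H).
Context (nlrn : nat) (eps : R).
Local Notation hal := (hal_prob P mdl rv nlrn eps).
Local Notation honest := (@honest_ledger S A H nlrn).
Local Notation q := (q_pun P mdl rv eps).
Context (N : nat) (pol : nat -> ledger -> policy).
Hypothesis N0 : (0 < N)%N.
Local Notation run := (run P mdl rv nlrn eps N pol).
Local Notation weight := (weight P mdl rv nlrn eps N pol).
Local Notation raw_weight := (raw_weight P mdl rv nlrn eps N pol).

Let muv := reg_valid reg.
Local Open Scope ereal_scope.

Lemma measurable_run m (F : M -> rawledger -> \bar R) :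
  (forall w rl, 0 <= F w rl) -> (forall rl, measurable_fun setT (F^~ rl)) ->
  measurable_fun setT (fun w => run (mdl w) m 1 [::] (F w)).
Proof.
move=> F0 mF; under eq_fun do rewrite (run_weightE P reg nlrn eps N pol (muv _)) //.
apply: measurable_esum => [rl w|rl].
  rewrite mule_ge0 ?lee_fin // mule_ge0 ?(raw_weight_ge0 P reg) //.
  by rewrite mule_ge0 ?lee_fin ?rawlik_ge0.
apply: emeasurable_funM => //; apply: emeasurable_funM => //.
apply: emeasurable_funM => //.
by apply/measurable_EFinP; case: (bmf_rawlik reg rl).
Qed.

(** Law of the hallucinated ledger after [m] phases, averaged over the prior and tested against
    [f]. *)
Lemma integral_hal_sum m (f : ledger -> R) : (forall s, 0 <= f s)%R ->
  \int[P]_w run (mdl w) m 1 [::] (fun rl => \S_(s : ledger) (hal rl s * f s)%R%:E) =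
  \S_(s : ledger) (f s * (weight m s * (hal (uncens s.2) s *
     lik_ex P mdl (censored_ledger (uncens s.2)))))%R%:E.
Proof.
move=> f0.
have hf0 rl s : 0 <= (hal rl s * f s)%R%:E.
  by rewrite lee_fin; apply: mulr_ge0 => //; exact: (hal_ge0 P reg).
have t0 w rl s : 0 <= (size rl == m)%:R%:E * (raw_weight 1 [::] rl *
     ((rawlik (mdl w) rl)%:E * (hal rl s)%:E)).
  rewrite mule_ge0 ?lee_fin // mule_ge0 ?(raw_weight_ge0 P reg) //.
  by rewrite mule_ge0 ?lee_fin ?rawlik_ge0 // (hal_ge0 P reg).
have E w : run (mdl w) m 1 [::] (fun rl => \S_(s : ledger) (hal rl s * f s)%R%:E) =
  \S_(s : ledger) (f s * (weight m s * hal (uncens s.2) s) *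
     ledger_lik (mdl w) (censored_ledger (uncens s.2)))%R%:E.
  rewrite (run_weightE P reg nlrn eps N pol (muv w)); last by move=> rl; exact: esumT_ge0.
  transitivity (\S_(rl : rawledger) \S_(s : ledger) ((f s)%:E * ((size rl == m)%:R%:E *
     (raw_weight 1 [::] rl * ((rawlik (mdl w) rl)%:E * (hal rl s)%:E))))).
    apply: eq_esumT => rl /=.
    rewrite -esumTZl ?rawlik_ge0 // -esumTZl_ereal ?(raw_weight_ge0 P reg) //; last first.
      by move=> s; rewrite mule_ge0 // lee_fin rawlik_ge0.
    rewrite -esumTZl //; last first.
      move=> s; rewrite mule_ge0 ?(raw_weight_ge0 P reg) //.
      by rewrite mule_ge0 // lee_fin rawlik_ge0.
    apply: eq_esumT => s; rewrite (EFinM (hal rl s)) [RHS]muleCA; congr (_ * _).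
    by rewrite [RHS]muleCA; congr (_ * _); rewrite [RHS]muleCA; congr (_ * _); exact: muleC.
  rewrite esum_exchange; last by move=> rl s; apply: mule_ge0; rewrite ?lee_fin.
  apply: eq_esumT => s; rewrite esumTZl //.
  rewrite (hal_raw_sum P reg nlrn eps N pol) -(weightE P reg nlrn eps pol N0) -!EFinM; congr EFin; ring.
under eq_integral do rewrite E.
have b s : bounded_mfun (fun w => f s * (weight m s * hal (uncens s.2) s) *
     ledger_lik (mdl w) (censored_ledger (uncens s.2)))%R.
  by apply: bmfZ; exact: (bmf_lik reg).
rewrite integral_esum; last 2 first.
- move=> s w; rewrite lee_fin; apply: mulr_ge0; last exact: ledger_lik_ge0.
  by apply: mulr_ge0 => //; apply: mulr_ge0; [exact: weight_ge0|exact: (hal_ge0 P reg)].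
- by move=> s; apply/measurable_EFinP; case: (b s).
apply: eq_esumT => s; rewrite -ExE // ExZ; last exact: (bmf_lik reg).
by congr EFin; rewrite /lik_ex; ring.
Qed.

(** Here [f] may depend on the model as well as on the ledger: given the honest ledger, the model is
    distributed according to the canonical posterior. *)
Lemma integral_honest_sum m (f : ledger -> M -> R) : (forall s w, 0 <= f s w)%R ->
  (forall s, bounded_mfun (f s)) ->
  \int[P]_w run (mdl w) m 1 [::] (fun rl => (f (honest rl) w)%:E) =
  \S_(s : ledger) (weight m s * Ex P (fun w => f s w * ledger_lik (mdl w) s))%R%:E.
Proof.
move=> f0 bf.
have t0 w rl (x : R) : (0 <= x)%R -> 0 <= (size rl == m)%:R%:E * (raw_weight 1 [::] rl *
     ((rawlik (mdl w) rl)%:E * x%:E)).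
  move=> x0; rewrite mule_ge0 ?lee_fin // mule_ge0 ?(raw_weight_ge0 P reg) //.
  by rewrite mule_ge0 ?lee_fin ?rawlik_ge0.
have E w : run (mdl w) m 1 [::] (fun rl => (f (honest rl) w)%:E) =
  \S_(s : ledger) (weight m s * (f s w * ledger_lik (mdl w) s))%R%:E.
  rewrite (run_weightE P reg nlrn eps N pol (muv w)); last by move=> rl; rewrite lee_fin.
  rewrite (esum_fiber honest); last by move=> rl; rewrite t0.
  apply: eq_esumT => s.
  transitivity (\S_(rl : rawledger) ((f s w)%:E * ((size rl == m)%:R%:E *
     (raw_weight 1 [::] rl * ((rawlik (mdl w) rl)%:E * (honest rl == s)%:R%:E))))).
    apply: eq_esumT => rl /=.
    have [<-|_] := eqVneq (honest rl) s; last by rewrite mul0e !mule0.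
    rewrite mul1e [RHS]muleCA; congr (_ * _); rewrite [RHS]muleCA; congr (_ * _).
    by rewrite mule1 muleC.
  rewrite esumTZl //; last by move=> rl; rewrite t0.
  rewrite (honest_sum P reg nlrn eps N pol) -(weightE P reg nlrn eps pol N0) -!EFinM; congr EFin; ring.
under eq_integral do rewrite E.
have b s : bounded_mfun (fun w => f s w * ledger_lik (mdl w) s)%R.
  by apply: bmfM => //; exact: (bmf_lik reg).
rewrite integral_esum; last 2 first.
- by move=> s w; rewrite lee_fin !mulr_ge0 ?(weight_ge0 P reg _ _ _ N0) ?ledger_lik_ge0.
- by move=> s; apply/measurable_EFinP; case: (bmfZ (weight m s) (b s)).
by apply: eq_esumT => s; rewrite -ExE ?ExZ //; exact: bmfZ.
Qed.

Variables (e beta : R).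
Hypotheses (e0 : (0 <= e)%R) (e1 : (e <= 1)%R) (beta0 : (0 < beta)%R) (q0 : (0 < q)%R).
Local Notation dev s w := (deviates rv nlrn e s (mdl w)).
Local Notation bound := (test_bound S A H' nlrn e).

Definition ex_dev (s : ledger) : R := Ex P (fun w => (dev s w)%:R * ledger_lik (mdl w) s)%R.

(* Hallucinated ledgers on which the incentive argument may fail: [s] looks
   atypical under every model satisfying the punish event, or the posterior given
   [s] does not trust the data of [s]. *)
Definition unreliable (s : ledger) : bool :=
  [|| `[< forall w, punish mdl rv eps s.1 w -> dev s w >],
      (beta * lik_ex P mdl s < ex_dev s)%R |
      weight (size s.2) s == 0%R].

Lemma ex_dev_ge0 s : (0 <= ex_dev s)%R.
Proof. by apply: (@Ex_ge0 _ _ _ P) => w; rewrite mulr_ge0 // ledger_lik_ge0. Qed.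

(* Change of measure: a hallucinated ledger is at most [1 / q_pun] times as likely
   as the honest ledger with the same contents. *)
Lemma unreliable_le m s :
  ((unreliable s)%:R * (weight m s * (hal (uncens s.2) s *
     lik_ex P mdl (censored_ledger (uncens s.2)))) <=
  q^-1 * (1 + beta^-1) * (weight m s * ex_dev s))%R.
Proof.
have q0' := ltW q0; have b0' := ltW beta0; have D0 := ex_dev_ge0 s.
have rhs0 : (0 <= q^-1 * (1 + beta^-1) * (weight m s * ex_dev s))%R.
  by rewrite !mulr_ge0 ?(weight_ge0 P reg _ _ _ N0) ?addr_ge0 ?invr_ge0.
have [un|_] := boolP (unreliable s); last by rewrite mul0r.
rewrite mul1r; have [->|W0] := eqVneq (weight m s) 0%R; first by rewrite !mul0r mulr0.
have h0 := hal_ge0 P reg nlrn eps (uncens s.2) s.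
have [->|h1] := eqVneq (hal (uncens s.2) s) 0%R; first by rewrite mul0r mulr0.
have {h0 h1} h : (0 < hal (uncens s.2) s)%R by rewrite lt_neqAle eq_sym h1.
rewrite [leRHS]mulrCA ler_wpM2l ?(weight_ge0 P reg _ _ _ N0) //.
have [EU _ _] := hal_gt0 reg h.
have szm : size s.2 = m.
  move: W0; rewrite /Submission.weight /ledger_weight.
  by have [//|_] := eqVneq (size s.2) m; rewrite /= mul0e eqxx.
(* If all models in the punish event deviate, the likelihood restricted to that event is at most
   [ex_dev s]; in the other case Markov's inequality costs [1 / beta]. *)
move: un; rewrite /unreliable szm (negbTE W0) orbF => /orP[/asboolP all_dev|big_dev].
  apply: le_trans (hal_cens_le_in reg q0 h) _.
  rewrite -mulrA ler_wpM2l ?invr_ge0 // mulrDl mul1r.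
  apply: (@le_trans _ _ (ex_dev s)); last by rewrite lerDl mulr_ge0 ?invr_ge0.
  apply: Ex_le => [||w].
  - by apply: (bmf_lik_in reg); exact: measurable_punish.
  - by apply: bmfM; [exact: (bmf_dev reg)|exact: (bmf_lik reg)].
  rewrite ler_wpM2r ?ledger_lik_ge0 // indicE.
  by case: (boolP (w \in _)) => // /set_mem/all_dev ->.
apply: le_trans (hal_cens_le reg q0 h) _.
rewrite -mulrA ler_wpM2l ?invr_ge0 // mulrDl mul1r.
apply: (@le_trans _ _ (beta^-1 * ex_dev s)%R); last by rewrite lerDr.
by rewrite mulrC ler_pdivlMr // mulrC ltW.
Qed.

(* Given the raw ledger, the conditional probability that the honest or the
   hallucinated ledger is misleading (as a union bound, possibly above [1]). *)
Definition bad_phase w (rl : rawledger) : \bar R :=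
  (dev (honest rl) w)%:R%:E + \S_(s : ledger) (hal rl s * (unreliable s)%:R)%R%:E.

Lemma bad_phase_ge0 w rl : 0 <= bad_phase w rl.
Proof.
rewrite adde_ge0 ?lee_fin //; apply: esumT_ge0 => s.
by rewrite lee_fin; apply: mulr_ge0 => //; exact: (hal_ge0 P reg).
Qed.

Definition bad_bound : R := (bound * (1 + q^-1 * (1 + beta^-1)))%R.

Lemma runD mu m l rl F G : model_valid mu -> (forall rl, 0 <= F rl) -> (forall rl, 0 <= G rl) ->
  run mu m l rl (fun x => F x + G x) = run mu m l rl F + run mu m l rl G.
Proof.
move=> mv F0 G0; elim: m l rl => //= m IH l rl.
rewrite -(stepD P reg nlrn eps N pol mv); last 2 first.
- by move=> ?; exact: (run_ge0 P reg).
- by move=> ?; exact: (run_ge0 P reg).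
by congr (step _ _ _ _ _ _ _ _ _ _ _); apply/funext => x; rewrite IH.
Qed.

Lemma integral_deviates m :
  \int[P]_w run (mdl w) m 1 [::] (fun rl => (dev (honest rl) w)%:R%:E) <= bound%:E.
Proof.
apply: (@le_trans _ _ (\int[P]_w (bound%:E))).
  apply: ge0_le_integral => //.
  - move=> w _; apply: (run_ge0 P reg _ _ _ _ (muv w)) => rl.
    by rewrite lee_fin.
  - apply: measurable_run => [w rl|rl]; first by rewrite lee_fin.
    by apply/measurable_EFinP; case: (bmf_dev reg nlrn e (honest rl)).
  - by move=> w _; exact: (deviation_bound P reg).
by rewrite integral_cst //= probability_setT mule1.
Qed.

(** The hallucinated term is moved by [unreliable_le] to the honest ledger, where it is again the
    probability of a deviation. *)
Lemma integral_bad_phase m :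
  \int[P]_w run (mdl w) m 1 [::] (bad_phase w) <= bad_bound%:E.
Proof.
have d0 w rl : 0 <= (dev (honest rl) w)%:R%:E :> \bar R by rewrite lee_fin.
have h0 rl : 0 <= \S_(s : ledger) (hal rl s * (unreliable s)%:R)%R%:E.
  apply: esumT_ge0 => s.
  by rewrite lee_fin; apply: mulr_ge0 => //; exact: (hal_ge0 P reg).
under eq_integral do rewrite /bad_phase (runD _ _ _ (muv _)) //.
rewrite ge0_integralD //; last 4 first.
- by move=> w _; apply: (run_ge0 P reg _ _ _ _ (muv w)).
- apply: measurable_run => // rl.
  by apply/measurable_EFinP; case: (bmf_dev reg nlrn e (honest rl)).
- by move=> w _; apply: (run_ge0 P reg _ _ _ _ (muv w)).
- exact: measurable_run.
rewrite /bad_bound mulrDr mulr1 EFinD leeD ?integral_deviates //.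
rewrite integral_hal_sum //.
apply: (@le_trans _ _ (\S_(s : ledger) ((q^-1 * (1 + beta^-1))%R%:E * (weight m s * ex_dev s)%R%:E))).
  by apply: le_esumT => s; rewrite -EFinM lee_fin unreliable_le.
have k0 : (0 <= q^-1 * (1 + beta^-1))%R.
  by rewrite mulr_ge0 ?addr_ge0 ?invr_ge0 ?ltW.
rewrite esumTZl //; last by move=> s; rewrite lee_fin mulr_ge0 ?(weight_ge0 P reg _ _ _ N0) ?ex_dev_ge0.
have -> : (bound * (q^-1 * (1 + beta^-1)))%R%:E = (q^-1 * (1 + beta^-1))%R%:E * bound%:E.
  by rewrite -EFinM mulrC.
rewrite lee_wpmul2l ?lee_fin //.
rewrite -(integral_honest_sum m (f := fun s w => (dev s w)%:R)) //.
  exact: integral_deviates.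
by move=> s; exact: (bmf_dev reg).
Qed.

End Unreliable.

(** * Progress of the exploration *)

Section Progress.
Context (R : realType) (S A H' : nat).
Local Notation H := H'.+1.
Context d (M : measurableType d) (P : probability M R).
Context (mdl : M -> mdp_model R S A H) (rv : nat -> R).
Hypothesis reg : regular_prior mdl rv.
Local Notation policy := (policy S A H).
Local Notation ftraj := (ftraj S A H).
Local Notation ledger := (ledger S A H).
Local Notation rawledger := (rawledger S A H).
Context (nlrn : nat) (eps : R).
Local Notation hal := (hal_prob P mdl rv nlrn eps).
Local Notation honest := (@honest_ledger S A H nlrn).
Local Notation under := (@under_explored S A H nlrn).
Local Notation q := (q_pun P mdl rv eps).
Local Notation r := (r_alt P mdl rv).
Context (N : nat) (pol : nat -> ledger -> policy).
Local Notation run := (run P mdl rv nlrn eps N pol).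
Local Notation step := (step P mdl rv nlrn eps N pol).
Variables (e beta rho p : R).
Local Notation unreliable := (unreliable P mdl rv nlrn eps N pol e beta).
Local Notation bad_phase := (bad_phase P mdl rv nlrn eps N pol e beta).
Local Notation dev s w := (deviates rv nlrn e s (mdl w)).

Let muv := reg_valid reg.

Definition unfinished w (rl : rawledger) : bool :=
  `[< exists2 t, t \in under rl & reachable rho (mdl w) t >].

Section HitGood.
Hypotheses (n0 : (0 < nlrn)%N) (N1 : (1 < N)%N).
Hypotheses (e0 : 0 <= e) (eps0 : 0 <= eps) (q0 : 0 < q) (r0 : 0 < r) (p1 : p <= 1).
Hypothesis br : best_responses P mdl rv N nlrn eps pol.
Hypothesis margin : H%:R * p <= r * rho - H%:R * (2 * e) - beta - H%:R * q^-1 / N.-1%:R -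
  H%:R * (eps + 2 * e) - H%:R * (H%:R * (2 * e)) - H%:R * beta.

Lemma hit_setT w pi (U : {set tri S A H}) : (forall t, t \in U) -> hit (mdl w) pi U = 1.
Proof.
move=> allU; rewrite /hit -[RHS](init_sum1 (muv w)); apply: eq_bigr => y _.
have hit1 k (u : nat -> 'I_S -> bool) n i : u i y -> chain_hit k u n i y = 1 :> R.
  by case: n => [|n] /= ->.
by rewrite hit1 ?mulr1 // allU.
Qed.

(** Each clause of reliability supplies one input of [hit_lower_bound]: a model [w0] in the punish
    event that agrees with the data, the bound [beta] on the posterior mass of deviating models, and
    the positive weight needed by [best_response_gap]. The competing policy is one that reaches the
    under-explored [t]. *)
Lemma hit_good w rl s (o : 'I_N) : unfinished w rl -> 0 < hal rl s -> ~~ unreliable s ->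
  ~~ dev (honest rl) w -> p <= hit (mdl w) (pol (kidx (size rl).+1 o) s) (under rl).
Proof.
move=> /asboolP[t tU [pi' occ]] h rel dw.
have [EU s0 _] := hal_gt0 reg h.
have sk : skel_cens s.2 = skel rl.
  by apply/eqP; move: h; rewrite (hal_probE P mdl rv) EU eqxx; case: (_ == _); rewrite // mul0r ltxx.
have sku : skel rl = skel (uncens s.2) by rewrite skel_uncens sk.
have s_under : s.1 = under (uncens s.2) by rewrite EU (under_explored_skel nlrn sku).
rewrite -EU; rewrite -EU in tU.
have szrl : size s.2 = size rl by rewrite -(size_skel rl) -sk size_map.
(* With fewer than [nlrn] entries all triples are under-explored and one is hit at once. Initial
   states are tested only from [nlrn] entries on. *)
have [sz|sz] := leqP nlrn (size s.2); last first.
  rewrite hit_setT // => t'; rewrite EU inE; apply: leq_ltn_trans (count_size _ _) _.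
  by rewrite -szrl.
move: rel => /norP[/asboolPn small' /norP[exd W0]].
have [w0 [w0p dw0]] : exists w0, punish mdl rv eps s.1 w0 /\ ~~ dev s w0.
  apply: contrapT => na; apply: small' => w0 w0p.
  by case: (boolP (dev s w0)) => // nd; case: na; exists w0.
have lex0 : 0 < lik_ex P mdl s.
  apply: lt_le_trans s0 (lik_in_le P reg _ _).
  exact: measurable_punish.
have fw : fits mdl rv nlrn e w s.
  apply: (fits_deviates dw); first by rewrite EU.
  by rewrite /= -/(cens _ _) skel_cens_cens sk.
have N0 : (0 < N)%N by exact: ltnW.
have hu : 0 < hal (uncens s.2) s by rewrite -(hal_skel P mdl rv nlrn eps s sku).
have Wgt : 0 < weight P mdl rv nlrn eps N pol (size rl) s.
  by rewrite lt_neqAle (weight_ge0 P reg _ _ _ N0) andbT eq_sym -szrl.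
have gap := best_response_gap reg N0 br q0 o pi' Wgt hu.
pose g := H%:R * q^-1 / N.-1%:R.
have N1' : 0 < N.-1%:R :> R by rewrite ltr0n; case: (N) N1 => [|[]].
have rb t' : t' \notin s.1 -> rmean rv (mdl w0) t' <= eps.
  by move=> ?; apply: w0p; rewrite finset.in_setC.
have := hit_lower_bound reg n0 e0 s_under sz fw lex0 eps0 rb dw0 (beta := beta) (g := g)
  (pi := pol (kidx (size rl).+1 o) s) (pi' := pi').
rewrite -/(ex_dev _ _ _ _ _ _) leNgt => /(_ exd).
have -> : g * lik_ex P mdl s = H%:R * q^-1 * lik_ex P mdl s / N.-1%:R by rewrite /g mulrAC.
rewrite ler_pdivlMr // mulrC => /(_ gap) main.
have hit' : rho <= hit (mdl w) pi' s.1 by apply: le_trans occ (occupancy_le_hit _ _ tU).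
have rh : r * rho <= r * hit (mdl w) pi' s.1 by rewrite ler_wpM2l // ltW.
have Hpos : 0 < H%:R :> R by rewrite ltr0n.
have marg := margin; rewrite -/g in marg.
rewrite -(ler_pM2l Hpos); move: main; rewrite mulrDr; lra.
Qed.

End HitGood.

Definition deficit (rl : rawledger) : nat :=
  (\sum_(t : tri S A H) (nlrn - count (fun e => visits t e.2) rl))%N.

Lemma count_rcons (T : Type) (a : pred T) s x : count a (rcons s x) = (count a s + a x)%N.
Proof. by rewrite -cats1 count_cat /= addn0. Qed.

Lemma deficit_rcons rl (x : policy * ftraj) :
  (deficit (rcons rl x) + [exists h : 'I_H, ((x.2 h).1, h) \in under rl] <= deficit rl)%N.
Proof.
have le1 t : (nlrn - count (fun e => visits t e.2) (rcons rl x) <=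
              nlrn - count (fun e => visits t e.2) rl)%N.
  by rewrite leq_sub2l // count_rcons leq_addr.
case: existsP => [[h hU]|_]; last by rewrite addn0; apply: leq_sum => t _.
rewrite /deficit (bigD1 ((x.2 h).1, h)) //= [leqRHS](bigD1 ((x.2 h).1, h)) //=.
rewrite addnAC leq_add //; last by apply: leq_sum => t _.
move: hU; rewrite inE count_rcons.
have -> : visits ((x.2 h).1, h) x.2 by apply/existsP; exists h.
by move=> hU; rewrite subnDA addn1 subn1 prednK // subn_gt0.
Qed.

Lemma unfinished_rcons w rl x : unfinished w (rcons rl x) -> unfinished w rl.
Proof.
move=> /asboolP[t tU re]; apply/asboolP; exists t => //.
by move: tU; rewrite !inE count_rcons; apply: leq_ltn_trans; exact: leq_addr.
Qed.

Local Open Scope ereal_scope.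

Hypothesis N0 : (0 < N)%N.
Hypotheses (p0 : (0 <= p)%R) (p1 : (p <= 1)%R).
Hypothesis good : forall w rl s (o : 'I_N), unfinished w rl -> (0 < hal rl s)%R ->
  ~~ unreliable s -> ~~ dev (honest rl) w ->
  (p <= hit (mdl w) (pol (kidx (size rl).+1 o) s) (under rl))%R.

(** [m] counts the phases still to run, each credited in advance with the factor [1 - p / 2]. *)
Definition potential m rl : R := (2 ^+ deficit rl * (1 - p / 2) ^+ m)%R.

Lemma potential_ge0 m rl : (0 <= potential m rl)%R.
Proof. by have p1' := p1; rewrite mulr_ge0 ?exprn_ge0 //; lra. Qed.

(** A visit to [under rl] lowers the deficit by at least one, so the factor is [1 - hit / 2] or less
    in expectation. *)
Lemma potential_step w m rl (pi : policy) : (p <= hit (mdl w) pi (under rl))%R ->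
  \S_(tau : ftraj) ((ftraj_prob (mdl w) pi tau)%:E * (potential m (rcons rl (pi, tau)))%:E)
  <= (potential m.+1 rl)%:E.
Proof.
move=> ph; have p0' := p0; have p1' := p1.
pose ind (tau : ftraj) := [exists h : 'I_H, ((tau h).1, h) \in under rl].
pose K := potential m rl; have K0 : (0 <= K)%R := potential_ge0 m rl.
have t0 tau : (0 <= ftraj_prob (mdl w) pi tau)%R by exact: ftraj_prob_ge0.
apply: (@le_trans _ _ (\S_(tau : ftraj) ((ftraj_prob (mdl w) pi tau)%:E * (K * (1 - (ind tau)%:R / 2))%R%:E))).
  apply: le_esumT => tau; rewrite lee_wpmul2l ?lee_fin // /potential /K mulrAC.
  rewrite ler_wpM2r ?exprn_ge0 //; first by lra.
  have := deficit_rcons rl (pi, tau); rewrite -/(ind tau) /=; case: (ind tau) => /= h.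
    apply: (@le_trans _ _ (2 ^+ (deficit rl).-1)%R).
      by rewrite ler_eXn2l ?ltr1n // -ltnS prednK ?(leq_trans _ h) ?addn1.
    rewrite -[X in (_ <= 2 ^+ X * _)%R](prednK (leq_trans _ h)) ?addn1 // exprS.
    by rewrite mulrAC (_ : (2 * (1 - 1 / 2) = 1)%R) ?mul1r //; lra.
  by rewrite mul0r subr0 mulr1 ler_eXn2l ?ltr1n // -[X in (X <= _)%N]addn0.
(* An addition instead of a subtraction, so that only nonnegative terms are summed. *)
have E : \S_(tau : ftraj) ((ftraj_prob (mdl w) pi tau)%:E * (K * (1 - (ind tau)%:R / 2))%R%:E) +
    (K / 2 * hit (mdl w) pi (under rl))%R%:E = K%:E.
  rewrite EFinM -(traj_hit _ (muv w)) -esumTZl; first last.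
  - by move=> tau; rewrite mule_ge0 ?lee_fin.
  - by rewrite mulr_ge0.
  rewrite -esumTD; last 2 first.
  - by move=> tau; rewrite mule_ge0 ?lee_fin // mulr_ge0 //; case: (ind tau) => /=; lra.
  - move=> tau; apply: mule_ge0; first by rewrite lee_fin mulr_ge0.
    by rewrite mule_ge0 ?lee_fin.
  rewrite -[RHS]mul1e -(ftraj_prob_sum1 pi (muv w)) -esumTZr // .
  apply: eq_esumT => tau; rewrite -!EFinM -EFinD; congr EFin; rewrite -/(ind tau).
  by field.
have := congr1 (fun z => z - (K / 2 * hit (mdl w) pi (under rl))%R%:E) E.
rewrite addeK // => ->; rewrite -EFinB lee_fin /potential exprS.
rewrite (_ : (_ * (_ * _) = K * (1 - p / 2))%R); last by rewrite /K /potential; ring.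
have := ler_wpM2l K0 ph; lra.
Qed.

(** Expected sum of [bad_phase] over the next [m] phases, in the recursive form that the induction
    of [progress] needs. *)
Fixpoint bad_total m w l rl : \bar R :=
  if m is m'.+1 then bad_phase w rl + step (mdl w) l rl (bad_total m' w l.+1) else 0.

Lemma bad_total_ge0 m w l rl : 0 <= bad_total m w l rl.
Proof.
elim: m l rl => //= m IH l rl; rewrite adde_ge0 ?(bad_phase_ge0 P reg) //.
exact: (step_ge0 P reg).
Qed.

Lemma esum2D (T1 T2 : countType) (f g : T1 -> T2 -> \bar R) :
  (forall x y, 0 <= f x y) -> (forall x y, 0 <= g x y) ->
  \S_x \S_y (f x y + g x y) = \S_x \S_y f x y + \S_x \S_y g x y.
Proof.
move=> f0 g0; rewrite -esumTD; last 2 first.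
- by move=> x; exact: esumT_ge0.
- by move=> x; exact: esumT_ge0.
by apply: eq_esumT => x; rewrite esumTD.
Qed.

(* The potential halves at each visit to an under-explored triple, so a good
   phase multiplies it by [1 - p / 2] on average. *)
Lemma progress m w rl :
  run (mdl w) m (size rl).+1 rl (fun rl' => (unfinished w rl')%:R%:E) <=
  ((unfinished w rl)%:R * potential m rl)%R%:E + bad_total m w (size rl).+1 rl.
Proof.
have nf0 rl' : 0 <= ((unfinished w rl')%:R%:E : \bar R) <= 1.
  by rewrite lee_fin /=; case: (unfinished w rl'); rewrite lee_fin ?lexx ?ler01.
elim: m rl => [|m IH] rl /=.
  rewrite adde0 lee_fin /potential expr0 mulr1 -[leLHS]mulr1 ler_wpM2l //.
  by rewrite exprn_ege1 // ler1n.
have run_le rl' l : run (mdl w) m l rl' (fun rl' => (unfinished w rl')%:R%:E) <= 1.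
  exact: (run_le1 P reg _ _ _ N0 (muv w)).
have IH' x : run (mdl w) m (size rl).+2 (rcons rl x) (fun rl' => (unfinished w rl')%:R%:E) <=
  ((unfinished w (rcons rl x))%:R * potential m (rcons rl x))%R%:E +
  bad_total m w (size rl).+2 (rcons rl x).
  by have := IH (rcons rl x); rewrite size_rcons.
have b0 := bad_phase_ge0 P reg nlrn eps N pol e beta w rl.
have [nf|fin] := boolP (unfinished w rl); last first.
  rewrite mul0r add0e -[leLHS]add0e leeD //; apply: (le_step P reg _ _ _ _ (muv w)) => x.
  apply: le_trans (IH' x) _.
  have -> : unfinished w (rcons rl x) = false by apply/negP => /unfinished_rcons; exact/negP.
  by rewrite mul0r add0e.
have t0 pi tau : 0 <= (ftraj_prob (mdl w) pi tau)%:E by rewrite lee_fin; exact: ftraj_prob_ge0.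
have s0 F l rl' : (forall rl, 0 <= F rl) -> 0 <= step (mdl w) l rl' F by exact: (step_ge0 P reg).
have hal0 lam : (0 <= hal rl lam)%R by exact: (hal_ge0 P reg).
have un0 : 0 <= \S_(s : ledger) (hal rl s * (unreliable s)%:R)%R%:E.
  by apply: esumT_ge0 => s; rewrite lee_fin mulr_ge0.
(* A deviating honest ledger makes [bad_phase] at least [1], which already bounds the left side. *)
have [dv|ndv] := boolP (dev (honest rl) w).
  apply: (@le_trans _ _ 1).
    apply: (step_le_cst P reg _ _ _ N0) => // pi.
    rewrite -(ftraj_prob_sum1 pi (muv w)); apply: le_esumT => tau.
    by rewrite -[leRHS]mule1 lee_wpmul2l.
  apply: (@le_trans _ _ (bad_phase w rl)).
    by rewrite /Submission.bad_phase dv -[leLHS]adde0 leeD.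
  rewrite addeC -addeA -[leLHS]adde0 leeD // adde_ge0 //.
    by rewrite s0 // => rl'; exact: bad_total_ge0.
  by rewrite lee_fin mul1r potential_ge0.
rewrite mul1r /Submission.bad_phase (negbTE ndv) add0e.
pose a := potential m.+1 rl; have a0 : (0 <= a)%R := potential_ge0 m.+1 rl.
pose X lam (o : 'I_N) := \S_(tau : ftraj) ((ftraj_prob (mdl w) (pol (kidx (size rl).+1 o) lam) tau)%:E *
    bad_total m w (size rl).+2 (rcons rl (pol (kidx (size rl).+1 o) lam, tau))).
have X0 lam o : 0 <= X lam o.
  by apply: esumT_ge0 => tau; rewrite mule_ge0 // bad_total_ge0.
have nh lam : 0 <= (N%:R^-1 * hal rl lam)%R%:E by exact: (nhal_ge0 P reg).
apply: (@le_trans _ _ (\S_(o : 'I_N) \S_(lam : ledger)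
   (((N%:R^-1 * (hal rl lam * (unreliable lam)%:R))%R%:E + (N%:R^-1 * hal rl lam * a)%R%:E) +
    (N%:R^-1 * hal rl lam)%R%:E * X lam o))).
  apply: le_esumT => o; apply: le_esumT => lam.
  have [h0|hn0] := eqVneq (hal rl lam) 0%R; first by rewrite h0 !(mulr0, mul0r, mul0e, adde0).
  have hgt : (0 < hal rl lam)%R by rewrite lt_neqAle eq_sym hn0 hal0.
  have -> : (N%:R^-1 * (hal rl lam * (unreliable lam)%:R))%R%:E + (N%:R^-1 * hal rl lam * a)%R%:E =
      (N%:R^-1 * hal rl lam)%R%:E * ((unreliable lam)%:R + a)%R%:E.
    by rewrite -EFinM -EFinD; congr EFin; ring.
  rewrite -ge0_muleDr ?lee_fin ?addr_ge0 // lee_wpmul2l //.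
  have [un|rel] := boolP (unreliable lam).
    apply: (@le_trans _ _ 1); last first.
      by rewrite EFinD -addeA -[leLHS]adde0 leeD // adde_ge0 // lee_fin.
    rewrite -(ftraj_prob_sum1 (pol (kidx (size rl).+1 o) lam) (muv w)); apply: le_esumT => tau.
    by rewrite -[leRHS]mule1 lee_wpmul2l.
  rewrite add0r.
  apply: (@le_trans _ _ (\S_(tau : ftraj) ((ftraj_prob (mdl w) (pol (kidx (size rl).+1 o) lam) tau)%:E *
     (potential m (rcons rl (pol (kidx (size rl).+1 o) lam, tau)))%:E) + X lam o)).
    rewrite -esumTD; last 2 first.
    - by move=> tau; rewrite mule_ge0 // lee_fin potential_ge0.
    - by move=> tau; rewrite mule_ge0 // bad_total_ge0.
    apply: le_esumT => tau; rewrite -ge0_muleDr ?lee_fin ?potential_ge0 ?bad_total_ge0 //.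
    rewrite lee_wpmul2l //; apply: le_trans (IH' _) _; rewrite leeD2r // lee_fin.
    by rewrite ler_piMl ?potential_ge0 //; case: (unfinished _ _).
  rewrite leeD2r //; apply: potential_step; exact: good.
have A1 lam : 0 <= (N%:R^-1 * (hal rl lam * (unreliable lam)%:R))%R%:E.
  by rewrite lee_fin mulr_ge0 ?invr_ge0 // mulr_ge0.
have A2 lam : 0 <= (N%:R^-1 * hal rl lam * a)%R%:E.
  by rewrite EFinM mule_ge0 // lee_fin.
rewrite esum2D; last 2 first.
- by move=> o lam; rewrite adde_ge0 ?A1 ?A2.
- by move=> o lam; rewrite mule_ge0.
rewrite addeA leeD //.
rewrite esum2D // addeC leeD //.
  apply: (@le_trans _ _ (step (mdl w) (size rl).+1 rl (fun=> a%:E))).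
    apply: le_esumT => o; apply: le_esumT => lam; rewrite EFinM lee_wpmul2l //.
    by rewrite esumTZr // ftraj_prob_sum1 // mul1e.
  apply: (step_le_cst P reg _ _ _ N0) => // pi.
  by rewrite esumTZr // ftraj_prob_sum1 // mul1e.
have -> : \S_(o : 'I_N) \S_(lam : ledger) (N%:R^-1 * (hal rl lam * (unreliable lam)%:R))%R%:E =
    \S_(o : 'I_N) ((N%:R^-1)%:E * \S_(lam : ledger) (hal rl lam * (unreliable lam)%:R)%R%:E).
  apply: eq_esumT => o; rewrite -esumTZl ?invr_ge0 // => lam.
  by rewrite lee_fin mulr_ge0.
under eq_esumT do rewrite muleC.
by rewrite esumTZl_ereal ?sum_ord_inv ?mule1.
Qed.

Lemma step_sum mu m l rl (F : nat -> rawledger -> \bar R) : model_valid mu ->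
  (forall j rl, 0 <= F j rl) ->
  step mu l rl (fun x => \sum_(j < m) F j x) = \sum_(j < m) step mu l rl (F j).
Proof.
move=> mv F0; elim: m => [|m IH].
  rewrite big_ord0 /Submission.step esum1 // => o _; rewrite esum1 // => lam _.
  by rewrite esum1 ?mule0 // => tau _; rewrite big_ord0 mule0.
rewrite big_ord_recr /= -IH -(stepD P reg nlrn eps N pol mv) //; last first.
  by move=> x; apply: sume_ge0.
by congr (step _ _ _ _); apply/funext => x; rewrite big_ord_recr.
Qed.

Lemma bad_totalE m w l rl :
  bad_total m w l rl = \sum_(j < m) run (mdl w) j l rl (bad_phase w).
Proof.
elim: m l rl => [|m IH] l rl /=; first by rewrite big_ord0.
rewrite big_ord_recl; congr (_ + _); under [RHS]eq_bigr do rewrite lift0 /=.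
rewrite -(step_sum m l rl (F := fun j rl' => run (mdl w) j l.+1 rl' (bad_phase w)) (muv w)).
  by congr (step _ _ _ _); apply/funext => x; rewrite IH.
by move=> j x; apply: (run_ge0 P reg _ _ _ _ (muv w)) => y; exact: (bad_phase_ge0 P reg).
Qed.

End Progress.

(** * Exploration probability and unfinished ledgers *)

Section Explore.
Context (R : realType) (S A H' : nat).
Local Notation H := H'.+1.
Context d (M : measurableType d) (P : probability M R).
Context (mdl : M -> mdp_model R S A H) (rv : nat -> R).
Hypothesis reg : regular_prior mdl rv.
Local Notation policy := (policy S A H).
Local Notation ledger := (ledger S A H).
Local Notation rawledger := (rawledger S A H).
Context (nlrn : nat) (eps : R).
Local Notation hal := (hal_prob P mdl rv nlrn eps).
Local Notation under := (@under_explored S A H nlrn).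
Local Notation q := (q_pun P mdl rv eps).
Context (N : nat) (pol : nat -> ledger -> policy).
Hypothesis N0 : (0 < N)%N.
Local Notation run := (run P mdl rv nlrn eps N pol).
Local Notation step := (step P mdl rv nlrn eps N pol).
Local Notation raw_weight := (raw_weight P mdl rv nlrn eps N pol).
Local Notation hist w := (hist_prob P mdl rv nlrn eps pol (mdl w)).
Local Notation phase_outN := (phase_out S A H N).
Variable rho : R.
Local Notation unfinished := (unfinished mdl nlrn rho).

Let muv := reg_valid reg.
Local Open Scope ereal_scope.

Lemma rawlik_le_cens w rl : (rawlik (mdl w) rl <= ledger_lik (mdl w) (censored_ledger rl))%R.
Proof.
rewrite -lee_fin -(rawlik_cens (muv w)) -/(cens _ _).
have := esum_ge1 (f := fun rl' : rawledger => (rawlik (mdl w) rl')%:E *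
  (cens [set: tri S A H]%SET rl' == cens [set: tri S A H]%SET rl)%:R%:E) rl.
rewrite eqxx mule1; apply => rl'.
by rewrite mule_ge0 ?lee_fin // rawlik_ge0.
Qed.

(** If the punish event has posterior probability [0], then [q > 0] forces the censored ledger, and
    with it the raw ledger, to have probability [0]. *)
Lemma Ex_rawlik_undefined rl : (0 < q)%R -> ~~ hal_defined P mdl rv nlrn eps rl ->
  Ex P (fun w => rawlik (mdl w) rl) = 0%R.
Proof.
move=> q0; rewrite /hal_defined -leNgt => le0.
apply/eqP; rewrite eq_le; apply/andP; split; last first.
  by apply: (@Ex_ge0 _ _ _ P) => w; exact: rawlik_ge0.
apply: (@le_trans _ _ (lik_ex P mdl (censored_ledger rl))).
  by apply: Ex_le => [||w]; [exact: (bmf_rawlik reg)|exact: (bmf_lik reg)|exact: rawlik_le_cens].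
have := le_trans (q_pun_le P reg nlrn eps rl) le0.
by rewrite pmulr_rle0.
Qed.

Lemma step_one w l rl : step (mdl w) l rl (fun=> 1) = (hal_defined P mdl rv nlrn eps rl)%:R%:E.
Proof.
rewrite /Submission.step -(hal_sum P reg).
transitivity (\S_(o : 'I_N) ((N%:R^-1)%:E * \S_(lam : ledger) (hal rl lam)%:E)).
  apply: eq_esumT => o; rewrite -esumTZl ?invr_ge0 //; last first.
    by move=> lam; rewrite lee_fin (hal_ge0 P reg).
  apply: eq_esumT => lam; under eq_esumT do rewrite mule1.
  by rewrite (ftraj_prob_sum1 _ (muv w)) mule1 -EFinM.
under eq_esumT do rewrite muleC.
rewrite esumTZl_ereal ?(sum_ord_inv R N0) ?mule1 //.
  by apply: esumT_ge0 => lam; rewrite lee_fin (hal_ge0 P reg).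
Qed.

(** Undefined hallucinations lose mass only at raw ledgers of prior probability [0]. The total mass
    is therefore [1] on average over the prior, though not necessarily for each model. *)
Lemma integral_run_one m : (0 < q)%R -> \int[P]_w run (mdl w) m 1 [::] (fun=> 1) = 1.
Proof.
move=> q0; elim: m => [|m IH]; first by rewrite /= integral_cst //= mul1e probability_setT.
pose def rl := hal_defined P mdl rv nlrn eps rl.
have E w : run (mdl w) m.+1 1 [::] (fun=> 1) = run (mdl w) m 1 [::] (fun rl => (def rl)%:R%:E).
  rewrite -addn1 run_addn; congr (Submission.run _ _ _ _ _ _ _ _ _ _ _ _); apply/funext => rl /=.
  exact: step_one.
under eq_integral do rewrite E.
have b0 (b : rawledger -> bool) rl : 0 <= (b rl)%:R%:E :> \bar R by rewrite lee_fin.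
have mb (b : rawledger -> bool) :
    measurable_fun setT (fun w => run (mdl w) m 1 [::] (fun rl => (b rl)%:R%:E)).
  by apply: (measurable_run P reg nlrn eps N pol m (F := fun _ rl => (b rl)%:R%:E)) => // *; rewrite lee_fin.
have undef0 : \int[P]_w run (mdl w) m 1 [::] (fun rl => (~~ def rl)%:R%:E) = 0.
  under eq_integral do rewrite (run_weightE P reg nlrn eps N pol (muv _)) //.
  have WE rl : raw_weight 1 [::] rl = (fine (raw_weight 1 [::] rl))%:E.
    rewrite fineK // ge0_fin_numE; last exact: (raw_weight_ge0 P reg).
    exact: le_lt_trans (raw_weight_le1 P reg _ _ _ N0 _ _ _) (ltry _).
  pose c rl : R := ((size rl == m)%:R * fine (raw_weight 1 [::] rl) * (~~ def rl)%:R)%R.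
  have tE w rl : (size rl == m)%:R%:E * (raw_weight 1 [::] rl *
      ((rawlik (mdl w) rl)%:E * (~~ def ([::] ++ rl))%:R%:E)) = (c rl * rawlik (mdl w) rl)%R%:E.
    by rewrite WE -!EFinM; congr EFin; rewrite /c /=; ring.
  have W0 rl : (0 <= fine (raw_weight 1 [::] rl))%R.
    by rewrite -lee_fin -WE (raw_weight_ge0 P reg).
  have bc rl : bounded_mfun (fun w => c rl * rawlik (mdl w) rl)%R.
    by apply: bmfZ; exact: (bmf_rawlik reg).
  under eq_integral do under eq_esumT do rewrite tE.
  rewrite integral_esum; last 2 first.
  - by move=> rl w; rewrite lee_fin mulr_ge0 ?rawlik_ge0 // !mulr_ge0.
  - by move=> rl; apply/measurable_EFinP; case: (bc rl).
  rewrite esum1 // => rl _; rewrite -ExE // ExZ; last exact: (bmf_rawlik reg).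
  have [df|ndf] := boolP (def rl); first by rewrite /c df mulr0 mul0r.
  by rewrite Ex_rawlik_undefined // mulr0.
rewrite -IH -[LHS]adde0 -undef0 -ge0_integralD //; last 2 first.
- by move=> w _; apply: (run_ge0 P reg _ _ _ _ (muv w)).
- by move=> w _; apply: (run_ge0 P reg _ _ _ _ (muv w)).
apply: eq_integral => w _; rewrite -(runD P reg nlrn eps N pol _ _ _ (muv w)) //.
congr (Submission.run _ _ _ _ _ _ _ _ _ _ _ _); apply/funext => rl.
by case: (def rl); rewrite /= ?adde0 ?add0e.
Qed.

(** The hallucination episodes are among the first [K] episodes, and they alone account for the
    visits recorded in the raw ledger. *)
Lemma visit_count_raw (t : tri S A H) K l rl (phs : seq phase_outN) : (0 < l)%N ->
  ((l.-1 + size phs) * N <= K)%N ->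
  (count (fun e => visits t e.2) (raw_after pol l rl phs) <=
   count (fun e => visits t e.2) rl + visit_count t K l phs)%N.
Proof.
elim: phs l rl => [|ph phs IH] l rl l0 /= lK; first by rewrite addn0.
apply: leq_trans (IH l.+1 _ isT _) _; first by rewrite /= -{1}(prednK l0) addSnnS.
rewrite addnA leq_add2r count_rcons leq_add2l /new_entry /= (bigD1 ph.1.1) //=.
apply: leq_trans (leq_addr _ _); case: (visits _ _); rewrite ?andbF // andbT.
suff -> : (kidx l ph.1.1 <= K)%N by [].
apply: leq_trans lK; rewrite /kidx -addnS addnS mulnDl -addnS leq_add2l.
by rewrite mulSn (leq_trans (ltn_ord _)) ?leq_addr.
Qed.

Lemma visit_count_take (t : tri S A H) K l L (phs : seq phase_outN) :
  (visit_count t K l (take L phs) <= visit_count t K l phs)%N.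
Proof.
elim: phs l L => [|ph phs IH] l [|L] //=; by rewrite leq_add2l.
Qed.

Lemma explored_finished w K L (phs : seq phase_outN) : (L * N <= K)%N -> (L <= size phs)%N ->
  ~~ unfinished w (raw_after pol 1 [::] (take L phs)) ->
  explored rho nlrn K (mdl w) phs.
Proof.
move=> LK Lsz /asboolPn fin t re.
have : t \notin under (raw_after pol 1 [::] (take L phs)).
  by apply/negP => tU; apply: fin; exists t.
rewrite inE -leqNgt => /leq_trans; apply.
apply: leq_trans (visit_count_raw t (K := K) [::] (ltn0Sn 0) _) _.
  by rewrite /= size_takel.
by rewrite add0n visit_count_take.
Qed.

Lemma bmf_hist l rl (phs : seq phase_outN) : bounded_mfun (fun w => hist w l rl phs).
Proof.
elim: phs l rl => [|ph phs IH] l rl /=; first exact: bmf_cst.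
apply: bmfM => //; rewrite /phase_prob; apply: bmfZ.
by apply: bmf_prod => i; exact: (bmf_ftraj_prob reg).
Qed.

Lemma measurable_explored K (phs : seq phase_outN) :
  measurable [set w | explored rho nlrn K (mdl w) phs].
Proof.
rewrite (_ : [set _ | _] = \bigcap_(t in [set t : tri S A H | ~~ (nlrn <= visit_count t K 1 phs)%N])
   ~` [set w | reachable rho (mdl w) t]); last first.
  apply/seteqP; split => [w ex t /= nv re|w ex t re]; first by move: nv; rewrite ex.
  by apply: contraT => nv; have := ex t nv.
apply: fin_bigcap_measurable; first exact: finite_finset.
by move=> t _; apply: measurableC; exact: (measurable_reachable reg).
Qed.

Lemma measurable_unfinished rl : measurable [set w | unfinished w rl].
Proof.
rewrite (_ : [set _ | _] = \bigcup_(t in [set` under rl]) [set w | reachable rho (mdl w) t]); last first.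
  apply/seteqP; split => [w /asboolP[t tU re]|w [t tU re]]; first by exists t.
  by apply/asboolP; exists t.
apply: fin_bigcup_measurable; first exact: finite_finset.
by move=> t _; exact: (measurable_reachable reg).
Qed.

Lemma measurable_bool (b : M -> bool) : measurable [set w | b w] ->
  measurable_fun setT (fun w => (b w)%:R%:E : \bar R).
Proof.
move=> mb; apply/measurable_EFinP; have [+ _] := bmf_indic R mb.
congr (measurable_fun _); apply/funext => w; rewrite indicE; congr (_%:R)%R; congr nat_of_bool.
by apply/idP/idP => [/set_mem|?] //; apply/mem_set.
Qed.

(** For each model the two terms dominate the total mass of [mK] phases; averaging over the prior
    turns this mass into [1]. *)
Lemma explore_prob_unfinished K L : (0 < q)%R -> (L * N <= K)%N ->
  1 <= explore_prob P mdl rv N nlrn eps pol rho nlrn K +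
       \int[P]_w run (mdl w) L 1 [::] (fun rl => (unfinished w rl)%:R%:E).
Proof.
(* [K / N] rounded up, since episode [K] may fall inside the last phase. *)
move=> q0 LK; set mK := ((K + N.-1) %/ N)%N.
have LmK : (L <= mK)%N.
  by rewrite leq_divRL // (leq_trans LK) // leq_addr.
pose fe w := \S_(phs : seq phase_outN)
   (((size phs == mK) && `[< explored rho nlrn K (mdl w) phs >])%:R%:E * (hist w 1 [::] phs)%:E).
have h0 w l rl phs : (0 <= hist w l rl phs)%R by exact: (hist_ge0 P reg _ _ _ (muv w)).
have nf0 w rl : 0 <= (unfinished w rl)%:R%:E :> \bar R by rewrite lee_fin.
have -> : explore_prob P mdl rv N nlrn eps pol rho nlrn K = \int[P]_w fe w.
  rewrite /explore_prob; apply: eq_integral => w _; rewrite esum_mkcond.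
  apply: eq_esumT => phs; set D := [set phs | _].
  have -> : (phs \in D) = (size phs == mK) && `[< explored rho nlrn K (mdl w) phs >].
    apply/idP/andP => [/set_mem[h1 h2]|[/eqP h1 /asboolP h2]].
      by split; [exact/eqP|exact/asboolP].
    by apply/mem_set; split.
  by case: (_ && _); rewrite ?mul1e ?mul0e.
have mfe : measurable_fun setT fe.
  apply: measurable_esum => [phs w|phs]; first by rewrite mule_ge0 ?lee_fin.
  apply: emeasurable_funM; last by apply/measurable_EFinP; case: (bmf_hist 1 [::] phs).
  apply: measurable_bool; case: (size phs == mK) => /=.
    rewrite (_ : [set _ | _] = [set w | explored rho nlrn K (mdl w) phs]); last first.
      by apply/seteqP; split => w /asboolP.
    exact: measurable_explored.
  by rewrite (_ : [set _ | _] = set0) //; apply/seteqP; split.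
have mrun : measurable_fun setT (fun w => run (mdl w) L 1 [::] (fun rl => (unfinished w rl)%:R%:E)).
  apply: (measurable_run P reg nlrn eps N pol L (F := fun w rl => (unfinished w rl)%:R%:E)) => // rl.
  by apply: measurable_bool; exact: measurable_unfinished.
rewrite -(integral_run_one mK q0) -ge0_integralD //; last 2 first.
- by move=> w _; apply: esumT_ge0 => phs; rewrite mule_ge0 ?lee_fin.
- by move=> w _; apply: (run_ge0 P reg _ _ _ _ (muv w)).
apply: ge0_le_integral => //.
- by move=> w _; apply: (run_ge0 P reg _ _ _ _ (muv w)).
- exact: (measurable_run P reg nlrn eps N pol mK (F := fun _ _ => 1)).
- exact: emeasurable_funD.
move=> w _; rewrite -(hist_sum P reg nlrn eps N pol (muv w)) //.
have [m' mE] : exists m', mK = (L + m')%N by exists (mK - L)%N; rewrite subnKC.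
apply: (@le_trans _ _ (fe w + \S_(phs : seq phase_outN)
   ((size phs == (L + m')%N)%:R%:E * ((hist w 1 [::] phs)%:E *
     (unfinished w (raw_after pol 1 [::] (take L phs)))%:R%:E)))); last first.
  rewrite leeD2l // (hist_sum_take P reg nlrn eps N pol (muv w) L m' 1 [::]
    (F := fun rl => (unfinished w rl)%:R%:E)) //.
  apply: (le_run P reg _ _ _ _ (muv w)) => rl.
  rewrite -[leRHS]mule1 lee_wpmul2l //; apply: (run_le1 P reg _ _ _ N0 (muv w)) => rl'.
  by rewrite lexx lee01.
rewrite -esumTD; last 2 first.
- by move=> phs; rewrite mule_ge0 ?lee_fin.
- move=> phs; apply: mule_ge0; first by rewrite lee_fin.
  by apply: mule_ge0; rewrite lee_fin ?h0.
apply: le_esumT => phs; rewrite -mE mule1.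
have [sz|_] := eqVneq (size phs) mK; last by rewrite !mul0e adde0.
rewrite !mul1e /=; have [nf|fin] := boolP (unfinished w _).
  by rewrite mule1 -[leLHS]add0e leeD // mule_ge0 ?lee_fin.
have -> : `[< explored rho nlrn K (mdl w) phs >].
  by apply/asboolP; apply: explored_finished fin => //; rewrite sz.
by rewrite mul1e mule0 adde0.
Qed.

End Explore.

(** * Choice of the parameters *)

Section Numerics.
Context (R : realType).
Implicit Types x q delta : R.

Lemma expRN_le_half_pow (k : nat) : expR (- k%:R) <= (2^-1 : R) ^+ k.
Proof.
rewrite -[k%:R]mulr1 -mulrN expRM_natl lerXn2r ?nnegrE ?expR_ge0 ?invr_ge0 //.
rewrite expRN lef_pV2 ?posrE ?expR_gt0 // (le_trans _ (expR_ge1Dx 1)) //.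
Qed.

Lemma mul_expRN_le1 (y : R) : 0 <= y -> y * expR (- y) <= 1.
Proof.
move=> y0; rewrite expRN ler_pdivrMr ?expR_gt0 // mul1r.
by apply: le_trans (expR_ge1Dx y); rewrite lerDr.
Qed.

(** Powers with exponent [S] and exponentials are plain variables here, which keeps them opaque to
    [field]. *)
Lemma bad_sum_factor (a b c m h n x q u v : R) : x != 0 -> q != 0 ->
  a * n * m * h / x * (b * m * u * (v * v) * (c * h / (q * x))) =
  a * b * c * m ^+ 2 * h ^+ 2 * u / (q * x ^+ 2) * (n * v * v).
Proof. by move=> x0 q0; field; rewrite x0. Qed.

Lemma bad_sum_constant (a b c m h x q delta u v w : R) :
  m != 0 -> h != 0 -> x != 0 -> q != 0 -> delta != 0 -> c != 0 ->
  a * m ^+ 2 * h ^+ 2 * u / (q * x ^+ 2) *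
    (b / (x / (c * h ^+ 2)) ^+ 2 * (v * w * ((m / (delta * x * q)) ^+ 9)^-1)) =
  (u * v) * ((a * (b * c ^+ 2) * w) * delta *
    ((h ^+ 6 / m ^+ 7) * (delta ^+ 8 * (x ^+ 5 * q ^+ 8)))).
Proof. by move=> m0 h0 x0 q0 d0 c0; field; rewrite m0 h0 x0 q0 d0. Qed.

Lemma ler_threshold (c l x h n e : R) : 0 < x -> 0 < h -> 0 < c ->
  31 * c ^+ 2 * x ^- 2 * h ^+ 4 * l <= n -> e = x / (c * h ^+ 2) ->
  31 * l <= e ^+ 2 * n.
Proof.
move=> x0 h0 c0 nl ->.
have -> : (x / (c * h ^+ 2)) ^+ 2 * n = n * x ^+ 2 / (c ^+ 2 * h ^+ 4).
  by field; rewrite !gt_eqF.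
rewrite ler_pdivlMr; last by apply: mulr_gt0; rewrite exprn_gt0.
have x20 : 0 < x ^+ 2 by rewrite exprn_gt0.
move: nl; rewrite -(ler_pM2r x20); apply: le_trans.
by rewrite le_eqVlt; apply/orP; left; apply/eqP; field; rewrite gt_eqF.
Qed.

Section Bound.
Variables (S : nat) (m h n x q delta : R).
Hypotheses (S0 : (0 < S)%N) (h1 : 1 <= h) (mh : h <= m) (n0 : 0 < n).
Hypotheses (x0 : 0 < x) (x1 : x <= 1) (q0 : 0 < q) (q1 : q <= 1).
Hypotheses (d0 : 0 < delta) (d1 : delta <= 1).
Let Lam := m / (delta * x * q).
Hypothesis n_ge : 31 * 288 ^+ 2 * x ^- 2 * h ^+ 4 * (S%:R + ln Lam) <= n.
Let e := x / (72 * h ^+ 2).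
Let beta := x / (36 * h).
(** Square root of the deviation bound of one test: one copy absorbs the factor [n] in the number of
    phases, the other all remaining factors. The [288 ^+ 2] of the threshold is [16 * 72 ^+ 2]. *)
Let E := expR (- (e ^+ 2 * n / 16)).

Let m1 : 1 <= m. Proof. exact: le_trans h1 mh. Qed.
Let m0 : 0 < m. Proof. exact: lt_le_trans ltr01 m1. Qed.
Let h0 : 0 < h. Proof. exact: lt_le_trans ltr01 h1. Qed.
Let D0 : 0 < delta * x * q. Proof. by rewrite !mulr_gt0. Qed.
Let D1 : delta * x * q <= 1.
Proof.
exact: (mulr_ile1 (mulr_ge0 (ltW d0) (ltW x0)) (ltW q0) (mulr_ile1 (ltW d0) (ltW x0) d1 x1) q1).
Qed.
Let Lam1 : 1 <= Lam.
Proof. by rewrite /Lam ler_pdivlMr // mul1r; apply: le_trans D1 m1. Qed.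

Lemma Lam_ln_ge0 : 0 <= ln Lam.
Proof. exact: ln_ge0. Qed.

(** The multiplier [31] is spent as follows: [S] once against the number of sets of states,
    [30 * S >= 30] against the numerical constants, and [31 * ln Lam >= 9 * ln Lam] against the
    parameters. *)
Lemma E_le : E <= (2^-1) ^+ S * (2^-1) ^+ 30 * (Lam ^+ 9)^-1.
Proof.
have Lam0 : 0 < Lam by exact: lt_le_trans ltr01 Lam1.
have l0 := Lam_ln_ge0.
have x0' := x0; have h0' := h0.
have key : 31 * (S%:R + ln Lam) <= e ^+ 2 * n / 16.
  have -> : e ^+ 2 * n / 16 = (x / (288 * h ^+ 2)) ^+ 2 * n.
    by rewrite /e; field; rewrite gt_eqF.
  by apply: (ler_threshold x0' h0' _ n_ge); rewrite ?ltr0n.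
apply: (@le_trans _ _ (expR (- (31 * (S%:R + ln Lam))))).
  by rewrite ler_expR lerN2.
have -> : - (31 * (S%:R + ln Lam)) = - S%:R + (30%:R * (- S%:R) + 31%:R * (- ln Lam)) by ring.
rewrite !expRD !expRM_natl -mulrA ler_pM ?expR_ge0 ?mulr_ge0 ?exprn_ge0 ?expR_ge0 //.
  exact: expRN_le_half_pow.
rewrite ler_pM ?exprn_ge0 ?expR_ge0 //.
  rewrite lerXn2r ?nnegrE ?expR_ge0 ?invr_ge0 //.
  apply: (@le_trans _ _ (expR (- 1%:R))); last by have := expRN_le_half_pow 1; rewrite expr1.
  by rewrite ler_expR lerN2 ler_nat.
rewrite expRN lnK // exprVn lef_pV2 ?posrE ?exprn_gt0 //.
by rewrite ler_weXn2l.
Qed.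

(** [T] stands for the number of tests and [L] for the number of phases. The ninth power of [Lam]
    outweighs the polynomial factors in [m], [h], [1 / x] and [1 / q] and leaves a factor
    [delta]. *)
Lemma bad_sum_le (T L : R) : 0 <= T -> T <= 4 * m * 2 ^+ S -> 0 <= L -> L <= 9 * n * m * h / x ->
  L * (T * expR (- (e ^+ 2 * n / 8)) * (1 + q^-1 * (1 + beta^-1))) <= delta / 2.
Proof.
move=> T0 T4 L0 L9.
have x0' := ltW x0; have h0' := ltW h0; have q0' := ltW q0; have m0' := ltW m0.
have d0' := ltW d0; have n0' := ltW n0.
have e0 : 0 < e by rewrite divr_gt0 // mulr_gt0 // exprn_gt0.
have EE : expR (- (e ^+ 2 * n / 8)) = E * E by rewrite /E -expRD; congr expR; field.
have E0 : 0 <= E by exact: expR_ge0.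
have nE : n * E <= 16 / e ^+ 2.
  rewrite ler_pdivlMr ?exprn_gt0 //.
  have := mul_expRN_le1 (y := e ^+ 2 * n / 16); rewrite -/E => /(_ _).
  have y0 : 0 <= e ^+ 2 * n / 16 by rewrite divr_ge0 // mulr_ge0 ?sqr_ge0.
  move=> /(_ y0) hy; have -> : n * E * e ^+ 2 = 16 * (e ^+ 2 * n / 16 * E) by field.
  by rewrite -[leRHS]mulr1 ler_wpM2l.
have bq : 1 + q^-1 * (1 + beta^-1) <= 108 * h / (q * x).
  have -> : beta^-1 = 36 * h / x by rewrite /beta; field; rewrite !gt_eqF.
  rewrite ler_pdivlMr ?mulr_gt0 //.
  have -> : (1 + q^-1 * (1 + 36 * h / x)) * (q * x) = q * x + x + 36 * h.
    by field; rewrite !gt_eqF.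
  have qx1 : q * x <= 1 := mulr_ile1 (ltW q0) (ltW x0) q1 x1.
  have x1' := x1; have h1' := h1; lra.
have bq0 : 0 <= 1 + q^-1 * (1 + beta^-1).
  by rewrite addr_ge0 // mulr_ge0 ?invr_ge0 // addr_ge0 // invr_ge0 divr_ge0 // mulr_ge0.
rewrite EE.
apply: (@le_trans _ _ (9 * n * m * h / x * (4 * m * 2 ^+ S * (E * E) * (108 * h / (q * x))))).
  rewrite ler_pM ?mulr_ge0 //.
  rewrite ler_pM ?mulr_ge0 //.
  by rewrite ler_wpM2r ?mulr_ge0.
have C0 : 0 <= 9 * 4 * 108 * m ^+ 2 * h ^+ 2 * 2 ^+ S / (q * x ^+ 2).
  apply: divr_ge0; last by rewrite mulr_ge0 ?exprn_ge0.
  by rewrite mulr_ge0 ?exprn_ge0 // mulr_ge0 ?exprn_ge0 // mulr_ge0 ?exprn_ge0.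
rewrite bad_sum_factor ?gt_eqF //.
apply: (@le_trans _ _ (9 * 4 * 108 * m ^+ 2 * h ^+ 2 * 2 ^+ S / (q * x ^+ 2) *
    (16 / e ^+ 2 * ((2^-1) ^+ S * (2^-1) ^+ 30 * (Lam ^+ 9)^-1)))).
  rewrite ler_wpM2l // ler_pM ?mulr_ge0 //.
  exact: E_le.
have S2 : 2 ^+ S * (2^-1) ^+ S = 1 :> R by rewrite -exprMn divff // expr1n.
rewrite /e /Lam bad_sum_constant ?gt_eqF // S2 mul1r.
have hm : h ^+ 6 / m ^+ 7 <= 1.
  rewrite ler_pdivrMr ?exprn_gt0 // mul1r.
  apply: (@le_trans _ _ (m ^+ 6)); first by rewrite lerXn2r // nnegrE.
  by rewrite ler_weXn2l.
have dxq : delta ^+ 8 * (x ^+ 5 * q ^+ 8) <= 1.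
  apply: mulr_ile1; rewrite ?mulr_ge0 ?exprn_ge0 ?exprn_ile1 //.
  by apply: mulr_ile1; rewrite ?exprn_ge0 ?exprn_ile1.
(* [9 * 4 * 108 <= 2 ^+ 12], [16 = 2 ^+ 4] and [72 ^+ 2 <= 2 ^+ 13]. *)
have num : 9 * 4 * 108 * (16 * 72 ^+ 2) * (2^-1) ^+ 30 <= 2^-1 :> R.
  rewrite exprVn ler_pdivrMr ?exprn_gt0 //.
  have -> : (2 : R) ^+ 30 = 2 * (2 ^+ 12 * (2 ^+ 4 * 2 ^+ 13)) by rewrite -!exprD -exprS.
  rewrite mulKf // ler_pM ?mulr_ge0 ?exprn_ge0 //; first by lra.
  by rewrite ler_pM ?exprn_ge0 //; lra.
have dxq0 : 0 <= delta ^+ 8 * (x ^+ 5 * q ^+ 8) by rewrite !mulr_ge0 ?exprn_ge0.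
have hm0 : 0 <= h ^+ 6 / m ^+ 7 by rewrite divr_ge0 ?exprn_ge0.
have k0 : 0 <= 9 * 4 * 108 * (16 * 72 ^+ 2) * (2^-1) ^+ 30 :> R.
  by rewrite !mulr_ge0 ?exprn_ge0 ?invr_ge0.
rewrite [leRHS]mulrC -[leRHS]mulr1; apply: ler_pM.
- by rewrite mulr_ge0.
- by rewrite mulr_ge0.
- by rewrite ler_wpM2r.
- exact: mulr_ile1.
Qed.

Lemma n_ge_log : 1 + ln delta^-1 <= n.
Proof.
have x0' := x0; have m1' := m1; have h1' := h1.
have ld : ln delta^-1 <= ln Lam.
  rewrite ler_ln ?posrE ?invr_gt0 // ?divr_gt0 //.
  rewrite /Lam ler_pdivlMr // -mulrA mulKf ?gt_eqF //.
  by apply: le_trans m1; exact: (mulr_ile1 (ltW x0) (ltW q0) x1 q1).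
have S1 : 1 <= S%:R :> R by rewrite ler1n.
have l0 := Lam_ln_ge0.
apply: le_trans n_ge.
apply: (@le_trans _ _ (S%:R + ln Lam)); first by rewrite lerD.
rewrite ler_peMl ?addr_ge0 //.
have h4 : 1 <= h ^+ 4 by rewrite exprn_ege1.
have x2 : 1 <= x ^- 2.
  by rewrite invf_ge1 ?exprn_gt0 // exprn_ile1 // (ltW x0).
apply: mulr_ege1 => //; apply: mulr_ege1 => //; apply: mulr_ege1; rewrite ?exprn_ege1 ?ler1n //.
Qed.

Lemma expRN_le_delta : expR (- n) <= delta / 2.
Proof.
apply: (@le_trans _ _ (expR (- (1 + ln delta^-1)))).
  by rewrite ler_expR lerN2 n_ge_log.
rewrite opprD expRD mulrC lnV ?posrE // opprK lnK ?posrE // ler_pM2l //.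
by have := expRN_le_half_pow 1; rewrite expr1.
Qed.

End Bound.

(** [2 ^+ D] is at most [expR D], and the other factor is at most [expR (- 2 * D)]. *)
Lemma potential_le (D L : nat) (p : R) : 0 <= p -> p <= 1 -> 2 * D%:R <= L%:R * (p / 2) ->
  2 ^+ D * (1 - p / 2) ^+ L <= expR (- D%:R).
Proof.
move=> p0 p1 DL.
have h1 : (1 - p / 2) ^+ L <= expR (- (L%:R * (p / 2))).
  rewrite -[in leRHS]mulrN expRM_natl lerXn2r ?nnegrE ?expR_ge0 //; first lra.
  exact: expR_ge1Dx.
have h2 : 2 ^+ D <= expR D%:R :> R.
  rewrite -[D%:R]mulr1 expRM_natl lerXn2r ?nnegrE ?expR_ge0 //.
  exact: (expR_ge1Dx 1).
apply: (@le_trans _ _ (expR D%:R * expR (- (L%:R * (p / 2))))).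
  by rewrite ler_pM ?exprn_ge0 //; lra.
by rewrite -expRD ler_expR; lra.
Qed.

End Numerics.

(** * Lower bound on the exploration probability *)

Section Final.
Context (R : realType) (S A H' : nat).
Local Notation H := H'.+1.
Context d (M : measurableType d) (P : probability M R).
Context (mdl : M -> mdp_model R S A H) (rv : nat -> R).
Hypothesis reg : regular_prior mdl rv.
Local Notation policy := (policy S A H).
Local Notation ledger := (ledger S A H).
Context (nlrn : nat) (eps : R).
Local Notation q := (q_pun P mdl rv eps).
Local Notation r := (r_alt P mdl rv).

Lemma lik_ex_nil U : lik_ex P mdl (U, [::]) = 1.
Proof.
by rewrite /lik_ex; under eq_Ex do rewrite /ledger_lik big_nil; rewrite Ex_cst.
Qed.

(** At the empty ledger the posterior is the prior, and mean rewards are at most [1]. *)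
Lemma r_alt_le1 (t : tri S A H) : r <= 1.
Proof.
have l1 : lik_ex P mdl ([set: tri S A H]%SET, [::]) = 1 := lik_ex_nil _.
have := r_alt_le (P := P) reg (lam := ([set: tri S A H]%SET, [::])) (t := t).
rewrite l1 mulr1 => /(_ ltr01); rewrite finset.in_setT => /(_ isT) h.
apply: (le_trans h); rewrite -[leRHS](Ex_cst P); apply: Ex_le => [||w].
- by apply: bmfM; [exact: (bmf_rmean reg)|exact: (bmf_lik reg)].
- exact: bmf_cst.
- by rewrite /ledger_lik big_nil mulr1 (rmean_le1 reg).
Qed.

Lemma q_pun_le1 : q <= 1.
Proof.
have l1 : lik_ex P mdl (censored_ledger ([::] : rawledger S A H)) = 1 := lik_ex_nil _.
have := q_pun_le P reg nlrn eps [::]; rewrite l1 mulr1 => /le_trans; apply.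
by rewrite -l1; apply: (lik_in_le P reg); exact: measurable_punish.
Qed.

Context (N : nat) (pol : nat -> ledger -> policy) (rho e beta p : R).
Hypotheses (N0 : (0 < N)%N) (q0 : 0 < q).
Hypotheses (e0 : 0 <= e) (e1 : e <= 1) (beta0 : 0 < beta) (p0 : 0 <= p) (p1 : p <= 1).
Hypothesis good : forall w rl s (o : 'I_N), unfinished mdl nlrn rho w rl ->
  0 < hal_prob P mdl rv nlrn eps rl s -> ~~ unreliable P mdl rv nlrn eps N pol e beta s ->
  ~~ deviates rv nlrn e (honest_ledger nlrn rl) (mdl w) ->
  p <= hit (mdl w) (pol (kidx (size rl).+1 o) s) (under_explored nlrn rl).

Let muv := reg_valid reg.

(** [progress] is started at the empty raw ledger and integrated; by linearity each of the [L]
    phases costs at most [bad_bound]. *)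
Lemma explore_prob_ge K L : (L * N <= K)%N ->
  ((1 - (potential nlrn p L ([::] : rawledger S A H) + L%:R * bad_bound P mdl rv nlrn eps e beta))%:E <=
   explore_prob P mdl rv N nlrn eps pol rho nlrn K)%E.
Proof.
move=> LK; set b := bad_bound _ _ _ _ _ _ _.
have h := @explore_prob_unfinished _ _ _ _ _ _ P _ _ reg nlrn eps N pol N0 rho K L q0 LK.
rewrite EFinB leeBlDr //; apply: le_trans h _; rewrite leeD2l //.
pose bp w := bad_phase P mdl rv nlrn eps N pol e beta w.
pose rn j w := run P mdl rv nlrn eps N pol (mdl w) j 1 [::] (bp w).
have bp0 w rl : (0 <= bp w rl)%E by exact: (bad_phase_ge0 P reg).
have rn0 j w : (0 <= rn j w)%E by exact: (run_ge0 P reg _ _ _ _ (muv w)).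
have mrn j : measurable_fun setT (rn j).
  apply: (measurable_run P reg nlrn eps N pol j bp0) => rl.
  apply: emeasurable_funD.
    by apply/measurable_EFinP; case: (bmf_dev reg nlrn e (honest_ledger nlrn rl)).
  by [].
have pot0 := potential_ge0 nlrn p1 L ([::] : rawledger S A H).
apply: (@le_trans _ _ (\int[P]_w ((potential nlrn p L ([::] : rawledger S A H))%:E + \sum_(j < L) rn j w))%E).
  apply: ge0_le_integral => //.
  - by move=> w _; apply: (run_ge0 P reg _ _ _ _ (muv w)) => rl; rewrite lee_fin.
  - apply: (measurable_run P reg nlrn eps N pol L
      (F := fun w rl => (unfinished mdl nlrn rho w rl)%:R%:E)) => [w rl|rl]; first by rewrite lee_fin.
    by apply: measurable_bool; exact: (measurable_unfinished reg).
  - by apply: emeasurable_funD => //; exact: emeasurable_sum.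
  move=> w _; have := progress reg N0 p0 p1 good L w [::].
  rewrite (bad_totalE P reg) => /le_trans; apply; rewrite leeD2r // lee_fin.
  by rewrite ler_piMl //; case: (unfinished _ _ _ _ _).
rewrite ge0_integralD //; last 2 first.
- by move=> w _; apply: sume_ge0.
- exact: emeasurable_sum.
rewrite integral_cst //= probability_setT mule1 EFinD leeD2l //.
rewrite ge0_integral_sum //.
apply: (@le_trans _ _ (\sum_(j < L) b%:E)%E).
  by apply: lee_sum => j _; exact: (integral_bad_phase reg nlrn pol N0 e0 e1 beta0 q0).
by rewrite sumEFin sumr_const card_ord mulr_natl.
Qed.

End Final.

(** * Phase length and number of phases *)

Section Tuning.
Variable R : realType.

(** With [y = x / h <= x], the losses are at most [x / 18 + x / 18 + x / 36 + x / 36] and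
    [3 * y / 36], hence [x / 4] together, while [x / 2] is available. *)
Lemma margin_le (h x q k : R) : 1 <= h -> 0 < x -> 0 < q -> 18 * h / (q * x) <= k ->
  h * (x / (2 * h)) <= x - h * (2 * (x / (72 * h ^+ 2))) - x / (36 * h) - h * q^-1 / k -
    h * (x / (18 * h) + 2 * (x / (72 * h ^+ 2))) - h * (h * (2 * (x / (72 * h ^+ 2)))) -
    h * (x / (36 * h)).
Proof.
move=> h1 x0 q0 hk.
have h0 : 0 < h by exact: lt_le_trans ltr01 h1.
have k0 : 0 < k by apply: lt_le_trans hk; rewrite !mulr_gt0 ?invr_gt0 ?mulr_gt0.
have E : h * q^-1 / k <= x / 18.
  rewrite ler_pdivrMr //.
  rewrite ler_pdivrMr ?mulr_gt0 // in hk.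
  have -> : h * q^-1 = 18 * h / q / 18 by field; rewrite gt_eqF.
  rewrite ler_pdivrMr // ler_pdivrMr //; nra.
pose y := x / h.
have y0 : 0 < y by rewrite divr_gt0.
have yx : y <= x by rewrite ler_pdivrMr // ler_peMr // ltW.
have -> : h * (x / (2 * h)) = x / 2 by field; rewrite gt_eqF.
have -> : h * (2 * (x / (72 * h ^+ 2))) = y / 36 by rewrite /y; field; rewrite gt_eqF.
have -> : x / (36 * h) = y / 36 by rewrite /y; field; rewrite gt_eqF.
have -> : h * (x / (18 * h) + 2 * (x / (72 * h ^+ 2))) = x / 18 + y / 36.
  by rewrite /y; field; rewrite gt_eqF.
have -> : h * (y / 36) = x / 36 by rewrite /y; field; rewrite gt_eqF.
lra.
Qed.

(** The bound on [N] makes the mixture loss at most [x / 18]; the bound on [L] makes [L * (p / 2)],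
    with [p = x / (2 * h)], at least twice the initial deficit [n * m]. Rounding raises [8] to [9]
    and [18] to [20], and [180 = 9 * 20]. *)
Lemma natr_phases (h x q n m : R) : 1 <= h -> 0 < x -> x <= 1 -> 0 < q -> q <= 1 ->
  1 <= m -> 1 <= n -> exists N L : nat,
  [/\ (1 < N)%N, 18 * h / (q * x) <= N.-1%:R, 8 * n * m * h / x <= L%:R,
      L%:R <= 9 * n * m * h / x &
      L%:R * N%:R <= 180 * n * m * h ^+ 2 / (q * x ^+ 2)].
Proof.
move=> h1 x0 x1 q0 q1 m1 n1.
have h0 : 0 < h by exact: lt_le_trans ltr01 h1.
have m0 : 0 < m by exact: lt_le_trans ltr01 m1.
have n0 : 0 < n by exact: lt_le_trans ltr01 n1.
have qx0 : 0 < q * x by exact: mulr_gt0.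
have hqx : 1 <= h / (q * x).
  by rewrite ler_pdivlMr // mul1r; apply: le_trans h1; exact: (mulr_ile1 (ltW q0) (ltW x0)).
have nmx : 1 <= n * m * h / x.
  by rewrite ler_pdivlMr // mul1r (le_trans x1) // !mulr_ege1.
set u := h / (q * x) in hqx *; set v := n * m * h / x in nmx *.
have -> : 18 * h / (q * x) = 18 * u by rewrite /u; field; rewrite !gt_eqF.
have -> : 8 * n * m * h / x = 8 * v by rewrite /v; field; rewrite !gt_eqF.
have -> : 9 * n * m * h / x = 9 * v by rewrite /v; field; rewrite !gt_eqF.
have -> : 180 * n * m * h ^+ 2 / (q * x ^+ 2) = (9 * v) * (20 * u).
  by rewrite /u /v; field; rewrite !gt_eqF.
have /andP[N1 N2] : (Num.trunc (18 * u))%:R <= 18 * u < (Num.trunc (18 * u)).+1%:R.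
  by apply: truncn_itv; lra.
have /andP[L1 L2] : (Num.trunc (8 * v))%:R <= 8 * v < (Num.trunc (8 * v)).+1%:R.
  by apply: truncn_itv; lra.
exists (Num.trunc (18 * u)).+2, (Num.trunc (8 * v)).+1.
have L3 : (Num.trunc (8 * v)).+1%:R <= 9 * v.
  by rewrite -natr1; lra.
split=> //; [exact: ltW|exact: ltW|].
rewrite ler_pM //; rewrite -2!natr1; lra.
Qed.

End Tuning.

(** There are [2 * k + k * 2 ^ S + 2 ^ S] tests, with [k = S * A * H'.+1]. *)
Lemma card_test_le (R : realType) (S A H' : nat) : (0 < S * A)%N ->
  #|{: test S A H'}|%:R <= 4 * (S * A * H'.+1)%:R * 2 ^+ S :> R.
Proof.
move=> SA0; rewrite -natrX -!natrM ler_nat.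
have card_set : #|{: {set 'I_S}}| = (2 ^ S)%N.
  by rewrite -(cardsT {set 'I_S}) -powersetT card_powerset cardsT card_ord.
rewrite !card_sum !card_prod card_bool !card_ord card_set.
have : (0 < 2 ^ S)%N by rewrite expn_gt0.
have : (0 < S * A * H'.+1)%N by rewrite muln_gt0 SA0.
move: (S * A * H'.+1)%N (2 ^ S)%N => k l; nia.
Qed.

Theorem theorem3 (R : realType) :
  exists c1 c2 : R, 0 < c1 /\ 0 < c2 /\
  forall (S A H : nat) (d : measure_display) (M : measurableType d)
         (P : probability M R) (mdl : M -> mdp_model R S A H) (rv : nat -> R)
         (rho delta : R),
    (0 < S)%N -> (0 < A)%N -> (0 < H)%N ->
    injective rv -> (forall n, 0 <= rv n <= 1) ->
    (forall w, model_valid (mdl w)) ->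
    (forall x a h n, measurable_fun [set: M] (fun w => rew (mdl w) x a h n)) ->
    (forall x a h y, measurable_fun [set: M] (fun w => trans (mdl w) x a h y)) ->
    (forall y, measurable_fun [set: M] (fun w => init (mdl w) y)) ->
    0 < rho <= 1 -> 0 < delta <= 1 ->
    let ralt := r_alt P mdl rv in
    let eps_pun := ralt * rho / (18 * H%:R) in
    let qpun := q_pun P mdl rv eps_pun in
    0 < ralt -> 0 < qpun ->
    forall n : nat,
      c1 * rho ^-2 * ralt ^-2 * H%:R ^+ 4 *
        (S%:R + ln ((S * A * H)%:R / (delta * rho * ralt * qpun))) <= n%:R ->
      exists Nph : nat, (0 < Nph)%N /\
        forall K : nat,
          c2 * n%:R * qpun^-1 * rho ^-3 * ralt ^-3 * (S * A)%:R * H%:R ^+ 4 <= K%:R ->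
          forall pol : nat -> ledger S A H -> policy S A H,
            best_responses P mdl rv Nph n eps_pun pol ->
            ((1 - delta)%:E <= explore_prob P mdl rv Nph n eps_pun pol rho n K)%E.
Proof.
(* The first constant is what [E_le] consumes, the second bounds the number of episodes in
   [natr_phases]. *)
exists (31 * 288 ^+ 2), 180; split; first by rewrite mulr_gt0 // exprn_gt0.
split => //.
move=> S A [//|H'] d M P mdl rv rho delta S0 A0 H0 _ rv01 valid mrew mtrans minit.
set H := H'.+1 => /andP[rho0 rho1] /andP[d0 d1] ralt eps qpun ralt0 qpun0 n n_ge.
have reg : regular_prior mdl rv by split.
have r1 : ralt <= 1 by exact: (r_alt_le1 P reg (Ordinal S0, Ordinal A0, ord0)).
have q1 : qpun <= 1 by exact: (q_pun_le1 P reg 0).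
pose x := ralt * rho.
have x0 : 0 < x by exact: mulr_gt0.
have x1 : x <= 1 by exact: (mulr_ile1 (ltW ralt0) (ltW rho0) r1 rho1).
pose h : R := H%:R; pose m : R := (S * A * H)%:R.
have h1 : 1 <= h by rewrite /h ler1n.
have h0 : 0 < h by exact: lt_le_trans ltr01 h1.
have mh : h <= m by rewrite /h /m ler_nat leq_pmull // muln_gt0 S0.
have m1 : 1 <= m by exact: le_trans mh.
have m0 : 0 < m by exact: lt_le_trans ltr01 m1.
have n_ge' : 31 * 288 ^+ 2 * x ^- 2 * h ^+ 4 * (S%:R + ln (m / (delta * x * qpun))) <= n%:R.
  move: n_ge; congr (_ <= _).
  have -> : delta * rho * ralt * qpun = delta * x * qpun by rewrite /x; ring.
  by rewrite /x exprMn (invfM (ralt ^+ 2)) -/h -/m; ring.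
have lnL : 0 <= ln (m / (delta * x * qpun)).
  by exact: (Lam_ln_ge0 h1 mh x0 x1 qpun0 q1 d0 d1).
have n1R : 1 <= n%:R :> R.
  apply: le_trans (n_ge_log S0 h1 mh x0 x1 qpun0 q1 d0 d1 n_ge').
  by rewrite lerDl ln_ge0 // invf_ge1.
have n0 : (0 < n)%N by rewrite -(ltr0n R); exact: lt_le_trans ltr01 n1R.
have [N [L [N1 N_ge L_ge L_le LN_le]]] := natr_phases h1 x0 x1 qpun0 q1 m1 n1R.
exists N; split => [|K K_ge pol br]; first exact: ltnW.
pose e := x / (72 * h ^+ 2); pose beta := x / (36 * h); pose p := x / (2 * h).
have LK : (L * N <= K)%N.
  rewrite -(ler_nat R) natrM; apply: (le_trans LN_le); apply: le_trans K_ge.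
  (* The [L] phases fit into [K] episodes with a spare factor [h / x]. *)
  have hx : 1 <= h / x by rewrite ler_pdivlMr // mul1r (le_trans x1).
  have -> : 180 * n%:R * qpun^-1 * rho ^- 3 * ralt ^- 3 * (S * A)%:R * H%:R ^+ 4 =
      180 * n%:R * m * h ^+ 2 / (qpun * x ^+ 2) * (h / x).
    by rewrite /m /x (natrM _ (S * A)) -/h; field; rewrite !gt_eqF.
  apply: ler_peMr => //; apply: divr_ge0; last by rewrite mulr_ge0 ?exprn_ge0 // ltW.
  by rewrite mulr_ge0 ?exprn_ge0 ?(ltW h0) // mulr_ge0 ?(ltW m0) // mulr_ge0.
have e0 : 0 <= e by rewrite divr_ge0 ?(ltW x0) // mulr_ge0 // exprn_ge0 // ltW.
have e1 : e <= 1.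
  rewrite ler_pdivrMr ?mulr_gt0 ?exprn_gt0 // mul1r (le_trans x1) //.
  by rewrite mulr_ege1 ?exprn_ege1 // ler1n.
have beta0 : 0 < beta by rewrite divr_gt0 // mulr_gt0.
have p0 : 0 <= p by rewrite divr_ge0 ?(ltW x0) // mulr_ge0 // ltW.
have p1 : p <= 1.
  by rewrite ler_pdivrMr ?mulr_gt0 // mul1r (le_trans x1) // mulr_ege1 // ler1n.
have eps0 : 0 <= eps by rewrite /eps divr_ge0 ?(ltW x0) // mulr_ge0.
have margin := margin_le h1 x0 qpun0 N_ge.
have good := hit_good reg n0 N1 e0 eps0 qpun0 ralt0 p1 br margin.
apply: le_trans (explore_prob_ge reg (ltnW N1) qpun0 e0 e1 beta0 p0 p1 good LK).
(* Half of [delta] goes to the potential after [L] phases, half to the bad phases. *)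
rewrite lee_fin lerD2l lerN2 [leRHS]splitr lerD //.
- rewrite /potential /deficit /=.
  under eq_bigr do rewrite subn0.
  rewrite sum_nat_const !card_prod !card_ord.
  have mn : (n%:R : R) <= (S * A * H * n)%:R.
    by rewrite ler_nat leq_pmull // !muln_gt0 S0 A0.
  apply: (@le_trans _ _ (expR (- (S * A * H * n)%:R))).
    apply: potential_le => //; rewrite natrM -/m.
    have -> : 2 * (m * n%:R) = 8 * n%:R * m * h / x * (p / 2).
      by rewrite /p; field; rewrite !gt_eqF.
    by rewrite ler_wpM2r // divr_ge0.
  apply: (@le_trans _ _ (expR (- n%:R))); first by rewrite ler_expR lerN2.
  exact: (expRN_le_delta S0 h1 mh x0 x1 qpun0 q1 d0 d1 n_ge').
rewrite /bad_bound /test_bound.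
apply: (bad_sum_le S0 h1 mh (lt_le_trans ltr01 n1R) x0 x1 qpun0 q1 d0 d1 n_ge') => //.
by apply: card_test_le; rewrite muln_gt0 S0.
Qed.
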